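(* Let $q\in L^2(\mathbb{R})$ (complex-valued) and let $s_{11}(\lambda)$ be the reciprocal of the transmission coefficient of the modified Zakharov–Shabat spectral problem $$\psi_{1,x}=-i\lambda^2\psi_1+\lambda q\,\psi_2,\qquad \psi_{2,x}=i\lambda^2\psi_2-\lambda q^*\psi_1$$ associated to the derivative nonlinear Schrödinger equation. Then: (1) One has the formal expansion $\ln s_{11}(\lambda)=\sum_{j=1}^{\infty}b_{2j}(\lambda)$, where each $b_{2j}(\lambda)$ is a formal linear combination of connected integrals of the form $$(-1)^{j}\int_{\Sigma_j}\lambda^{2j}\prod_{k=1}^{j}q(y_k)q^*(x_k)e^{2i\lambda^2(y_k-x_k)}\,dx_1dy_1\cdots dx_jdy_j ,$$ $\Sigma_j$ being domains on which $x_k<y_k$ for all $k\le j$. (2) The following hold: $$\ln s_{11}(\lambda)\sim -\frac{i}{2}\|q\|^2_{L^2(\mathbb{R})},\qquad \lambda\to\infty,$$ and $$s_{11}(\lambda)\sim e^{-\frac{i}{2}\|q\|^2_{L^2(\mathbb{R})}},\qquad \lambda\to\infty .$$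
   Context: The star denotes complex conjugation and $\lambda\in\mathbb{C}$ is the spectral parameter, with $\operatorname{Im}\lambda^2>0$ (the region in which $s_{11}$ is defined for $q\in L^2$). $s_{11}(\lambda)$: let $\psi_l$ be the Jost solution of the spectral problem with $\psi_l\sim (e^{-i\lambda^2x},0)^{T}$ as $x\to-\infty$; then $\psi_l\sim(s_{11}(\lambda)e^{-i\lambda^2x},\,s_{21}(\lambda)e^{i\lambda^2x})^T$ as $x\to+\infty$. Equivalently $s_{11}(\lambda)=\det(\psi_l,\varphi)$, where $\varphi$ is the solution with $\varphi\sim e^{i\lambda^2x}(0,1)^T$ as $x\to+\infty$. The transmission coefficient is $s_{11}(\lambda)^{-1}$. Formal expansion: $s_{11}=1+\sum_{j\ge1}s_{2j}$ formally, where $s_{2j}$ is the part homogeneous of degree $2j$ in $(q,q^* )$; $\ln s_{11}=\sum_{j\ge 1} b_{2j}$ is the formal logarithm, with $b_{2j}$ its part homogeneous of degree $2j$ in $(q,q^* )$. Connected integrals: each domain $\Sigma_j$ is given by a strict total ordering of the variables, with $x_1<\dots<x_j$, $y_1<\dots<y_j$ and $x_k<y_k$ for all $k$. It is encoded by the word in the letters $X,Y$ obtained by listing the variables in increasing order, writing $X$ for each $x_k$ and $Y$ for each $y_k$. The letters $X$ and $Y$ are paired as opening and closing parentheses. The integral is called connected if the first $X$ is paired with the last $Y$. $f(\lambda)\sim c$ as $\lambda\to\infty$, for a constant $c$, means $f(\lambda)\to c$.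
   Formalization: In (2), λ→∞ is taken with Im λ² ≥ δ|λ²| for each δ>0 rather than in all of Im λ²>0, since unrestricted convergence fails for general q∈L² (lacunary q=εΣ2^{-k/2}e^{i2^k x}φ); ln s₁₁ there is the sum of the series in (1). *)

(* Defs.v *)
From HB Require Import structures.
From mathcomp Require Import all_boot all_order all_algebra complex.
From mathcomp Require Import all_classical all_reals all_analysis.
Set Implicit Arguments.
Unset Strict Implicit.
Unset Printing Implicit Defensive.
Import Order.TTheory GRing.Theory Num.Theory.
Import numFieldNormedType.Exports.
Local Open Scope classical_set_scope.
Local Open Scope ring_scope.

(* [R[i]^o] is [R[i]] with the topology of the modulus. *)
Definition cvgC (R : realType) (T : Type) (f : T -> R[i]) (F : set_system T)
    (l : R[i]) : Prop :=
  (f : T -> R[i]^o) @ F --> (l : R[i]^o).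

Definition cexp (R : realType) (z : R[i]) : R[i] :=
  (expR (complex.Re z))%:C%C * (cos (complex.Im z) +i* sin (complex.Im z))%C.

Definition cint (R : realType) (D : set R) (f : R -> R[i]) : R[i] :=
  ((\int[lebesgue_measure]_(x in D) complex.Re (f x)) +i*
   (\int[lebesgue_measure]_(x in D) complex.Im (f x)))%C.

Definition Lnorm2 (R : realType) (q : R -> R[i]) : \bar R :=
  ('N[@lebesgue_measure R]_(2%:E) [ (fun x => (complex.Re `|q x|)%:E) ])%E.

Definition L2 (R : realType) (q : R -> R[i]) : Prop :=
  [/\ measurable_fun [set: R] (fun x => complex.Re (q x)),
      measurable_fun [set: R] (fun x => complex.Im (q x)) &
      (Lnorm2 q < +oo)%E].

Definition L2norm (R : realType) (q : R -> R[i]) : R := fine (Lnorm2 q).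

(* For [q] in L^2 the system only holds almost everywhere; its solutions are
   the absolutely continuous ones, i.e. those of the integrated system. *)
Definition zs_solution (R : realType) (q : R -> R[i]) (lambda : R[i])
    (psi1 psi2 : R -> R[i]) : Prop :=
  [/\ continuous (psi1 : R -> R[i]^o),
      continuous (psi2 : R -> R[i]^o) &
      forall a b : R, a <= b ->
        psi1 b - psi1 a = cint `[a, b] (fun x =>
          - 'i%C * lambda ^+ 2 * psi1 x + lambda * q x * psi2 x) /\
        psi2 b - psi2 a = cint `[a, b] (fun x =>
          'i%C * lambda ^+ 2 * psi2 x - lambda * (q x)^*%C * psi1 x)].

(* psi ~ (exp(-i lambda^2 x), 0) as x --> -oo, that is
   exp(i lambda^2 x) psi --> (1, 0). *)
Definition left_jost (R : realType) (q : R -> R[i]) (lambda : R[i])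
    (psi1 psi2 : R -> R[i]) : Prop :=
  [/\ zs_solution q lambda psi1 psi2,
      cvgC (fun x => cexp ('i%C * lambda ^+ 2 * x%:C%C) * psi1 x) -oo 1 &
      cvgC (fun x => cexp ('i%C * lambda ^+ 2 * x%:C%C) * psi2 x) -oo 0].

(* s11 is read off the first component at +oo only: for a general [q] in L^2
   and Im lambda^2 > 0 the coefficient s21 of the growing exponential
   in the second component need not exist. *)
Definition is_s11 (R : realType) (q : R -> R[i]) (lambda s : R[i]) : Prop :=
  exists psi1 psi2 : R -> R[i],
    left_jost q lambda psi1 psi2 /\
    cvgC (fun x => cexp ('i%C * lambda ^+ 2 * x%:C%C) * psi1 x) +oo s.

Definition s11 (R : realType) (q : R -> R[i]) (lambda : R[i]) : R[i] :=
  get [set s : R[i]^o | is_s11 q lambda s].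

(* The formal expansion s11 = 1 + s_2 + s_4 + ... into parts homogeneous in
   (q, q^* ): [s j] is s_{2j}, and replacing q by eps q (eps real) multiplies
   s_{2j} by eps^(2j), so the s_{2j} are the coefficients of the expansion to
   all orders of s11 for the potential eps q as eps --> 0. *)
Definition homogeneous_expansion (R : realType) (q : R -> R[i])
    (lambda : R[i]) (s : nat -> R[i]) : Prop :=
  s 0%N = 1 /\
  forall N : nat,
    cvgC (fun eps : R =>
      (s11 (fun x => eps%:C%C * q x) lambda
        - \sum_(j < N.+1) s j * eps%:C%C ^+ j.*2) / eps%:C%C ^+ N.*2)
      (0 : R)^' 0.

Definition s_hom (R : realType) (q : R -> R[i]) (lambda : R[i])
    : nat -> R[i] :=
  get [set s : nat -> R[i]^o | homogeneous_expansion q lambda s].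

(* The coefficient of X^j in ln (1 + u) = \sum_n (-1)^(n+1) u^n / n, where
   u = \sum_(i >= 1) s_i X^i; only n <= j and i <= j contribute to it. *)
Definition formal_log (F : fieldType) (s : nat -> F) (j : nat) : F :=
  \sum_(1 <= n < j.+1) (-1) ^+ n.+1 / n%:R *
    ((\sum_(1 <= i < j.+1) s i *: 'X^i : {poly F}) ^+ n)`_j.

(* [b_hom q lambda j] is b_{2j}. *)
Definition b_hom (R : realType) (q : R -> R[i]) (lambda : R[i]) (j : nat)
    : R[i] :=
  formal_log (s_hom q lambda) j.

Definition ln_s11 (R : realType) (q : R -> R[i]) (lambda : R[i]) : R[i] :=
  lim (((fun n : nat => \sum_(1 <= j < n.+1) b_hom q lambda j)
          : nat -> R[i]^o) @ \oo).

Definition ln_s11_converges (R : realType) (q : R -> R[i]) (lambda : R[i])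
    : Prop :=
  cvg (((fun n : nat => \sum_(1 <= j < n.+1) b_hom q lambda j)
          : nat -> R[i]^o) @ \oo).

Notation letterX := true.
Notation letterY := false.

(* Position in [w] of the [k]-th occurrence (from 0) of [a]. *)
Definition occ (a : bool) (w : seq bool) (k : nat) : nat :=
  nth (size w) [seq i <- iota 0 (size w) | nth letterX w i == a] k.

(* The words listing x_1 < ... < x_j, y_1 < ... < y_j with x_k < y_k. *)
Definition admissible (j : nat) (w : seq bool) : bool :=
  [&& count_mem letterX w == j, count_mem letterY w == j &
      all (fun k => occ letterX w k < occ letterY w k)%N (iota 0 j)].

Definition balanced (w : seq bool) : bool :=
  all (fun n => count_mem letterY (take n w) <= count_mem letterX (take n w))%N
    (iota 0 (size w)) &&
  (count_mem letterX w == count_mem letterY w).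

Definition paired (w : seq bool) (i k : nat) : bool :=
  [&& (i < k < size w)%N, nth letterY w i == letterX,
      nth letterX w k == letterY & balanced (drop i.+1 (take k w))].

Definition connected_word (j : nat) (w : seq bool) : bool :=
  admissible j w && paired w (occ letterX w 0) (occ letterY w j.-1).

(* The variables x_k, y_k in the order in which they occur in [w]. *)
Definition listing (T : Type) (x y : nat -> T) (w : seq bool) : seq T :=
  [seq (if nth letterX w i
        then x (count_mem letterX (take i w))
        else y (count_mem letterY (take i w))) | i <- iota 0 (size w)].

(* The integral over R^n, as an iterated integral (all the integrals below
   converge absolutely for [q] in L^2 and Im lambda^2 > 0). *)
Fixpoint cint_iter (R : realType) (n : nat) (f : seq R -> R[i]) : R[i] :=
  if n is m.+1 then
    cint [set: R] (fun t => cint_iter m (fun v => f (t :: v)))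
  else f [::].

(* The variables are integrated as v = (x_1, y_1, ..., x_j, y_j). *)
Definition word_integral (R : realType) (q : R -> R[i]) (lambda : R[i])
    (j : nat) (w : seq bool) : R[i] :=
  (-1) ^+ j * cint_iter j.*2 (fun v : seq R =>
    let x k := v`_(k.*2) in
    let y k := v`_(k.*2.+1) in
    if sorted <%R (listing x y w) then
      lambda ^+ j.*2 *
      \prod_(k < j) (q (y k) * (q (x k))^*%C *
        cexp (2%:R * 'i%C * lambda ^+ 2 * (y k - x k)%:C%C))
    else 0).

(* lambda --> oo with lambda^2 in a closed sector of the open upper half-plane.
   The restriction is necessary in L^2: for q in L^1 and L^2, s11 is continuous
   up to Im lambda^2 = 0, and |s11|^2 + |s21|^2 = 1 for real lambda, where
   s21 need not tend to 0 as lambda --> oo. *)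
Definition sector_oo (R : realType) (delta : R) : set_system R[i] :=
  [set A | exists M : R, forall lambda : R[i],
    M < complex.Re `|lambda| ->
    delta * complex.Re `|lambda ^+ 2| <= complex.Im (lambda ^+ 2) ->
    A lambda].

(* Main.v *)
(* Write zeta = lambda^2, a_X(s) = q^*(s) e^(-2 i zeta s) and
   a_Y(s) = q(s) e^(2 i zeta s).  The ratio V of the two (rescaled) components
   of the left Jost solution solves the Riccati equation
   V' = lambda (a_X + a_Y V^2), V(-oo) = 0, so that
   ln s11 = - lambda \int a_Y V.  By degree in (q, q^* ), V is a series of
   terms U_n of odd degree 2n+1, with U_(n+1)' = a_Y \sum_(k <= n) U_k U_(n-k);
   it converges when |lambda|^2 M^2 is small, M being the supremum of
   t |-> \int_(s < t) e^(-2 Im zeta (t - s)) |q(s)| ds.  Rescaling q to eps q,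
   this gives the expansion of s11 to all orders, and identifies b_(2n+2) with
   - lambda^(2n+2) \int a_Y U_n.
   By the shuffle product formula U_n is a sum of iterated integrals over words
   all of whose nonempty prefixes have more X's than Y's; appending the letter
   Y of the last integration gives exactly connected words.
   As lambda --> oo in a sector, |lambda|^2 M^2 --> 0, hence
   \sum_(j >= 2) b_(2j) --> 0.  For b_2 one replaces q^* by a mollification g
   with g' in L^2 and integrates by parts, which produces
   - (i/2) \int q g up to an error O(1 / Im zeta). *)
Require Import Defs.
From HB Require Import structures.
From mathcomp Require Import all_boot all_order all_algebra complex.
From mathcomp Require Import all_classical all_reals all_analysis.
From mathcomp Require Import measurable_realfun ring lra zify.
Set Implicit Arguments.
Unset Strict Implicit.
Unset Printing Implicit Defensive.
Import Order.TTheory GRing.Theory Num.Theory.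
Import numFieldNormedType.Exports.
Local Open Scope classical_set_scope.
Local Open Scope ring_scope.

(** * Complex modulus and exponential *)

(** Three obstacles shape the proof. For $q$ in $L^2$ the Jost solutions are only absolutely
    continuous, so the whole calculus (product and exponential rules, the system itself, the
    Wronskian) runs on the integral relation [prim], obtained from second-order defect bounds on
    short intervals. Next, [s11] and [s_hom] are choices made by [get]: exhibiting a Jost solution
    or an expansion settles nothing until uniqueness is proved as well. Finally, Cauchy-Schwarz
    gives $M^2\le\|q\|^2/(2w)$ with $w=\operatorname{Im}\lambda^2$, which in a sector only bounds
    $|\lambda|^2M^2$; smallness comes from the local mass [wsq], uniformly small for large $w$
    because the integral of $|q|^2$ is absolutely continuous. Working with $\ln s_{11}$ from the
    start means that disconnected integrals never arise and nothing has to cancel. The terms $U_n$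
    are majorized through the Catalan recurrence, whence growth $4^n$ and the threshold 32. The
    mollifier has a one-sided exponential kernel: its derivative is an explicit multiple of the
    defect, and the same weighted averages estimate everything. *)

Section Modulus.
Context {R : realType}.
Implicit Types z w : R[i].

(** The norm on [R[i]] is itself [R[i]]-valued; integrals, suprema and real limits need it in
    [R]. *)
Definition cabs z : R := complex.Re `|z|.

Lemma cabsE z : `|z| = (cabs z)%:C%C.
Proof. by rewrite /cabs normc_def. Qed.

Lemma cabs_sqrt z : cabs z = Num.sqrt (complex.Re z ^+ 2 + complex.Im z ^+ 2).
Proof. by rewrite /cabs normc_def. Qed.

Lemma cabs_ge0 z : 0 <= cabs z.
Proof. by rewrite cabs_sqrt sqrtr_ge0. Qed.

Lemma sqr_cabs z : cabs z ^+ 2 = complex.Re z ^+ 2 + complex.Im z ^+ 2.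
Proof. by rewrite cabs_sqrt sqr_sqrtr// addr_ge0 ?sqr_ge0. Qed.

Lemma cabs0 : cabs 0 = 0.
Proof. by rewrite /cabs normr0. Qed.

Lemma cabs1 : cabs 1 = 1.
Proof. by rewrite /cabs normr1. Qed.

Lemma cabsM z w : cabs (z * w) = cabs z * cabs w.
Proof. by apply: complexI; rewrite -cabsE normrM !cabsE rmorphM. Qed.

Lemma cabsD z w : cabs (z + w) <= cabs z + cabs w.
Proof. by rewrite -lecR -cabsE (le_trans (ler_normD _ _))// !cabsE rmorphD. Qed.

Lemma cabsN z : cabs (- z) = cabs z.
Proof. by rewrite /cabs normrN. Qed.

Lemma cabsB z w : cabs (z - w) <= cabs z + cabs w.
Proof. by rewrite -[cabs w]cabsN cabsD. Qed.

Lemma cabs_distC z w : cabs (z - w) = cabs (w - z).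
Proof. by rewrite -cabsN opprB. Qed.

Lemma cabsX z n : cabs (z ^+ n) = cabs z ^+ n.
Proof. by elim: n => [|n IH]; rewrite ?cabs1// !exprS cabsM IH. Qed.

Lemma cabsV z : cabs z^-1 = (cabs z)^-1.
Proof. by apply: complexI; rewrite -cabsE normfV cabsE fmorphV. Qed.

Lemma cabsJ z : cabs z^*%C = cabs z.
Proof. by rewrite !cabs_sqrt; case: z => a b /=; rewrite sqrrN. Qed.

Lemma cabsR (x : R) : cabs x%:C%C = `|x|.
Proof. by rewrite cabs_sqrt /= expr0n addr0 sqrtr_sqr. Qed.

Lemma cabs_eq0 z : cabs z = 0 -> z = 0.
Proof. by move=> z0; apply/eqP; rewrite -normr_eq0 cabsE z0. Qed.

Lemma Re_le_cabs z : `|complex.Re z| <= cabs z.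
Proof. by rewrite cabs_sqrt -sqrtr_sqr ler_wsqrtr// lerDl sqr_ge0. Qed.

Lemma Im_le_cabs z : `|complex.Im z| <= cabs z.
Proof. by rewrite cabs_sqrt -sqrtr_sqr ler_wsqrtr// lerDr sqr_ge0. Qed.

Lemma cabs_le z : cabs z <= `|complex.Re z| + `|complex.Im z|.
Proof.
rewrite -[cabs z]ger0_norm ?cabs_ge0// -ler_sqr ?nnegrE ?addr_ge0//.
rewrite real_normK ?num_real// sqr_cabs sqrrD !real_normK ?num_real//.
by rewrite lerD2r lerDl mulrn_wge0// mulr_ge0.
Qed.

Lemma cabs_sum (I : Type) (r : seq I) (P : pred I) (F : I -> R[i]) :
  cabs (\sum_(i <- r | P i) F i) <= \sum_(i <- r | P i) cabs (F i).
Proof.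
elim/big_rec2: _ => [|i x y _ le]; first by rewrite cabs0.
by rewrite (le_trans (cabsD _ _))// lerD2l.
Qed.

Lemma cabs_distD z w u : cabs (z - u) <= cabs (z - w) + cabs (w - u).
Proof. by rewrite (le_trans _ (cabsD _ _))// addrA subrK. Qed.

Lemma cabs_le0 z : cabs z <= 0 -> z = 0.
Proof. by move=> z0; apply/cabs_eq0/le_anti; rewrite z0 cabs_ge0. Qed.

Lemma cReD z w : complex.Re (z + w) = complex.Re z + complex.Re w.
Proof. by case: z; case: w. Qed.
Lemma cImD z w : complex.Im (z + w) = complex.Im z + complex.Im w.
Proof. by case: z; case: w. Qed.
Lemma cReN z : complex.Re (- z) = - complex.Re z. Proof. by case: z. Qed.
Lemma cImN z : complex.Im (- z) = - complex.Im z. Proof. by case: z. Qed.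
Lemma cReM z w : complex.Re (z * w) =
  complex.Re z * complex.Re w - complex.Im z * complex.Im w.
Proof. by case: z; case: w. Qed.
Lemma cImM z w : complex.Im (z * w) =
  complex.Re z * complex.Im w + complex.Im z * complex.Re w.
Proof. by case: z; case: w. Qed.
Lemma complex_eqP z w :
  complex.Re z = complex.Re w -> complex.Im z = complex.Im w -> z = w.
Proof. by case: z; case: w => ? ? ? ? /= -> ->. Qed.

End Modulus.

Section CvgC.
Context {R : realType}.

Lemma nbhsCP (l : R[i]) (A : set R[i]) :
  nbhs (l : R[i]^o) A <->
  exists2 e : R, 0 < e & forall z, cabs (z - l) < e -> A z.
Proof.
split.
  move=> /(nbhs_ballP (l : R[i]^o) A)[e /= e0 eA].
  exists (complex.Re e); first by move: e0; rewrite ltcE => /andP[].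
  move=> z ze; apply: eA; rewrite /ball /= distrC cabsE ltcE /= ze andbT.
  by move: e0; rewrite ltcE => /andP[].
move=> [e e0 eA]; apply/(nbhs_ballP (l : R[i]^o) A); exists (e%:C%C : R[i]).
  by rewrite /= ltcR.
by move=> z; rewrite /ball /= distrC cabsE ltcR; exact: eA.
Qed.

(** Only upward closure of [F] is asked for, so the criterion applies to [sector_oo delta] before
    that family is shown to be a filter. *)
Lemma cvgCP (T : Type) (f : T -> R[i]) (F : set_system T) (l : R[i])
  (FF : forall A B : set T, F A -> A `<=` B -> F B) :
  cvgC f F l <-> forall e : R, 0 < e -> F [set t | cabs (f t - l) < e].
Proof.
split=> [fl e e0|fl A].
  by apply: (fl [set z | cabs (z - l) < e]); apply/nbhsCP; exists e.
by move=> /nbhsCP[e e0 eA]; apply: (FF _ _ (fl e e0)) => t /= /eA.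
Qed.

Lemma cvgC_filterP (T : Type) (f : T -> R[i]) (F : set_system T)
    {FF : Filter F} (l : R[i]) :
  cvgC f F l <-> (fun t => cabs (f t - l)) @ F --> (0 : R).
Proof.
rewrite cvgCP; last by move=> A B FA AB; apply: filterS FA.
split=> [fl|].
  apply/cvgrPdist_lt => e e0; apply: filterS (fl e e0) => t /=.
  by rewrite sub0r normrN ger0_norm ?cabs_ge0.
move=> /cvgrPdist_lt fl e e0; apply: filterS (fl e e0) => t /=.
by rewrite sub0r normrN ger0_norm ?cabs_ge0.
Qed.

Lemma cvgC_unique (T : Type) (f : T -> R[i]) (F : set_system T)
    {FF : ProperFilter F} (l l' : R[i]) :
  cvgC f F l -> cvgC f F l' -> l = l'.
Proof.
by move=> fl fl'; apply: (cvg_unique (@norm_hausdorff _ R[i]^o) fl fl').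
Qed.

Lemma squeezeC (T : Type) (f : T -> R[i]) (g : T -> R) (F : set_system T)
    {FF : Filter F} (l : R[i]) :
  (forall t, cabs (f t - l) <= g t) -> g @ F --> (0 : R) -> cvgC f F l.
Proof.
move=> fg g0; apply/cvgC_filterP.
apply: (@squeeze_cvgr _ _ _ _ (fun=> 0) g) => //; last exact: cvg_cst.
by apply: nearW => t; rewrite cabs_ge0 fg.
Qed.

Lemma cvgCD (T : Type) (f g : T -> R[i]) (F : set_system T)
    {FF : Filter F} (l m : R[i]) :
  cvgC f F l -> cvgC g F m -> cvgC (fun t => f t + g t) F (l + m).
Proof.
move=> /cvgC_filterP fl /cvgC_filterP gm.
apply: (@squeezeC _ _ (fun t => cabs (f t - l) + cabs (g t - m))).
  by move=> t; rewrite opprD addrACA cabsD.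
by rewrite -[X in _ --> X](addr0 0); apply: cvgD.
Qed.

Lemma cvgCM (T : Type) (f g : T -> R[i]) (F : set_system T)
    {FF : Filter F} (l m : R[i]) :
  cvgC f F l -> cvgC g F m -> cvgC (fun t => f t * g t) F (l * m).
Proof.
move=> /cvgC_filterP fl /cvgC_filterP gm.
apply: (@squeezeC _ _ (fun t => cabs (f t - l) * cabs (g t - m) +
   (cabs (f t - l) * cabs m + cabs l * cabs (g t - m)))).
  move=> t; rewrite (_ : _ - _ = (f t - l) * (g t - m) +
    ((f t - l) * m + l * (g t - m))); last by ring.
  rewrite (le_trans (cabsD _ _))// cabsM lerD2l.
  by rewrite (le_trans (cabsD _ _))// !cabsM.
rewrite [X in _ --> X](_ : 0 = 0 * 0 + (0 * cabs m + cabs l * 0)); last first.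
  by rewrite !mul0r mulr0 !addr0.
apply: cvgD; first exact: cvgM.
by apply: cvgD; apply: cvgM => //; exact: cvg_cst.
Qed.

Lemma cvgC_cst (T : Type) (F : set_system T) {FF : Filter F} (l : R[i]) :
  cvgC (fun=> l) F l.
Proof. exact: (@cvg_cst R[i]^o). Qed.

Lemma continuousCP (f : R -> R[i]) :
  (continuous (f : R -> R[i]^o)) <->
  (continuous (fun x => complex.Re (f x)) /\
   continuous (fun x => complex.Im (f x))).
Proof.
split=> [cf|[cr ci] x].
  split=> x; apply/cvgrPdist_lt => e e0.
    have /(cvgC_filterP f) /cvgrPdist_lt /(_ e e0) := cf x.
    apply: filterS => t; rewrite sub0r normrN ger0_norm ?cabs_ge0//.
    rewrite distrC => /(le_lt_trans _)-> //.
    by rewrite -cReN -cReD Re_le_cabs.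
  have /(cvgC_filterP f) /cvgrPdist_lt /(_ e e0) := cf x.
  apply: filterS => t; rewrite sub0r normrN ger0_norm ?cabs_ge0//.
  rewrite distrC => /(le_lt_trans _)-> //.
  by rewrite -cImN -cImD Im_le_cabs.
suff : cvgC f (nbhs x) (f x) by [].
apply: (@squeezeC _ _ (fun t => `|complex.Re (f t) - complex.Re (f x)|
   + `|complex.Im (f t) - complex.Im (f x)|)).
  by move=> t; rewrite (le_trans (cabs_le _))// cReD cImD cReN cImN.
rewrite -[X in _ --> X](addr0 0); apply: cvgD.
  have : (fun t => complex.Re (f t) - complex.Re (f x)) @ x --> (0 : R).
    by rewrite -(subrr (complex.Re (f x))); apply: cvgB; [exact: cr|exact: cvg_cst].
  by move=> /cvg_norm; rewrite normr0.
have : (fun t => complex.Im (f t) - complex.Im (f x)) @ x --> (0 : R).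
  by rewrite -(subrr (complex.Im (f x))); apply: cvgB; [exact: ci|exact: cvg_cst].
by move=> /cvg_norm; rewrite normr0.
Qed.

End CvgC.

Section Cexp.
Context {R : realType}.
Implicit Types z w : R[i].

Lemma cexpD z w : cexp (z + w) = cexp z * cexp w.
Proof.
case: z => a b; case: w => c d; rewrite /cexp /= expRD sinD cosD.
by apply: complex_eqP => /=; ring.
Qed.

Lemma cexp0 : cexp (0 : R[i]) = 1.
Proof. by rewrite /cexp /= expR0 cos0 sin0 mul1r. Qed.

Lemma cexpN z : cexp (- z) = (cexp z)^-1.
Proof.
apply: (@mulIf _ (cexp z)).
  by apply/eqP => z0; have /eqP := cexpD (- z) z;
    rewrite addNr cexp0 z0 mulr0 oner_eq0.
rewrite -cexpD addNr cexp0 mulVf//; apply/eqP => z0.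
by have /eqP := cexpD (- z) z; rewrite addNr cexp0 z0 mulr0 oner_eq0.
Qed.

Lemma cabs_cexp z : cabs (cexp z) = expR (complex.Re z).
Proof.
rewrite /cexp cabsM cabsR ger0_norm ?expR_ge0//.
by rewrite cabs_sqrt /= cos2Dsin2 sqrtr1 mulr1.
Qed.

Lemma cexp_neq0 z : cexp z != 0.
Proof.
apply/eqP => z0; have := cabs_cexp z; rewrite z0 cabs0 => /eqP.
by rewrite eq_sym expR_eq0.
Qed.

Definition cderiv (F f : R -> R[i]) : Prop := forall t : R,
  is_derive t 1 (fun x => complex.Re (F x)) (complex.Re (f t)) /\
  is_derive t 1 (fun x => complex.Im (F x)) (complex.Im (f t)).

Lemma cderiv_cexp z : cderiv (fun t => cexp (t%:C%C * z))
  (fun t => z * cexp (t%:C%C * z)).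
Proof.
case: z => a b t; rewrite /cexp /=; split.
  rewrite (_ : (fun x : R => _) = (fun x : R => expR (x * a) * cos (x * b))).
    apply: is_derive_eq; rewrite /GRing.scale /= !(mul0r, mulr0, subr0, addr0).
    by ring.
  by apply/funext => x /=; rewrite !mul0r !subr0 !addr0.
rewrite (_ : (fun x : R => _) = (fun x : R => expR (x * a) * sin (x * b))).
  apply: is_derive_eq; rewrite /GRing.scale /= !(mul0r, mulr0, subr0, addr0).
  by ring.
by apply/funext => x /=; rewrite !mul0r !subr0 !addr0.
Qed.

Lemma cderivB (F G f g : R -> R[i]) : cderiv F f -> cderiv G g ->
  cderiv (fun t => F t - G t) (fun t => f t - g t).
Proof.
move=> Ff Gg t; have [Fr Fi] := Ff t; have [Gr Gi] := Gg t; split.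
  rewrite (_ : (fun _ => _) = (fun x => complex.Re (F x) - complex.Re (G x))).
    by rewrite cReD cReN; exact: is_deriveB.
  by apply/funext => x; rewrite cReD cReN.
rewrite (_ : (fun _ => _) = (fun x => complex.Im (F x) - complex.Im (G x))).
  by rewrite cImD cImN; exact: is_deriveB.
by apply/funext => x; rewrite cImD cImN.
Qed.

Lemma cderivD (F G f g : R -> R[i]) : cderiv F f -> cderiv G g ->
  cderiv (fun t => F t + G t) (fun t => f t + g t).
Proof.
move=> Ff Gg t; have [Fr Fi] := Ff t; have [Gr Gi] := Gg t; split.
  rewrite (_ : (fun _ => _) = (fun x => complex.Re (F x) + complex.Re (G x))).
    by rewrite cReD; exact: is_deriveD.
  by apply/funext => x; rewrite cReD.
rewrite (_ : (fun _ => _) = (fun x => complex.Im (F x) + complex.Im (G x))).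
  by rewrite cImD; exact: is_deriveD.
by apply/funext => x; rewrite cImD.
Qed.

Lemma cderiv_cst z : cderiv (fun=> z) (fun=> 0).
Proof. by move=> t; split; exact: is_derive_cst. Qed.

Lemma is_derive_pow n (c t : R) :
  is_derive t 1 (fun x : R => x ^+ n.+1 * c) (n.+1%:R * t ^+ n * c).
Proof.
have -> : (fun x : R => x ^+ n.+1 * c) = (fun x => (id ^+ n.+1) x * (fun=> c) x).
  by apply/funext => x; rewrite /= exprfctE.
apply: is_derive_eq; rewrite /GRing.scale /= mulr0 add0r !mulr1.
by rewrite -[X in _ * X = _]/(n.+1%:R *: (t ^+ n)) /GRing.scale /= mulrC.
Qed.

Lemma cderiv_exp n z : cderiv (fun t => t%:C%C ^+ n.+1 * z)
  (fun t => n.+1%:R * t%:C%C ^+ n * z).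
Proof.
move=> t; split.
  rewrite (_ : (fun x : R => _) = (fun x => x ^+ n.+1 * complex.Re z)).
    rewrite -(rmorph_nat (real_complex R)) -rmorphXn -rmorphM cReM /=.
    by rewrite mul0r subr0; exact: is_derive_pow.
  by apply/funext => x; rewrite -rmorphXn cReM /= mul0r subr0.
rewrite (_ : (fun x : R => _) = (fun x => x ^+ n.+1 * complex.Im z)).
  rewrite -(rmorph_nat (real_complex R)) -rmorphXn -rmorphM cImM /=.
  by rewrite mul0r addr0; exact: is_derive_pow.
by apply/funext => x; rewrite -rmorphXn cImM /= mul0r addr0.
Qed.

Lemma cderiv_expsum N z :
  cderiv (fun t => \sum_(n < N.+1) (t%:C%C * z) ^+ n / n`!%:R)
         (fun t => z * \sum_(n < N) (t%:C%C * z) ^+ n / n`!%:R).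
Proof.
elim: N => [|N IH].
  rewrite (_ : (fun _ => _) = (fun=> 1)).
    rewrite [X in cderiv _ X](_ : _ = fun=> 0); first exact: cderiv_cst.
    by apply/funext => t; rewrite big_ord0 mulr0.
  by apply/funext => t; rewrite big_ord_recr big_ord0 /= add0r expr0 mul1r invr1.
rewrite (_ : (fun _ => _) = (fun t : R =>
  \sum_(n < N.+1) (t%:C%C * z) ^+ n / n`!%:R +
    t%:C%C ^+ N.+1 * (z ^+ N.+1 / (N.+1)`!%:R))); last first.
  by apply/funext => t; rewrite big_ord_recr /= [in RHS]mulrA -exprMn.
rewrite [X in cderiv _ X](_ : _ = (fun t : R =>
  z * \sum_(n < N) (t%:C%C * z) ^+ n / n`!%:R +
    N.+1%:R * t%:C%C ^+ N * (z ^+ N.+1 / (N.+1)`!%:R))).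
  by apply: cderivD => //; exact: cderiv_exp.
apply/funext => t; rewrite big_ord_recr /= mulrDr; congr (_ + _).
rewrite factS natrM exprS exprMn.
have N0 : N.+1%:R != 0 :> R[i] by rewrite pnatr_eq0.
have F0 : N`!%:R != 0 :> R[i] by rewrite pnatr_eq0 -lt0n fact_gt0.
by move: (N.+1%:R) (N`!%:R) N0 F0 => k m k0 m0; field; rewrite m0.
Qed.

Lemma cderiv_bound (F f : R -> R[i]) (K : R) : cderiv F f -> F 0 = 0 ->
  (forall t : R, 0 <= t <= 1 -> cabs (f t) <= K) ->
  forall t : R, 0 <= t <= 1 -> cabs (F t) <= 2 * K.
Proof.
move=> Ff F0 fK t /andP[t0 t1].
have bnd (G g : R -> R) : (forall x : R, is_derive x 1 G (g x)) -> G 0 = 0 ->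
    (forall x : R, 0 <= x <= 1 -> `|g x| <= K) -> `|G t| <= K.
  move=> Gg G0 gK.
  have cG : {within `[0, t], continuous G}.
    apply: continuous_subspaceT => x; apply/differentiable_continuous.
    by apply/derivable1_diffP; have [] := Gg x.
  have [c] := MVT_segment t0 (fun x _ => Gg x) cG.
  rewrite in_itv /= => /andP[c0 ct]; rewrite G0 !subr0 => ->.
  have gc : `|g c| <= K by rewrite gK// c0 (le_trans ct).
  by rewrite normrM (ger0_norm t0) (le_trans _ gc)// ler_piMr.
rewrite mulr_natl mulr2n (le_trans (cabs_le _))// lerD//.
  apply: bnd (fun x => (Ff x).1) _ _; first by rewrite F0.
  by move=> x /fK; exact: le_trans (Re_le_cabs _).
apply: bnd (fun x => (Ff x).2) _ _; first by rewrite F0.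
by move=> x /fK; exact: le_trans (Im_le_cabs _).
Qed.

(** Induction along the ray $t\mapsto tz$: the derivative of the remainder of order $N+1$ is $z$
    times the one of order $N$. The mean value theorem is applied to real and imaginary parts
    separately, which costs a factor 2 at each order; no factorial is gained, and none matters
    later. *)
Lemma cexp_taylor N z :
  cabs (cexp z - \sum_(n < N) z ^+ n / n`!%:R)
    <= (2 * cabs z) ^+ N * expR (cabs z).
Proof.
suff H (t : R) : 0 <= t <= 1 ->
    cabs (cexp (t%:C%C * z) - \sum_(n < N) (t%:C%C * z) ^+ n / n`!%:R)
    <= (2 * cabs z) ^+ N * expR (cabs z).
  by have := H 1; rewrite lexx ler01 mul1r; exact.
elim: N t => [|N IH] t t01.
  rewrite big_ord0 subr0 expr0 mul1r cabs_cexp ler_expR cReM /= mul0r subr0.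
  rewrite (le_trans (ler_norm _))// normrM.
  rewrite (le_trans _ (Re_le_cabs _))// ler_piMl//.
  by case/andP: t01 => t0 t1; rewrite ger0_norm.
have := cderivB (cderiv_cexp z) (cderiv_expsum N z).
move=> /(@cderiv_bound _ _ (cabs z * ((2 * cabs z) ^+ N * expR (cabs z)))).
rewrite exprS !mulrA; apply => //.
  rewrite mul0r cexp0 big_ord_recl /= expr0 mul1r invr1 big1 ?addr0 ?subrr//.
  by move=> i _; rewrite expr0n mul0r.
move=> u u01; rewrite -mulrBr cabsM -mulrA ler_wpM2l ?cabs_ge0//.
exact: IH.
Qed.

End Cexp.

(** * Complex-valued integrals *)

Section Cmeas.
Context {R : realType} d (T : measurableType d).
Implicit Types f g : T -> R[i].

Definition cmeas f : Prop :=
  measurable_fun [set: T] (fun x => complex.Re (f x)) /\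
  measurable_fun [set: T] (fun x => complex.Im (f x)).

Lemma cmeas_cst z : cmeas (fun=> z).
Proof. by split; exact: measurable_cst. Qed.

Lemma cmeasD f g : cmeas f -> cmeas g -> cmeas (fun x => f x + g x).
Proof.
move=> [fr fi] [gr gi]; split.
  by under eq_fun do rewrite cReD; exact: measurable_funD.
by under eq_fun do rewrite cImD; exact: measurable_funD.
Qed.

Lemma cmeasN f : cmeas f -> cmeas (fun x => - f x).
Proof.
move=> [fr fi]; split.
  by under eq_fun do rewrite cReN; exact: measurableT_comp.
by under eq_fun do rewrite cImN; exact: measurableT_comp.
Qed.

Lemma cmeasB f g : cmeas f -> cmeas g -> cmeas (fun x => f x - g x).
Proof. by move=> mf mg; apply: cmeasD => //; exact: cmeasN. Qed.

Lemma cmeasM f g : cmeas f -> cmeas g -> cmeas (fun x => f x * g x).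
Proof.
move=> [fr fi] [gr gi]; split.
  under eq_fun do rewrite cReM.
  by apply: measurable_funB; exact: measurable_funM.
under eq_fun do rewrite cImM.
by apply: measurable_funD; exact: measurable_funM.
Qed.

Lemma cmeasZ z f : cmeas f -> cmeas (fun x => z * f x).
Proof. by move=> mf; apply: cmeasM => //; exact: cmeas_cst. Qed.

Lemma cmeas_real (f : T -> R) : measurable_fun [set: T] f ->
  cmeas (fun x => (f x)%:C%C).
Proof. by move=> mf; split => //=; exact: measurable_cst. Qed.

Lemma cmeasJ f : cmeas f -> cmeas (fun x => (f x)^*%C).
Proof.
move=> [fr fi]; split.
  by rewrite (_ : (fun _ => _) = fun x => complex.Re (f x))//;
    apply/funext => x; case: (f x).
rewrite (_ : (fun _ => _) = fun x => - complex.Im (f x)).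
  exact: measurableT_comp.
by apply/funext => x; case: (f x).
Qed.

Lemma cmeas_sum (I : Type) (r : seq I) (P : pred I) (h : I -> T -> R[i]) :
  (forall i, cmeas (h i)) -> cmeas (fun x => \sum_(i <- r | P i) h i x).
Proof.
move=> mh; elim: r => [|i r IH].
  by under eq_fun do rewrite big_nil; exact: cmeas_cst.
under eq_fun do rewrite big_cons; case: (P i) => //.
exact: cmeasD.
Qed.

Lemma cmeas_prod (I : Type) (r : seq I) (P : pred I) (h : I -> T -> R[i]) :
  (forall i, cmeas (h i)) -> cmeas (fun x => \prod_(i <- r | P i) h i x).
Proof.
move=> mh; elim: r => [|i r IH].
  by under eq_fun do rewrite big_nil; exact: cmeas_cst.
under eq_fun do rewrite big_cons; case: (P i) => //.
exact: cmeasM.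
Qed.

Lemma cmeas_cexp f : cmeas f -> cmeas (fun x => cexp (f x)).
Proof.
move=> [fr fi]; rewrite /cexp; apply: cmeasM.
  by apply: cmeas_real; exact: (measurableT_comp (@measurable_expR R)).
split => /=; first exact: (measurableT_comp (continuous_measurable_fun (@continuous_cos R))).
exact: (measurableT_comp (continuous_measurable_fun (@continuous_sin R))).
Qed.

Lemma cmeas_if (b : T -> bool) f g : measurable_fun [set: T] b ->
  cmeas f -> cmeas g -> cmeas (fun x => if b x then f x else g x).
Proof.
move=> mb [fr fi] [gr gi]; split.
  rewrite (_ : (fun _ => _) =
    fun x => if b x then complex.Re (f x) else complex.Re (g x)).
    exact: measurable_fun_ifT.
  by apply/funext => x; case: (b x).
rewrite (_ : (fun _ => _) =
  fun x => if b x then complex.Im (f x) else complex.Im (g x)).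
  exact: measurable_fun_ifT.
by apply/funext => x; case: (b x).
Qed.

Lemma measurable_cabs f : cmeas f -> measurable_fun [set: T] (fun x => cabs (f x)).
Proof.
move=> [fr fi]; under eq_fun do rewrite cabs_sqrt.
apply: (measurableT_comp (continuous_measurable_fun (@sqrt_continuous R))).
by apply: measurable_funD; exact: measurable_funX.
Qed.

Lemma cmeas_lim (h : nat -> T -> R[i]) f : (forall n, cmeas (h n)) ->
  (forall x, cvgC (fun n => h n x) \oo (f x)) -> cmeas f.
Proof.
move=> mh hf.
have sub (x : T) (p : R[i] -> R) : (forall z, `|p z| <= cabs z) ->
    (forall z w, p (z - w) = p z - p w) -> (p \o h ^~ x) @ \oo --> p (f x).
  move=> pz pB; apply/cvgrPdist_lt => e e0.
  have /cvgC_filterP/cvgrPdist_lt /(_ e e0) := hf x.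
  apply: filterS => n; rewrite sub0r normrN ger0_norm ?cabs_ge0// distrC.
  by apply: le_lt_trans; rewrite /= -pB pz.
split.
  apply: (@measurable_fun_cvg _ _ _ _ (fun n x => complex.Re (h n x))).
    by move=> n; have [] := mh n.
  move=> x _; apply: (sub x (@complex.Re R)); first exact: Re_le_cabs.
  by move=> z w; rewrite cReD cReN.
apply: (@measurable_fun_cvg _ _ _ _ (fun n x => complex.Im (h n x))).
  by move=> n; have [] := mh n.
move=> x _; apply: (sub x (@complex.Im R)); first exact: Im_le_cabs.
by move=> z w; rewrite cImD cImN.
Qed.

End Cmeas.

Lemma cmeas_comp {R : realType} d d' (T : measurableType d)
    (T' : measurableType d') (g : T' -> T) (f : T -> R[i]) :
  measurable_fun [set: T'] g -> cmeas f -> cmeas (fun x => f (g x)).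
Proof.
by move=> mg [fr fi]; split; [exact: (measurableT_comp fr)|
  exact: (measurableT_comp fi)].
Qed.

Lemma cmeas_continuous {R : realType} (f : R -> R[i]) :
  continuous (f : R -> R[i]^o) -> cmeas f.
Proof.
by move=> /continuousCP[cr ci]; split; exact: continuous_measurable_fun.
Qed.

Section Cint.
Context {R : realType}.
Implicit Types (f g : R -> R[i]) (D : set R).
Local Notation mu := (@lebesgue_measure R).
Local Notation mble := (@measurable _ (measurableTypeR R)).

Definition cintb D f : Prop :=
  cmeas f /\ mu.-integrable D (EFin \o (fun x => cabs (f x))).

Lemma cintb_dom D f (g : R -> R) : mble D -> cmeas f ->
  mu.-integrable D (EFin \o g) -> (forall x, D x -> cabs (f x) <= g x) ->
  cintb D f.
Proof.
move=> mD mf ig fg; split => //; apply: le_integrable ig => //.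
  by apply/measurable_EFinP; exact: measurable_funTS (measurable_cabs mf).
move=> x Dx /=; rewrite lee_fin ger0_norm ?cabs_ge0//.
by rewrite (le_trans (fg x Dx))// ler_norm.
Qed.

Lemma cintb_Re D f : mble D -> cintb D f ->
  mu.-integrable D (EFin \o (fun x => complex.Re (f x))).
Proof.
move=> mD [[fr fi] jf]; apply: le_integrable jf => //.
  by apply/measurable_EFinP; exact: measurable_funTS.
by move=> x Dx /=; rewrite lee_fin [leRHS]ger0_norm ?cabs_ge0// Re_le_cabs.
Qed.

Lemma cintb_Im D f : mble D -> cintb D f ->
  mu.-integrable D (EFin \o (fun x => complex.Im (f x))).
Proof.
move=> mD [[fr fi] jf]; apply: le_integrable jf => //.
  by apply/measurable_EFinP; exact: measurable_funTS.
by move=> x Dx /=; rewrite lee_fin [leRHS]ger0_norm ?cabs_ge0// Im_le_cabs.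
Qed.

Lemma cintbS D E f : mble E -> mble D -> D `<=` E ->
  cintb E f -> cintb D f.
Proof. by move=> mE mD DE [mf jf]; split => //; exact: integrableS jf. Qed.

Lemma cintbD D f g : mble D -> cintb D f -> cintb D g ->
  cintb D (fun x => f x + g x).
Proof.
move=> mD [mf jf] [mg jg]; apply: (@cintb_dom _ _ (fun x => cabs (f x) + cabs (g x))) => //.
- exact: cmeasD.
- by have := integrableD mD jf jg.
- by move=> x _; exact: cabsD.
Qed.

Lemma cintbM D f g (K : R) : mble D -> cintb D f -> cmeas g ->
  (forall x, D x -> cabs (g x) <= K) -> cintb D (fun x => f x * g x).
Proof.
move=> mD [mf jf] mg gK; apply: (@cintb_dom _ _ (fun x => K * cabs (f x))) => //.
- exact: cmeasM.
- by have := integrableZl mD K jf.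
- by move=> x Dx; rewrite cabsM mulrC ler_wpM2r ?cabs_ge0// gK.
Qed.

Lemma cintbZ D f z : mble D -> cintb D f -> cintb D (fun x => z * f x).
Proof.
move=> mD jf; under eq_fun do rewrite mulrC.
by apply: (@cintbM _ _ _ (cabs z)) => //; exact: cmeas_cst.
Qed.

Lemma cintbN D f : mble D -> cintb D f -> cintb D (fun x => - f x).
Proof. by move=> mD jf; under eq_fun do rewrite -mulN1r; exact: cintbZ. Qed.

Lemma cintbB D f g : mble D -> cintb D f -> cintb D g ->
  cintb D (fun x => f x - g x).
Proof. by move=> mD jf jg; apply: cintbD => //; exact: cintbN. Qed.

Lemma cintb0 D : mble D -> cintb D (fun=> 0).
Proof.
move=> mD; split; first exact: cmeas_cst.
rewrite (_ : _ \o _ = cst 0%E); last by apply/funext => x /=; rewrite cabs0.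
exact: integrable0.
Qed.

Lemma cintb_sum D (I : Type) (r : seq I) (h : I -> R -> R[i]) :
  mble D -> (forall i, cintb D (h i)) ->
  cintb D (fun x => \sum_(i <- r) h i x).
Proof.
move=> mD jh; elim: r => [|i r IH].
  by under eq_fun do rewrite big_nil; exact: cintb0.
by under eq_fun do rewrite big_cons; exact: cintbD.
Qed.

Lemma eq_cint D f g : (forall x, D x -> f x = g x) -> cint D f = cint D g.
Proof.
by move=> fg; rewrite /cint; congr (Complex _ _); apply: eq_Rintegral => x;
  rewrite inE => Dx; rewrite fg.
Qed.

Lemma cintD D f g : mble D -> cintb D f -> cintb D g ->
  cint D (fun x => f x + g x) = cint D f + cint D g.
Proof.
move=> mD jf jg; apply: complex_eqP; rewrite ?cReD ?cImD /=.
  by under eq_Rintegral do rewrite cReD; rewrite RintegralD//; exact: cintb_Re.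
by under eq_Rintegral do rewrite cImD; rewrite RintegralD//; exact: cintb_Im.
Qed.

Lemma cintZ D f z : mble D -> cintb D f ->
  cint D (fun x => z * f x) = z * cint D f.
Proof.
move=> mD jf; have [jr ji] := (cintb_Re mD jf, cintb_Im mD jf).
have jZ (c : R) (h : R -> R) : mu.-integrable D (EFin \o h) ->
  mu.-integrable D (EFin \o (fun x => c * h x)).
  by move=> jh; have := integrableZl mD c jh.
apply: complex_eqP; rewrite ?cReM ?cImM /=.
  under eq_Rintegral do rewrite cReM.
  by rewrite RintegralB ?jZ// !RintegralZl.
under eq_Rintegral do rewrite cImM.
by rewrite RintegralD ?jZ// !RintegralZl.
Qed.

Lemma cintN D f : mble D -> cintb D f ->
  cint D (fun x => - f x) = - cint D f.
Proof. by move=> mD jf; under eq_fun do rewrite -mulN1r; rewrite cintZ// mulN1r. Qed.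

Lemma cintB D f g : mble D -> cintb D f -> cintb D g ->
  cint D (fun x => f x - g x) = cint D f - cint D g.
Proof. by move=> mD jf jg; rewrite cintD ?cintN//; exact: cintbN. Qed.

Lemma cint0 D : cint D (fun=> 0) = 0 :> R[i].
Proof. by rewrite /cint /= /Rintegral integral0. Qed.

Lemma cint_sum D (I : Type) (r : seq I) (h : I -> R -> R[i]) :
  mble D -> (forall i, cintb D (h i)) ->
  cint D (fun x => \sum_(i <- r) h i x) = \sum_(i <- r) cint D (h i).
Proof.
move=> mD jh; elim: r => [|i r IH].
  by under eq_fun do rewrite big_nil; rewrite big_nil cint0.
under eq_fun do rewrite big_cons; rewrite big_cons cintD ?IH//.
exact: cintb_sum.
Qed.

(* Rotate the integral onto the positive real axis and compare real parts. *)
Lemma cabs_cint D f : mble D -> cintb D f ->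
  cabs (cint D f) <= \int[mu]_(x in D) cabs (f x).
Proof.
move=> mD jf; set I := cint D f.
have [->|I0] := eqVneq I 0.
  by rewrite cabs0 Rintegral_ge0// => x _; exact: cabs_ge0.
have aI0 : cabs I != 0 by apply: contra_neq I0; exact: cabs_eq0.
pose c := I^*%C / (cabs I)%:C%C.
have c1 : cabs c = 1.
  by rewrite cabsM cabsJ cabsV cabsR ger0_norm ?cabs_ge0// divff.
have cI : c * I = (cabs I)%:C%C.
  rewrite /c mulrAC [_ * I]mulrC -sqr_normc cabsE -rmorphXn /= -fmorphV -rmorphM.
  by congr (_%:C%C); rewrite expr2 mulfK.
have -> : cabs I = complex.Re (c * I) by rewrite cI.
rewrite -cintZ//= le_Rintegral//; last by move=> x Dx;
  rewrite (le_trans (ler_norm _))// (le_trans (Re_le_cabs _))// cabsM c1 mul1r.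
  by apply: cintb_Re => //; exact: cintbZ.
by case: jf.
Qed.

Lemma cabs_cint_le D f (g : R -> R) : mble D -> cmeas f ->
  mu.-integrable D (EFin \o g) -> (forall x, D x -> cabs (f x) <= g x) ->
  cabs (cint D f) <= \int[mu]_(x in D) g x.
Proof.
move=> mD mf jg fg; have jf : cintb D f by apply: cintb_dom jg fg.
by rewrite (le_trans (cabs_cint mD jf))// le_Rintegral//; case: jf.
Qed.

Lemma cint_setU D E f : mble D -> mble E -> cintb (D `|` E) f ->
  [disjoint D & E] -> cint (D `|` E) f = cint D f + cint E f.
Proof.
move=> mD mE jf DE; have mDE := measurableU _ _ mD mE.
apply: complex_eqP; rewrite ?cReD ?cImD /= Rintegral_setU//.
  exact: cintb_Re.
exact: cintb_Im.
Qed.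

Lemma cint_itvB f (a b : itv_bound R) x :
  cintb [set` Interval a b] f -> (a <= BRight x)%O -> (BRight x <= b)%O ->
  cint [set` Interval a b] f - cint [set` Interval a (BRight x)] f =
  cint [set` Interval (BRight x) b] f.
Proof.
move=> jf ax xb; apply: complex_eqP; rewrite ?cReD ?cReN ?cImD ?cImN /=.
  by rewrite Rintegral_itvB//; exact: cintb_Re.
by rewrite Rintegral_itvB//; exact: cintb_Im.
Qed.

Lemma cint_itv_obnd_cbnd f (r : R) (b : itv_bound R) :
  cintb [set` Interval (BRight r) b] f ->
  cint [set` Interval (BRight r) b] f = cint [set` Interval (BLeft r) b] f.
Proof.
move=> jf; apply: complex_eqP; rewrite /= Rintegral_itv_obnd_cbnd//.
  exact: cintb_Re.
exact: cintb_Im.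
Qed.

Lemma cint_itv_add f (a b c : R) : a <= b -> b <= c -> cintb `[a, c] f ->
  cint `[a, c] f = cint `[a, b] f + cint `[b, c] f.
Proof.
move=> ab bc jf; apply/eqP; rewrite addrC -subr_eq; apply/eqP.
rewrite cint_itvB ?bnd_simp// cint_itv_obnd_cbnd//.
apply: cintbS jf => //; apply: subset_itvr; rewrite bnd_simp//.
Qed.

Lemma cintNy_sub f (a b : R) : a <= b -> cintb `]-oo, b] f ->
  cint `]-oo, b] f - cint `]-oo, a] f = cint `[a, b] f.
Proof.
move=> ab jf; rewrite cint_itvB ?bnd_simp// cint_itv_obnd_cbnd//.
by apply: cintbS jf => //; apply: subset_itvr; rewrite bnd_simp.
Qed.

Lemma cint_real D (g : R -> R) : mu.-integrable D (EFin \o g) ->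
  cint D (fun x => (g x)%:C%C) = (\int[mu]_(x in D) g x)%:C%C.
Proof. by move=> jg; rewrite /cint /= /Rintegral integral0. Qed.

End Cint.

(** * Absolutely continuous functions *)

Lemma le_cvg0 {R : realType} (T : Type) (F : set_system T)
    {FF : ProperFilter F} (x : R) (g : T -> R) :
  g @ F --> 0 -> (forall t, x <= g t) -> x <= 0.
Proof.
move=> g0 xg; rewrite -(cvg_lim (@Rhausdorff R) g0).
by apply: limr_ge; [apply/cvg_ex; exists 0|exact: nearW].
Qed.

Section Prim.
Context {R : realType}.
Local Notation mu := (@lebesgue_measure R).
Local Notation mble := (@measurable _ (measurableTypeR R)).
Implicit Types (f g F G : R -> R[i]).

(* Bisecting at the midpoint value of [H] halves the constant in a quadratic
   bound of an additive interval function, so that it vanishes. *)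
Lemma additive_quad0 (a b C : R) (H : R -> R) (D : R -> R -> R[i]) :
  a <= b -> {within `[a, b], continuous H} ->
  (forall x y, a <= x -> x <= y -> y <= b -> H x <= H y) ->
  (forall x y z, a <= x -> x <= y -> y <= z -> z <= b -> D x z = D x y + D y z) ->
  (forall x y, a <= x -> x <= y -> y <= b -> cabs (D x y) <= C * (H y - H x) ^+ 2) ->
  D a b = 0.
Proof.
move=> ab cH ndH addD quadD.
have half n : forall x y, a <= x -> x <= y -> y <= b ->
    cabs (D x y) <= C / 2 ^+ n * (H y - H x) ^+ 2.
  elim: n => [|n IH] x y ax xy yb; first by rewrite expr0 divr1 quadD.
  have cHxy : {within `[x, y], continuous H}.
    by apply: continuous_subspaceW cH; apply: subset_itvScc; rewrite bnd_simp.
  have Hxy := ndH _ _ ax xy yb.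
  have [|z] := IVT (v := (H x + H y) / 2) xy cHxy.
    by rewrite min_l// max_r//; apply/andP; split; lra.
  rewrite in_itv /= => /andP[xz zy] Hz.
  rewrite (addD x z y)// (le_trans (cabsD _ _))//.
  have := lerD (IH x z ax xz (le_trans zy yb)) (IH z y (le_trans ax xz) zy yb).
  move=> /le_trans; apply; rewrite Hz.
  set c := C / 2 ^+ n.
  rewrite (_ : C / 2 ^+ n.+1 = c / 2); last by rewrite /c exprS invfM; ring.
  rewrite le_eqVlt; apply/orP; left; apply/eqP; by field.
apply: cabs_le0; apply: (@le_cvg0 _ _ \oo _ _ (geometric (C * (H b - H a) ^+ 2) (2^-1))).
  by apply: cvg_geometric; rewrite ger0_norm// invf_lt1// ltr1n.
move=> n; rewrite /geometric /= exprVn mulrAC; exact: half.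
Qed.

(** Local absolute continuity of [F] with density [f], phrased as an integral identity so that no
    derivative almost everywhere has to be handled. *)
Definition prim F f : Prop :=
  (forall a b, cintb `[a, b] f) /\
  (forall a b, a <= b -> F b - F a = cint `[a, b] f).

Lemma Rintegral_itv_sub (h : R -> R) (a x y : R) :
  a <= x -> x <= y -> mu.-integrable `[a, y] (EFin \o h) ->
  \int[mu]_(t in `[a, y]) h t - \int[mu]_(t in `[a, x]) h t =
  \int[mu]_(t in `[x, y]) h t.
Proof.
move=> ax xy jh; rewrite Rintegral_itvB ?bnd_simp//.
rewrite Rintegral_itv_obnd_cbnd//.
by apply: integrableS jh => //; apply: subset_itvr; rewrite bnd_simp.
Qed.

(** The defect $F(y)-F(x)-\int_x^y f$ is additive over adjacent intervals, and the primitive of [h]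
    is continuous and monotone, so [additive_quad0] turns a quadratic bound into exact vanishing.
    Rules of calculus thereby reduce to second-order estimates on short intervals. *)
Lemma prim_criterion F f (h : R -> R) :
  (forall a b, cintb `[a, b] f) ->
  (forall a b, mu.-integrable `[a, b] (EFin \o h)) -> (forall x, 0 <= h x) ->
  (forall a b, a <= b -> exists C, forall x y, a <= x -> x <= y -> y <= b ->
     cabs (F y - F x - cint `[x, y] f) <= C * (\int[mu]_(t in `[x, y]) h t) ^+ 2) ->
  prim F f.
Proof.
move=> jf jh h0 quad; split => // a b ab.
have [C {}quad] := quad a b ab.
pose H x := \int[mu]_(t in `[a, x]) h t.
have HB x y : a <= x -> x <= y -> \int[mu]_(t in `[x, y]) h t = H y - H x.
  by move=> ax xy; rewrite /H Rintegral_itv_sub.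
apply/eqP; rewrite -subr_eq0; apply/eqP.
apply: (@additive_quad0 a b C H (fun x y => F y - F x - cint `[x, y] f)) => //.
- exact: parameterized_integral_continuous.
- move=> x y ax xy yb; rewrite -subr_ge0 -HB//.
  by apply: Rintegral_ge0 => z _.
- move=> x y z ax xy yz zb; rewrite (cint_itv_add xy yz)//; ring.
- by move=> x y ax xy yb; rewrite -HB//; exact: quad.
Qed.

Section PrimTheory.
Variables (F f : R -> R[i]).
Hypothesis Ff : prim F f.

Lemma prim_cmeas_density : cmeas f.
Proof. by have [] := Ff.1 0 0. Qed.

Lemma prim_integrable a b :
  mu.-integrable `[a, b] (EFin \o (fun x => cabs (f x))).
Proof. by have [] := Ff.1 a b. Qed.

Lemma prim_le x y : x <= y ->
  cabs (F y - F x) <= \int[mu]_(t in `[x, y]) cabs (f t).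
Proof. by move=> xy; rewrite Ff.2//; apply: cabs_cint => //; exact: Ff.1. Qed.

Lemma prim_le_sub a b x y : a <= x -> x <= y -> y <= b ->
  cabs (F y - F x) <= \int[mu]_(t in `[a, b]) cabs (f t).
Proof.
move=> ax xy yb; apply: le_trans (prim_le xy) _.
have := Rintegral_itv_sub ax xy (prim_integrable a y).
have := Rintegral_itv_sub (le_trans ax xy) yb (prim_integrable a b).
have I0 (u v : R) : 0 <= \int[mu]_(t in `[u, v]) cabs (f t).
  by apply: Rintegral_ge0 => z _; exact: cabs_ge0.
by move: (I0 y b) (I0 a x) => {I0}; lra.
Qed.

Lemma prim_bounded a b : exists K, forall x, a <= x -> x <= b -> cabs (F x) <= K.
Proof.
exists (cabs (F a) + \int[mu]_(t in `[a, b]) cabs (f t)) => x ax xb.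
rewrite -[F x](subrK (F a)) addrC (le_trans (cabsD _ _))// lerD2l.
by apply: (prim_le_sub (lexx a)).
Qed.

Lemma prim_continuous : continuous (F : R -> R[i]^o).
Proof.
move=> x; pose H y := \int[mu]_(t in `[x - 1, y]) cabs (f t).
have cH : {for x, continuous H}.
  have x11 : x - 1 < x + 1 by lra.
  have := parameterized_integral_continuous (ltW x11) (prim_integrable (x - 1) (x + 1)).
  move=> /(continuous_within_itvP _ x11)[+ _ _]; apply.
  by rewrite in_itv /=; apply/andP; split; lra.
have : cvgC F (nbhs x) (F x); last by [].
apply/cvgC_filterP.
apply: (@squeeze_cvgr _ _ _ _ (fun=> 0) (fun y => `|H y - H x|)).
- have nx : nbhs x (`]x - 1, x + 1[%classic).
    by apply: near_in_itvoo; rewrite in_itv /=; apply/andP; split; lra.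
  apply: filterS nx => y; rewrite /= in_itv /= => /andP[y1 y2]; rewrite cabs_ge0 /=.
  have [xy|/ltW yx] := leP x y.
    rewrite /H Rintegral_itv_sub ?(le_trans (prim_le xy) (ler_norm _)) //; first lra.
    exact: prim_integrable.
  rewrite cabs_distC distrC /H Rintegral_itv_sub
    ?(le_trans (prim_le yx) (ler_norm _)) //; first lra.
  exact: prim_integrable.
- exact: cvg_cst.
- have : (fun y => H y - H x) @ x --> 0.
    by rewrite -(subrr (H x)); apply: cvgB => //; exact: cvg_cst.
  by move=> /cvg_norm; rewrite normr0.
Qed.

Lemma prim_cmeas : cmeas F.
Proof. exact/cmeas_continuous/prim_continuous. Qed.

Lemma prim_mul_bounded g : (forall a b, cintb `[a, b] g) ->
  forall a b, cintb `[a, b] (fun x => g x * F x).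
Proof.
move=> jg a b; have [K FK] := prim_bounded a b.
apply: (@cintbM _ _ _ _ K) => //; first exact: prim_cmeas.
by move=> x /=; rewrite in_itv /= => /andP[]; exact: FK.
Qed.

End PrimTheory.

End Prim.

Section PrimRules.
Context {R : realType}.
Local Notation mu := (@lebesgue_measure R).
Local Notation mble := (@measurable _ (measurableTypeR R)).
Implicit Types (f g F G : R -> R[i]).

Lemma prim_eq F f g : prim F f -> (forall x, f x = g x) -> prim F g.
Proof. by move=> Ff fg; rewrite (_ : g = f)//; apply/funext => x. Qed.

Lemma cintb_ext D f g : (forall x, f x = g x) -> cintb D f -> cintb D g.
Proof. by move=> fg; rewrite (_ : g = f)//; apply/funext => x. Qed.

Lemma primD F G f g : prim F f -> prim G g ->
  prim (fun x => F x + G x) (fun x => f x + g x).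
Proof.
move=> [jf Ff] [jg Gg]; split => [a b|a b ab]; first exact: cintbD.
by rewrite cintD// -Ff// -Gg// opprD addrACA.
Qed.

Lemma primZ z F f : prim F f -> prim (fun x => z * F x) (fun x => z * f x).
Proof.
move=> [jf Ff]; split => [a b|a b ab]; first exact: cintbZ.
by rewrite cintZ// -Ff// mulrBr.
Qed.

Lemma primN F f : prim F f -> prim (fun x => - F x) (fun x => - f x).
Proof.
move=> [jf Ff]; split => [a b|a b ab]; first exact: cintbN.
by rewrite cintN// -Ff// opprD.
Qed.

Lemma primB F G f g : prim F f -> prim G g ->
  prim (fun x => F x - G x) (fun x => f x - g x).
Proof. by move=> Ff Gg; apply: primD => //; exact: primN. Qed.

Lemma integrable_itv_cst (a b c : R) :
  mu.-integrable `[a, b] (EFin \o (fun=> c)).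
Proof.
apply: measurable_bounded_integrable => //=.
- by rewrite lebesgue_measure_itv /=; case: ifP => // _; rewrite -EFinB ltry.
- by exists `|c|; split; [exact: num_real|move=> M cM x _ /=; exact: ltW].
Qed.

Lemma Rintegral_itv_cst (a b c : R) : a <= b ->
  \int[mu]_(t in `[a, b]) c = c * (b - a).
Proof.
move=> ab; rewrite Rintegral_cst//= lebesgue_measure_itv /= lte_fin.
by move: ab; rewrite le_eqVlt => /predU1P[->|->]; rewrite ?ltxx ?subrr//= -EFinB.
Qed.

Lemma cintb_itv_cst (a b : R) z : cintb `[a, b] (fun=> z).
Proof. by split; [exact: cmeas_cst|exact: integrable_itv_cst]. Qed.

Lemma prim_cst (z : R[i]) : prim (fun=> z) (fun=> 0).
Proof.
by split => [a b|a b ab]; [exact: cintb_itv_cst|rewrite cint0 subrr].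
Qed.

Lemma prim_id : prim (fun x : R => x%:C%C) (fun=> 1).
Proof.
split => [a b|a b ab]; first exact: cintb_itv_cst.
rewrite (@cint_real _ _ (fun=> 1)); last exact: integrable_itv_cst.
by rewrite Rintegral_itv_cst// mul1r rmorphB.
Qed.

(** Freezing both factors at the left endpoint leaves the product of the two increments and two
    integrals of a density against an increment. Each of the three is at most the square of
    $\int(|f|+|g|)$, hence the constant 3. *)
Lemma primM F G f g : prim F f -> prim G g ->
  prim (fun x => F x * G x) (fun x => f x * G x + F x * g x).
Proof.
move=> Ff Gg.
have jfG := prim_mul_bounded Gg Ff.1.
have jFg a b : cintb `[a, b] (fun x => F x * g x).
  by apply: cintb_ext (prim_mul_bounded Ff Gg.1 a b) => x; rewrite mulrC.
have jh a b : mu.-integrable `[a, b] (EFin \o (fun x => cabs (f x) + cabs (g x))).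
  by have := integrableD (measurable_itv _ : mble `[a, b])
       (prim_integrable Ff a b) (prim_integrable Gg a b).
apply: (@prim_criterion _ _ _ (fun x => cabs (f x) + cabs (g x))) => //.
- by move=> a b; exact: cintbD.
- by move=> x; rewrite addr_ge0 ?cabs_ge0.
move=> a b ab; exists 3 => x y ax xy yb.
set I := \int[mu]_(t in `[x, y]) _.
have II : I = \int[mu]_(t in `[x, y]) cabs (f t) + \int[mu]_(t in `[x, y]) cabs (g t).
  by rewrite /I RintegralD//; [exact: (prim_integrable Ff)|exact: (prim_integrable Gg)].
have If0 : 0 <= \int[mu]_(t in `[x, y]) cabs (f t).
  by apply: Rintegral_ge0 => ? _; exact: cabs_ge0.
have Ig0 : 0 <= \int[mu]_(t in `[x, y]) cabs (g t).
  by apply: Rintegral_ge0 => ? _; exact: cabs_ge0.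
have FI u : x <= u -> u <= y -> cabs (F u - F x) <= I.
  by move=> xu uy; rewrite (le_trans (prim_le_sub Ff (lexx x) xu uy))// II lerDl.
have GI u : x <= u -> u <= y -> cabs (G u - G x) <= I.
  by move=> xu uy; rewrite (le_trans (prim_le_sub Gg (lexx x) xu uy))// II lerDr.
have jf1 : cintb `[x, y] (fun t => f t * (G t - G x)).
  apply: (@cintb_ext _ (fun t => f t * G t - G x * f t)) => [t|]; first ring.
  by apply: cintbB => //; apply: cintbZ => //; exact: Ff.1.
have jg1 : cintb `[x, y] (fun t => (F t - F x) * g t).
  apply: (@cintb_ext _ (fun t => F t * g t - F x * g t)) => [t|]; first ring.
  by apply: cintbB => //; apply: cintbZ => //; exact: Gg.1.
have -> : F y * G y - F x * G x - cint `[x, y] (fun t => f t * G t + F t * g t) =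
    (F y - F x) * (G y - G x) -
    (cint `[x, y] (fun t => f t * (G t - G x)) +
     cint `[x, y] (fun t => (F t - F x) * g t)).
  have -> : cint `[x, y] (fun t => f t * (G t - G x)) =
      cint `[x, y] (fun t => f t * G t) - G x * cint `[x, y] f.
    rewrite -cintZ//; last exact: Ff.1.
    rewrite -cintB//; last by apply: cintbZ => //; exact: Ff.1.
    by apply: eq_cint => t _; ring.
  have -> : cint `[x, y] (fun t => (F t - F x) * g t) =
      cint `[x, y] (fun t => F t * g t) - F x * cint `[x, y] g.
    rewrite -cintZ//; last exact: Gg.1.
    rewrite -cintB//; last by apply: cintbZ => //; exact: Gg.1.
    by apply: eq_cint => t _; ring.
  by rewrite cintD// -(Ff.2 x y)// -(Gg.2 x y)//; ring.
have I0 : 0 <= I by rewrite II addr_ge0.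
have b1 : cabs ((F y - F x) * (G y - G x)) <= I * I.
  by rewrite cabsM ler_pM ?cabs_ge0 ?FI ?GI.
have b2 : cabs (cint `[x, y] (fun t => f t * (G t - G x))) <= I * I.
  apply: (le_trans (@cabs_cint_le _ _ _ (fun t => I * cabs (f t)) _ _ _ _)) => //.
  - by case: jf1.
  - by have := integrableZl (measurable_itv _ : mble `[x, y]) I
       (prim_integrable Ff x y).
  - move=> t /=; rewrite in_itv /= => /andP[xt ty].
    by rewrite cabsM mulrC ler_wpM2r ?cabs_ge0 ?GI.
  - rewrite RintegralZl//; last exact: (prim_integrable Ff).
    by rewrite ler_wpM2l// II lerDl.
have b3 : cabs (cint `[x, y] (fun t => (F t - F x) * g t)) <= I * I.
  apply: (le_trans (@cabs_cint_le _ _ _ (fun t => I * cabs (g t)) _ _ _ _)) => //.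
  - by case: jg1.
  - by have := integrableZl (measurable_itv _ : mble `[x, y]) I
       (prim_integrable Gg x y).
  - move=> t /=; rewrite in_itv /= => /andP[xt ty].
    by rewrite cabsM ler_wpM2r ?cabs_ge0 ?FI.
  - rewrite RintegralZl//; last exact: (prim_integrable Gg).
    by rewrite ler_wpM2l// II lerDr.
rewrite (le_trans (cabsB _ _))// (le_trans (lerD b1 (le_trans (cabsD _ _) (lerD b2 b3))))//.
by rewrite expr2 le_eqVlt; apply/orP; left; apply/eqP; ring.
Qed.

Lemma cexp_sub1 (z : R[i]) : cabs (cexp z - 1) <= 2 * cabs z * expR (cabs z).
Proof.
by have := cexp_taylor 1 z; rewrite big_ord_recl big_ord0 /= addr0 expr0 mul1r invr1
  expr1.
Qed.

Lemma cexp_sub1z (z : R[i]) :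
  cabs (cexp z - 1 - z) <= (2 * cabs z) ^+ 2 * expR (cabs z).
Proof.
have := cexp_taylor 2 z; rewrite 2!big_ord_recl big_ord0 /= addr0 expr0 mul1r invr1.
by rewrite expr1 mulr1 opprD addrA.
Qed.

Lemma prim_cexp F f : prim F f ->
  prim (fun x => cexp (F x)) (fun x => f x * cexp (F x)).
Proof.
move=> Ff.
have cF : cmeas (fun x => cexp (F x)) by apply: cmeas_cexp; exact: prim_cmeas Ff.
have eF a b : exists2 E, 0 <= E & forall x, a <= x -> x <= b -> cabs (cexp (F x)) <= E.
  have [K FK] := prim_bounded Ff a b; exists (expR K); first exact: expR_ge0.
  move=> x ax xb; rewrite cabs_cexp ler_expR (le_trans (ler_norm _))//.
  by rewrite (le_trans (Re_le_cabs _))// FK.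
have jfF a b : cintb `[a, b] (fun x => f x * cexp (F x)).
  have [E _ FE] := eF a b; apply: (@cintbM _ _ _ _ E) => //; first exact: Ff.1.
  by move=> x /=; rewrite in_itv /= => /andP[]; exact: FE.
apply: (@prim_criterion _ _ _ (fun x => cabs (f x))) => //.
- exact: prim_integrable Ff.
- by move=> x; exact: cabs_ge0.
move=> a b ab; have [E E0 FE] := eF a b.
set K := \int[mu]_(t in `[a, b]) cabs (f t).
(* The first summand pays for the second-order Taylor remainder of the increment of [F], the second
   for freezing [cexp (F t)] at [x] under the integral. *)
exists (E * (4 * expR K) + E * (2 * expR K)) => x y ax xy yb.
set I := \int[mu]_(t in `[x, y]) _.
have I0 : 0 <= I by apply: Rintegral_ge0 => ? _; exact: cabs_ge0.
have FI u : x <= u -> u <= y -> cabs (F u - F x) <= I.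
  by move=> xu uy; rewrite (prim_le_sub Ff (lexx x) xu uy).
have FK u : x <= u -> u <= y -> cabs (F u - F x) <= K.
  by move=> xu uy; rewrite (prim_le_sub Ff ax xu (le_trans uy yb)).
have Ex : cabs (cexp (F x)) <= E by rewrite FE// (le_trans xy).
have j1 : cintb `[x, y] (fun t => f t * (cexp (F t) - cexp (F x))).
  apply: (@cintb_ext _ (fun t => f t * cexp (F t) - cexp (F x) * f t)) => [t|].
    by ring.
  by apply: cintbB => //; apply: cintbZ => //; exact: Ff.1.
have -> : cexp (F y) - cexp (F x) - cint `[x, y] (fun t => f t * cexp (F t)) =
    cexp (F x) * (cexp (F y - F x) - 1 - (F y - F x)) -
    cint `[x, y] (fun t => f t * (cexp (F t) - cexp (F x))).
  have -> : cint `[x, y] (fun t => f t * (cexp (F t) - cexp (F x))) =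
      cint `[x, y] (fun t => f t * cexp (F t)) - cexp (F x) * cint `[x, y] f.
    rewrite -cintZ//; last exact: Ff.1.
    rewrite -cintB//; last by apply: cintbZ => //; exact: Ff.1.
    by apply: eq_cint => t _; ring.
  have -> : cexp (F y) = cexp (F x) * cexp (F y - F x).
    by rewrite -cexpD [F x + _]addrC subrK.
  by rewrite -(Ff.2 x y)//; ring.
have b1 : cabs (cexp (F x) * (cexp (F y - F x) - 1 - (F y - F x))) <=
    E * (4 * expR K) * I ^+ 2.
  rewrite cabsM -mulrA ler_pM ?cabs_ge0// (le_trans (cexp_sub1z _))//.
  rewrite exprMn mulrAC (_ : 2 ^+ 2 = 4 :> R); last by rewrite expr2 -natrM.
  rewrite ler_pM ?sqr_ge0 ?mulr_ge0 ?expR_ge0//.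
    by rewrite ler_wpM2l// ler_expR FK.
  by rewrite ler_pXn2r ?nnegrE ?cabs_ge0 ?FI.
have b2 : cabs (cint `[x, y] (fun t => f t * (cexp (F t) - cexp (F x)))) <=
    E * (2 * expR K) * I ^+ 2.
  apply: (le_trans (@cabs_cint_le _ _ _
    (fun t => E * (2 * expR K) * I * cabs (f t)) _ _ _ _)) => //.
  - by case: j1.
  - by have := integrableZl (measurable_itv _ : mble `[x, y])
      (E * (2 * expR K) * I) (prim_integrable Ff x y).
  - move=> t /=; rewrite in_itv /= => /andP[xt ty].
    rewrite cabsM mulrC ler_wpM2r ?cabs_ge0//.
    have -> : cexp (F t) - cexp (F x) = cexp (F x) * (cexp (F t - F x) - 1).
      by rewrite mulrBr mulr1 -cexpD [F x + _]addrC subrK.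
    rewrite cabsM -2!mulrA ler_pM ?cabs_ge0// (le_trans (cexp_sub1 _))//.
    rewrite [expR K * I]mulrC mulrA ler_pM ?mulr_ge0 ?cabs_ge0 ?expR_ge0//.
      by rewrite ler_wpM2l// FI.
    by rewrite ler_expR FK.
  - rewrite RintegralZl//; last exact: (prim_integrable Ff).
    by rewrite -/I le_eqVlt; apply/orP; left; apply/eqP; ring.
by rewrite (le_trans (cabsB _ _))// mulrDl lerD.
Qed.

Lemma prim_cexpZ (z : R[i]) : prim (fun x => cexp (z * x%:C%C))
  (fun x => z * cexp (z * x%:C%C)).
Proof.
apply: (prim_eq (prim_cexp (primZ z prim_id))) => x.
by rewrite mulr1.
Qed.

Lemma prim0_cst F : prim F (fun=> 0) -> forall x y, F x = F y.
Proof.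
move=> [_ F0]; suff H x y : x <= y -> F x = F y.
  by move=> x y; have [/H//|/ltW/H] := leP x y.
by move=> xy; apply/esym/eqP; rewrite -subr_eq0 F0// cint0.
Qed.

Lemma cintb_itvNy f : (forall t : R, cintb `]-oo, t] f) ->
  forall a b : R, cintb `[a, b] f.
Proof.
move=> jf a b; apply: cintbS (jf b) => //.
by apply: subset_itvr.
Qed.

Lemma primNy f : (forall t : R, cintb `]-oo, t] f) ->
  prim (fun t => cint `]-oo, t] f) f.
Proof.
move=> jf; split; first exact: cintb_itvNy.
by move=> a b ab; rewrite cintNy_sub.
Qed.

End PrimRules.

(** * Exponentially weighted averages *)

Section Exhaustion.
Context {R : realType}.
Local Notation mu := (@lebesgue_measure R).
Local Notation mble := (@measurable _ (measurableTypeR R)).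
Implicit Types (g : R -> R) (D : set R).

Lemma integral_exhaust g D (F : nat -> set R) : nondecreasing_seq F ->
  (forall n, mble (F n)) -> \bigcup_n F n = D ->
  measurable_fun [set: R] g -> (forall x, 0 <= g x) ->
  (fun n => \int[mu]_(x in F n) (g x)%:E)%E @ \oo --> (\int[mu]_(x in D) (g x)%:E)%E.
Proof.
move=> ndF mF <- mg g0; apply: ge0_nondecreasing_set_cvg_integral => //.
  by move=> i; apply/measurable_EFinP; exact: measurable_funTS.
by move=> i x _; rewrite lee_fin.
Qed.

Lemma integrable_exhaust g D (F : nat -> set R) (B : R) : nondecreasing_seq F ->
  (forall n, mble (F n)) -> \bigcup_n F n = D ->
  measurable_fun [set: R] g -> (forall x, 0 <= g x) ->
  (forall n, mu.-integrable (F n) (EFin \o g) /\ \int[mu]_(x in F n) g x <= B) ->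
  mu.-integrable D (EFin \o g) /\ \int[mu]_(x in D) g x <= B.
Proof.
move=> ndF mF FD mg g0 gB.
have mD : mble D by rewrite -FD; exact: bigcup_measurable.
have IB : (\int[mu]_(x in D) (g x)%:E <= B%:E)%E.
  have cv := integral_exhaust ndF mF FD mg g0.
  rewrite -(cvg_lim (@ereal_hausdorff R) cv); apply: lime_le.
    by apply/cvg_ex; eexists; exact: cv.
  apply: nearW => n; have [jg] := gB n.
  by rewrite /Rintegral -lee_fin fineK//; exact: integrable_fin_num.
have I0 : (0 <= \int[mu]_(x in D) (g x)%:E)%E.
  by apply: integral_ge0 => x _; rewrite lee_fin.
have jD : mu.-integrable D (EFin \o g).
  apply/integrableP; split; first by apply/measurable_EFinP; exact: measurable_funTS.
  under eq_integral do rewrite /= ger0_norm//.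
  by rewrite (le_lt_trans IB)// ltry.
split => //; rewrite /Rintegral -lee_fin fineK//.
exact: (integrable_fin_num mD jD).
Qed.

Lemma bigcup_itv_nat : \bigcup_n `[- n%:R, n%:R]%classic = [set: R].
Proof.
rewrite -subTset => x _.
exists (Num.truncn `|x|).+1 => //=.
have := truncnS_gt `|x|; rewrite in_itv /= => /ltW.
by rewrite ler_norml.
Qed.

Lemma bigcup_itvNy (t : R) : \bigcup_n `[t - n%:R, t]%classic = `]-oo, t]%classic.
Proof.
apply/seteqP; split => x /=.
  by case=> n _ /=; rewrite !in_itv /= => /andP[].
rewrite in_itv /= => xt.
exists (Num.truncn `|t - x|).+1 => //=.
have /ltW := truncnS_gt `|t - x|; rewrite in_itv /= xt andbT lerBlDr -lerBlDl.
by apply: le_trans; exact: ler_norm.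
Qed.

Lemma integrable_exhaustT g (B : R) :
  measurable_fun [set: R] g -> (forall x, 0 <= g x) ->
  (forall a b, a <= b -> mu.-integrable `[a, b] (EFin \o g) /\
     \int[mu]_(x in `[a, b]) g x <= B) ->
  mu.-integrable [set: R] (EFin \o g) /\ \int[mu]_x g x <= B.
Proof.
move=> mg g0 gB; apply: (integrable_exhaust _ _ bigcup_itv_nat) => //.
- move=> m n mn; apply/subsetPset; apply: subset_itv; rewrite bnd_simp ?lerN2 ler_nat//.
- by move=> n; apply: gB; rewrite (@le_trans _ _ 0)// oppr_le0.
Qed.

Lemma integrable_exhaustNy g (B t : R) :
  measurable_fun [set: R] g -> (forall x, 0 <= g x) ->
  (forall a, a <= t -> mu.-integrable `[a, t] (EFin \o g) /\
     \int[mu]_(x in `[a, t]) g x <= B) ->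
  mu.-integrable `]-oo, t] (EFin \o g) /\ \int[mu]_(x in `]-oo, t]) g x <= B.
Proof.
move=> mg g0 gB; apply: (integrable_exhaust _ _ (bigcup_itvNy t)) => //.
- move=> m n mn; apply/subsetPset; apply: subset_itvr; rewrite bnd_simp lerB// ler_nat//.
- by move=> n; apply: gB; rewrite gerBl.
Qed.

Lemma Rintegral_subset g D E : mble D -> mble E -> D `<=` E ->
  (forall x, 0 <= g x) -> mu.-integrable E (EFin \o g) ->
  \int[mu]_(x in D) g x <= \int[mu]_(x in E) g x.
Proof.
move=> mD mE DE g0 jg; have jD := integrableS mE mD DE jg.
rewrite /Rintegral fine_le//; [exact: integrable_fin_num|exact: integrable_fin_num|].
apply: ge0_subset_integral => //; first exact: (measurable_int mu).
by move=> x _; rewrite lee_fin.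
Qed.

Lemma Rintegral_tail g (e : R) : 0 < e -> (forall x, 0 <= g x) ->
  mu.-integrable [set: R] (EFin \o g) -> measurable_fun [set: R] g ->
  exists n : nat, forall D, mble D -> (forall x, D x -> n%:R < `|x|) ->
    \int[mu]_(x in D) g x <= e.
Proof.
move=> e0 g0 jg mg.
have ndF : nondecreasing_seq (fun n => `[- n%:R, n%:R]%classic : set R).
  by move=> m n mn; apply/subsetPset; apply: subset_itv; rewrite bnd_simp ?lerN2 ler_nat.
have := integral_exhaust ndF (fun n => measurable_itv _) bigcup_itv_nat mg g0.
rewrite -(fineK (integrable_fin_num (measurableT : mble setT) jg)).
move=> /fine_cvgP[_] /cvgrPdist_lt /(_ e e0) [n _ /(_ n (leqnn n))] /= nI.
exists n => D mD Dn.
have jU : mu.-integrable (D `|` `[- n%:R, n%:R]) (EFin \o g).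
  by apply: integrableS jg => //; exact: measurableU.
have dis : [disjoint D & `[- n%:R, n%:R]%classic : set R].
  apply/disj_setPS => x [/Dn /=]; rewrite in_itv /= -ler_norml => + /le_lt_trans.
  by move=> xn /(_ _ xn); rewrite ltxx.
have := @Rintegral_subset g (D `|` `[- n%:R, n%:R]) setT _ _ _ g0 jg.
rewrite Rintegral_setU// => /(_ (measurableU _ _ mD (measurable_itv _)) measurableT).
move=> /(_ (@subsetT _ _)).
have : `|Rintegral mu setT g - fine (\int[mu]_(x in `[- n%:R, n%:R]) (g x)%:E)| < e by [].
rewrite -/(Rintegral _ _ _) => /(le_lt_trans (ler_norm _)).
rewrite -/(Rintegral mu (`[- n%:R, n%:R]) g).
move: (Rintegral mu setT g) (Rintegral mu (`[- n%:R, n%:R]) g) (Rintegral mu D g).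
by move=> a b c ? ?; lra.
Qed.

End Exhaustion.

Section RealPrim.
Context {R : realType}.
Local Notation mu := (@lebesgue_measure R).
Local Notation mble := (@measurable _ (measurableTypeR R)).

Lemma cexp_real (x : R) : cexp x%:C%C = (expR x)%:C%C.
Proof. by rewrite /cexp /= cos0 sin0 mulr1. Qed.

Lemma prim_expR (c : R) : prim (fun x => (expR (c * x))%:C%C)
  (fun x => (c * expR (c * x))%:C%C).
Proof.
have H x : cexp (c%:C%C * x%:C%C) = (expR (c * x))%:C%C.
  by rewrite -rmorphM cexp_real.
have := prim_cexpZ (c%:C%C).
rewrite (_ : (fun x : R => cexp _) = (fun x => (expR (c * x))%:C%C)); last first.
  by apply/funext => x; rewrite H.
by move=> /prim_eq; apply => x; rewrite H rmorphM.
Qed.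

Lemma prim_realP (H h : R -> R) : prim (fun x => (H x)%:C%C) (fun x => (h x)%:C%C) ->
  (forall a b, mu.-integrable `[a, b] (EFin \o h)) /\
  (forall a b, a <= b -> H b - H a = \int[mu]_(x in `[a, b]) h x).
Proof.
move=> [jh Hh]; have jh' a b : mu.-integrable `[a, b] (EFin \o h).
  by have := cintb_Re (measurable_itv _) (jh a b).
split => // a b ab; apply: complexI.
by rewrite rmorphB Hh// cint_real.
Qed.

Lemma prim_real_measurable (H h : R -> R) :
  prim (fun x => (H x)%:C%C) (fun x => (h x)%:C%C) ->
  measurable_fun [set: R] H /\ measurable_fun [set: R] h.
Proof. by move=> Hh; have [] := prim_cmeas Hh; have [] := prim_cmeas_density Hh. Qed.

Lemma measurable_expRM (c : R) : measurable_fun [set: R] (fun x => expR (c * x)).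
Proof. by have [] := prim_real_measurable (prim_expR c). Qed.

Lemma Rintegral_expR (c a b : R) : c != 0 -> a <= b ->
  mu.-integrable `[a, b] (EFin \o (fun x => expR (c * x))) /\
  \int[mu]_(x in `[a, b]) expR (c * x) = (expR (c * b) - expR (c * a)) / c.
Proof.
move=> c0 ab; have [jc Hc] := prim_realP (prim_expR c).
have j1 : mu.-integrable `[a, b] (EFin \o (fun x => expR (c * x))).
  have := integrableZl (measurable_itv _ : mble `[a, b]) c^-1 (jc a b).
  apply: eq_integrable => // x _ /=.
  by rewrite -EFinM mulrA mulVf// mul1r.
split => //; rewrite Hc// RintegralZl//.
by rewrite mulrC mulrA mulVf// mul1r.
Qed.

Lemma Rintegral_expRNy (c t : R) : 0 < c ->
  mu.-integrable `]-oo, t] (EFin \o (fun x => expR (c * x))) /\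
  \int[mu]_(x in `]-oo, t]) expR (c * x) <= expR (c * t) / c.
Proof.
move=> c0; apply: integrable_exhaustNy; first exact: measurable_expRM.
  by move=> x; exact: expR_ge0.
move=> a at_; have [j ->] := Rintegral_expR (lt0r_neq0 c0) at_.
by split => //; rewrite ler_pM2r ?invr_gt0// gerBl expR_ge0.
Qed.

End RealPrim.

Section Weighted.
Context {R : realType}.
Local Notation mu := (@lebesgue_measure R).
Local Notation mble := (@measurable _ (measurableTypeR R)).

Definition sqint (p : R -> R[i]) : Prop :=
  cmeas p /\ mu.-integrable [set: R] (EFin \o (fun x => cabs (p x) ^+ 2)).

Definition sqn (p : R -> R[i]) : R := \int[mu]_x cabs (p x) ^+ 2.

Definition wprim (p : R -> R[i]) (w t : R) : R :=
  \int[mu]_(s in `]-oo, t]) (cabs (p s) * expR (2 * w * s)).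

(** With $w=\operatorname{Im}\lambda^2$ this is the weighted average whose supremum is $M$. The
    factor depending on [t] stays outside the integral, so that [wprim] is a primitive, and an
    increasing majorant for the Riccati terms. *)
Definition wavg (p : R -> R[i]) (w t : R) : R :=
  expR (- (2 * w) * t) * wprim p w t.

(** Essentially the $L^2$ mass of [p] in a window of length $1/w$ to the left of [t]; unlike [sqn p]
    it becomes uniformly small as [w] grows. *)
Definition wsq (p : R -> R[i]) (w t : R) : R :=
  \int[mu]_(s in `]-oo, t]) (cabs (p s) ^+ 2 * expR (2 * w * (s - t))).

Variables (p : R -> R[i]) (w : R).
Hypotheses (hp : sqint p) (w0 : 0 < w).

Let w20 : 0 < 2 * w. Proof. by rewrite mulr_gt0. Qed.

Lemma sqint_measurable : measurable_fun [set: R] (fun x => cabs (p x) ^+ 2).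
Proof. by apply: measurable_funX; apply: measurable_cabs; case: hp. Qed.

Lemma sqint_integrable D : mble D ->
  mu.-integrable D (EFin \o (fun x => cabs (p x) ^+ 2)).
Proof. by move=> mD; case: hp => _; apply: integrableS. Qed.

Lemma sqn_ge0 : 0 <= sqn p.
Proof. by apply: Rintegral_ge0 => x _; exact: sqr_ge0. Qed.

Lemma sqint_le D : mble D -> \int[mu]_(x in D) cabs (p x) ^+ 2 <= sqn p.
Proof.
move=> mD; apply: Rintegral_subset => // [x|]; first exact: sqr_ge0.
exact: sqint_integrable.
Qed.

Lemma wsq_integrable t : mu.-integrable `]-oo, t]
  (EFin \o (fun s => cabs (p s) ^+ 2 * expR (2 * w * (s - t)))).
Proof.
apply: (le_integrable _ _ _ (sqint_integrable (measurable_itv `]-oo, t]))) => //.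
  apply/measurable_EFinP/measurable_funTS/measurable_funM.
    exact: sqint_measurable.
  apply: (measurableT_comp (@measurable_expR R)).
  apply: measurable_funM; first exact: measurable_cst.
  by apply: measurable_funB.
move=> s /=; rewrite in_itv /= => st; rewrite lee_fin.
rewrite !ger0_norm ?mulr_ge0 ?cabs_ge0 ?expR_ge0// ler_piMr ?mulr_ge0 ?cabs_ge0//.
by rewrite -[leRHS]expR0 ler_expR mulr_ge0_le0 ?subr_le0 ?(ltW w20).
Qed.

Lemma wprim_integrable t : mu.-integrable `]-oo, t]
  (EFin \o (fun s => cabs (p s) * expR (2 * w * s))).
Proof.
have [je _] := Rintegral_expRNy t w20.
have js := integrableZl (measurable_itv _ : mble `]-oo, t]) (expR (2 * w * t))
  (sqint_integrable (measurable_itv `]-oo, t])).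
have := integrableD (measurable_itv _ : mble `]-oo, t]) js je.
apply: le_integrable => //.
  apply/measurable_EFinP/measurable_funTS/measurable_funM.
    by apply: measurable_cabs; case: hp.
  exact: measurable_expRM.
move=> s /=; rewrite in_itv /= => st; rewrite -?EFinM -?EFinD ?lee_fin.
rewrite !ger0_norm ?mulr_ge0 ?cabs_ge0 ?expR_ge0//; last first.
  by rewrite addr_ge0 ?mulr_ge0 ?expR_ge0 ?cabs_ge0.
have e0 := expR_ge0 (2 * w * s).
have et : expR (2 * w * s) <= expR (2 * w * t) by rewrite ler_expR ler_pM2l.
have c0 := cabs_ge0 (p s).
have := ler_wpM2r (sqr_ge0 (cabs (p s))) et.
have : 0 <= (cabs (p s) - 1) ^+ 2 * expR (2 * w * s) by rewrite mulr_ge0 ?sqr_ge0.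
move: (cabs (p s)) (expR (2 * w * s)) (expR (2 * w * t)) c0 e0 et => c e f.
nra.
Qed.

Lemma wprim_ge0 t : 0 <= wprim p w t.
Proof.
by apply: Rintegral_ge0 => s _; rewrite mulr_ge0 ?cabs_ge0 ?expR_ge0.
Qed.

Lemma wavg_ge0 t : 0 <= wavg p w t.
Proof. by rewrite mulr_ge0 ?expR_ge0 ?wprim_ge0. Qed.

Lemma wprim_wavg t : wprim p w t = expR (2 * w * t) * wavg p w t.
Proof. by rewrite /wavg mulrA -expRD -mulrDl subrr mul0r expR0 mul1r. Qed.

(** Integrates $|p|\le\frac k2|p|^2+\frac1{2k}$ against the weight, whose mass is at most $1/(2w)$.
    Keeping [k] free makes this a substitute for Cauchy-Schwarz. *)
Lemma wavg_amgm k t : 0 < k ->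
  wavg p w t <= k / 2 * wsq p w t + (4 * k * w)^-1.
Proof.
move=> k0; have [je Ie] := Rintegral_expRNy t w20.
rewrite -(ler_pM2l (expR_gt0 (2 * w * t))) -wprim_wavg.
have j1 : mu.-integrable `]-oo, t] (EFin \o (fun s =>
    (k / 2 * expR (2 * w * t)) * (cabs (p s) ^+ 2 * expR (2 * w * (s - t))))).
  by have := integrableZl (measurable_itv _ : mble `]-oo, t])
    (k / 2 * expR (2 * w * t)) (wsq_integrable t).
have j2 : mu.-integrable `]-oo, t] (EFin \o (fun s =>
    (2 * k)^-1 * expR (2 * w * s))).
  by have := integrableZl (measurable_itv _ : mble `]-oo, t]) (2 * k)^-1 je.
apply: (@le_trans _ _ (\int[mu]_(s in `]-oo, t])
   ((k / 2 * expR (2 * w * t)) * (cabs (p s) ^+ 2 * expR (2 * w * (s - t)))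
     + (2 * k)^-1 * expR (2 * w * s)))).
  apply: le_Rintegral => //.
  - exact: wprim_integrable.
  - by have := integrableD (measurable_itv _ : mble `]-oo, t]) j1 j2.
  move=> s _.
  rewrite (_ : k / 2 * _ * (_ * _) = k / 2 * cabs (p s) ^+ 2 * expR (2 * w * s)).
    rewrite -mulrDl ler_wpM2r ?expR_ge0// -subr_ge0.
    rewrite (_ : _ - _ = (k * cabs (p s) - 1) ^+ 2 / (2 * k)).
      by rewrite divr_ge0 ?sqr_ge0// mulr_ge0// ltW.
    by field; rewrite lt0r_neq0.
  have -> : expR (2 * w * s) = expR (2 * w * t) * expR (2 * w * (s - t)).
    by rewrite -expRD; congr (expR _); ring.
  by ring.
rewrite RintegralD// !RintegralZl//; last exact: wsq_integrable.
rewrite mulrDr; apply: lerD; first by rewrite /wsq mulrA [expR _ * _]mulrC.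
apply: (le_trans (ler_wpM2l _ Ie)); first by rewrite invr_ge0 mulr_ge0// ltW.
rewrite le_eqVlt; apply/orP; left; apply/eqP; field.
by rewrite !lt0r_neq0.
Qed.

Lemma wsq_ge0 t : 0 <= wsq p w t.
Proof.
by apply: Rintegral_ge0 => s _; rewrite !mulr_ge0 ?cabs_ge0 ?expR_ge0.
Qed.

Lemma wavg_sq t : wavg p w t ^+ 2 <= wsq p w t / (2 * w).
Proof.
have := wavg_ge0 t; rewrite le_eqVlt => /predU1P[<-|m0].
  by rewrite expr0n /= divr_ge0 ?wsq_ge0// ltW.
(* With this [k] the last term of [wavg_amgm] is half of the average itself and is absorbed on the
   left. *)
have k0 : 0 < (2 * w * wavg p w t)^-1 by rewrite invr_gt0 mulr_gt0.
have := wavg_amgm t k0.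
move: (wavg p w t) (wsq p w t) m0 => m A m0 {k0}.
rewrite (_ : (4 * _ * w)^-1 = m / 2); last by field; rewrite !lt0r_neq0.
rewrite (_ : _ / 2 * A = A / (4 * w * m)); last by field; rewrite !lt0r_neq0.
rewrite -lerBlDr (_ : m - m / 2 = m / 2); last by field.
rewrite ler_pdivlMr ?mulr_gt0// => h; rewrite ler_pdivlMr//.
by apply: le_trans h; rewrite le_eqVlt; apply/orP; left; apply/eqP; field.
Qed.

Lemma wsq_le t : wsq p w t <= \int[mu]_(s in `]-oo, t]) cabs (p s) ^+ 2.
Proof.
apply: le_Rintegral => //; [exact: wsq_integrable|exact: sqint_integrable|].
move=> s /=; rewrite in_itv /= => st; rewrite ler_piMr ?sqr_ge0//.
by rewrite -[leRHS]expR0 ler_expR mulr_ge0_le0 ?subr_le0 ?(ltW w20).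
Qed.

Lemma wavg_bound t : wavg p w t ^+ 2 <= sqn p / (2 * w).
Proof.
rewrite (le_trans (wavg_sq t))// ler_wpM2r ?invr_ge0 ?(ltW w20)//.
by rewrite (le_trans (wsq_le t))// sqint_le.
Qed.

Lemma wavg_cvgNy e : 0 < e -> exists T, forall t, t <= T -> wavg p w t ^+ 2 <= e.
Proof.
move=> e0.
have [||n tailn] := @Rintegral_tail _ (fun x => cabs (p x) ^+ 2) (e * (2 * w)) _ _ hp.2 sqint_measurable.
- by rewrite mulr_gt0.
- by move=> x; exact: sqr_ge0.
exists (- n.+1%:R) => t tn; rewrite (le_trans (wavg_sq t))// ler_pdivrMr//.
rewrite (le_trans (wsq_le t))// tailn// => x /=; rewrite in_itv /= => xt.
rewrite ltr_normr ltrNr (le_lt_trans (le_trans xt tn)) ?orbT// ltrN2 ltr_nat//.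
Qed.

Lemma wprim_prim : prim (fun t => (wprim p w t)%:C%C)
  (fun t => (cabs (p t) * expR (2 * w * t))%:C%C).
Proof.
rewrite (_ : (fun t => _) = (fun t => cint `]-oo, t]
    (fun t => (cabs (p t) * expR (2 * w * t))%:C%C))).
  apply: primNy => t; split.
    apply: cmeas_real; apply: measurable_funM; last exact: measurable_expRM.
    by apply: measurable_cabs; case: hp.
  rewrite (_ : (fun x => _) = (fun x => cabs (p x) * expR (2 * w * x))).
    exact: wprim_integrable.
  by apply/funext => x; rewrite cabsR ger0_norm// mulr_ge0 ?cabs_ge0 ?expR_ge0.
by apply/funext => t; rewrite cint_real//; exact: wprim_integrable.
Qed.

Lemma wavg_prim : prim (fun t => (wavg p w t)%:C%C)
  (fun t => (cabs (p t) - 2 * w * wavg p w t)%:C%C).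
Proof.
have := primM (prim_expR (- (2 * w))) wprim_prim.
rewrite (_ : (fun t => _ * _) = (fun t => (wavg p w t)%:C%C)); last first.
  by apply/funext => t; rewrite -rmorphM.
move=> /prim_eq; apply => t; rewrite -!rmorphM -rmorphD; congr (_%:C%C).
rewrite [cabs _ * _]mulrC [in X in _ + X]mulrA -expRD -mulrDl addNr mul0r expR0 mul1r.
by rewrite /wavg; ring.
Qed.

Lemma wavg_measurable : measurable_fun [set: R] (wavg p w).
Proof. by have [] := prim_real_measurable wavg_prim. Qed.

(** Energy estimate for $m'=|p|-2wm$: completing the square gives $(m^2)'\le|p|^2/(2w)-2wm^2$.
    Integrating, the upper boundary term has a favourable sign and the lower one is at most $2we$
    once the starting point is far enough to the left. *)
Lemma wavg_energy e S T : 0 < e -> S <= T ->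
  mu.-integrable `[S, T] (EFin \o (fun t => wavg p w t ^+ 2)) /\
  \int[mu]_(t in `[S, T]) wavg p w t ^+ 2 <= sqn p / (4 * w ^+ 2) + e.
Proof.
move=> e0 ST.
have := primM wavg_prim wavg_prim.
rewrite (_ : (fun t => _ * _) = (fun t => (wavg p w t ^+ 2)%:C%C)); last first.
  by apply/funext => t; rewrite -rmorphM -expr2.
move=> /prim_eq H.
have {H} := H (fun t => (2 * (wavg p w t * (cabs (p t) - 2 * w * wavg p w t)))%:C%C).
have E x : (cabs (p x) - 2 * w * wavg p w x)%:C%C * (wavg p w x)%:C%C +
  (wavg p w x)%:C%C * (cabs (p x) - 2 * w * wavg p w x)%:C%C =
  (2 * (wavg p w x * (cabs (p x) - 2 * w * wavg p w x)))%:C%C :> R[i].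
  by rewrite -!rmorphM -rmorphD; congr (_%:C%C); ring.
move=> /(_ E) {E} /prim_realP[jd Hd].
have j2 a b : a <= b -> mu.-integrable `[a, b] (EFin \o (fun t => wavg p w t ^+ 2)).
  move=> ab; apply: (le_integrable _ _ _ (integrable_itv_cst a b (sqn p / (2 * w)))) => //.
    apply/measurable_EFinP/measurable_funTS/measurable_funX; exact: wavg_measurable.
  move=> x _ /=; rewrite lee_fin !ger0_norm ?sqr_ge0 ?wavg_bound//.
  by rewrite divr_ge0 ?sqn_ge0// ltW.
split; first exact: j2.
have [S0 HS0] := wavg_cvgNy (mulr_gt0 e0 w20).
pose S1 := Num.min S S0.
have S1T : S1 <= T by rewrite (le_trans _ ST)// ge_min lexx.
apply: (@le_trans _ _ (\int[mu]_(t in `[S1, T]) wavg p w t ^+ 2)).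
  apply: Rintegral_subset => //.
  - by apply: subset_itvr; rewrite bnd_simp ge_min lexx.
  - by move=> x; exact: sqr_ge0.
  - exact: j2.
have := Hd S1 T S1T.
have m1 : wavg p w S1 ^+ 2 <= e * (2 * w) by apply: HS0; rewrite ge_min lexx orbT.
have m2 := sqr_ge0 (wavg p w T).
have jp : mu.-integrable `[S1, T] (EFin \o (fun x => cabs (p x) ^+ 2)).
  exact: sqint_integrable.
have jp' : mu.-integrable `[S1, T] (EFin \o (fun x => (2 * w)^-1 * cabs (p x) ^+ 2)).
  by have := integrableZl (measurable_itv _ : mble `[S1, T]) (2 * w)^-1 jp.
have jm' : mu.-integrable `[S1, T] (EFin \o (fun x => 2 * w * wavg p w x ^+ 2)).
  by have := integrableZl (measurable_itv _ : mble `[S1, T]) (2 * w) (j2 _ _ S1T).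
have le1 : \int[mu]_(t in `[S1, T]) (2 * w * wavg p w t ^+ 2) <=
    \int[mu]_(t in `[S1, T]) ((2 * w)^-1 * cabs (p t) ^+ 2 -
       2 * (wavg p w t * (cabs (p t) - 2 * w * wavg p w t))).
  apply: le_Rintegral => //.
    by have := integrableB (measurable_itv _ : mble `[S1, T]) jp' (jd S1 T).
  move=> x _; rewrite -subr_ge0 (_ : _ - _ =
    (cabs (p x) - 2 * w * wavg p w x) ^+ 2 / (2 * w)).
    by rewrite divr_ge0 ?sqr_ge0// ltW.
  by field; rewrite lt0r_neq0.
move: le1; rewrite RintegralB//.
rewrite [leLHS]RintegralZl//; last exact: j2.
rewrite [X in X - _]RintegralZl//.
have pn : \int[mu]_(t in `[S1, T]) cabs (p t) ^+ 2 <= sqn p by exact: sqint_le.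
move: (Rintegral mu _ _) (Rintegral mu _ _) (Rintegral mu _ _) pn => K I J Jn.
move: (wavg p w T ^+ 2) (wavg p w S1 ^+ 2) m1 m2 => M1 M2 m1 m2.
move=> le1 le2.
have le3 : 2 * w * I <= (2 * w)^-1 * sqn p + e * (2 * w).
  have : (2 * w)^-1 * J <= (2 * w)^-1 * sqn p.
    by rewrite ler_wpM2l// invr_ge0 ltW.
  lra.
rewrite -(ler_pM2l w20) (le_trans le3)// le_eqVlt; apply/orP; left; apply/eqP.
by field; rewrite lt0r_neq0.
Qed.

(** Young's inequality for convolution with the kernel $e^{-2ws}$ on $s>0$, of mass $1/(2w)$,
    reached here through the energy estimate. *)
Lemma wavg_L2 : mu.-integrable [set: R] (EFin \o (fun t => wavg p w t ^+ 2)) /\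
  \int[mu]_t wavg p w t ^+ 2 <= sqn p / (4 * w ^+ 2).
Proof.
have H e : 0 < e -> mu.-integrable [set: R] (EFin \o (fun t => wavg p w t ^+ 2)) /\
  \int[mu]_t wavg p w t ^+ 2 <= sqn p / (4 * w ^+ 2) + e.
  move=> e0; apply: integrable_exhaustT => //.
  - apply: measurable_funX; exact: wavg_measurable.
  - by move=> x; exact: sqr_ge0.
  - by move=> a b; exact: wavg_energy.
by split; [case: (H 1 ltr01)|apply/ler_addgt0Pr => e e0; case: (H e e0)].
Qed.

End Weighted.

(** * The Riccati series *)

Section Smallness.
Context {R : realType}.
Local Notation mu := (@lebesgue_measure R).
Local Notation mble := (@measurable _ (measurableTypeR R)).
Variables (p : R -> R[i]).
Hypothesis hp : sqint p.

(** The window is cut at $t-h$. The near part is small by absolute continuity of $\int|p|^2$,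
    uniformly in [t] since only the length [h] matters; the far part carries the factor
    $e^{-2wh}$. *)
Lemma wsq_small e : 0 < e ->
  exists2 W, 0 < W & forall w t, W <= w -> wsq p w t <= e.
Proof.
move=> e0; have e20 : 0 < e / 2 by rewrite divr_gt0.
have [d [d0 Hd]] := integral_normr_continuous hp.2 e20.
pose h := d / 2; have h0 : 0 < h by rewrite divr_gt0.
have n0 := sqn_ge0 p.
(* Ensures $weh\ge\|p\|^2$; since $2wh<e^{2wh}$, the far part is then at most $e/2$. The added 1
   keeps the threshold positive when $p=0$. *)
exists ((sqn p + 1) / (h * e)); first by rewrite divr_gt0 ?mulr_gt0// ltr_wpDl.
move=> w t Ww.
have w0 : 0 < w by apply: lt_le_trans Ww; rewrite divr_gt0 ?mulr_gt0// ltr_wpDl.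
have tht : t - h <= t by rewrite gerBl ltW.
have jw := wsq_integrable hp w0 t.
have := Rintegral_itvB (x := t - h) jw; rewrite !bnd_simp => /(_ isT tht).
move=> /eqP; rewrite subr_eq => /eqP; rewrite /wsq => ->.
rewrite (_ : e = e / 2 + e / 2); last by lra.
apply: lerD.
  apply: (@le_trans _ _ (\int[mu]_(s in `]t - h, t]) `|cabs (p s) ^+ 2|)); last first.
    apply/ltW/Hd => //=; rewrite lebesgue_measure_itv /= lte_fin ltrBlDl ltrDr h0.
    rewrite -EFinB lte_fin /h; lra.
  apply: le_Rintegral => //.
  - by apply: integrableS jw => //; exact: subset_itvr.
  - by apply: integrable_norm; exact: sqint_integrable.
  - move=> s /=; rewrite in_itv /= => /andP[_ st].
    rewrite ger0_norm ?sqr_ge0// ler_piMr ?sqr_ge0//.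
    by rewrite -[leRHS]expR0 ler_expR mulr_ge0_le0 ?subr_le0// mulr_ge0// ltW.
apply: (@le_trans _ _ (\int[mu]_(s in `]-oo, t - h])
    (expR (- (2 * w * h)) * cabs (p s) ^+ 2))).
  apply: le_Rintegral => //.
  - by apply: integrableS jw => //; exact: subset_itvl.
  - by have := integrableZl (measurable_itv _ : mble `]-oo, t - h])
      (expR (- (2 * w * h))) (sqint_integrable hp (measurable_itv _)).
  move=> s /=; rewrite in_itv /= => st; rewrite mulrC ler_wpM2r ?sqr_ge0//.
  rewrite ler_expR -mulrN ler_pM2l ?mulr_gt0//.
  by rewrite lerBlDl.
rewrite RintegralZl//; last exact: sqint_integrable.
apply: (@le_trans _ _ (expR (- (2 * w * h)) * sqn p)).
  by rewrite ler_wpM2l ?expR_ge0//; exact: sqint_le.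
have x0 : 0 < 2 * w * h by rewrite !mulr_gt0.
rewrite expRN mulrC ler_pdivrMr ?expR_gt0//.
apply: (@le_trans _ _ (e / 2 * (2 * w * h))); last first.
  by rewrite ler_wpM2l ?ltW// (le_lt_trans _ (expR_gt1Dx (lt0r_neq0 x0)))// lerDr.
rewrite (_ : e / 2 * _ = w * (h * e)); last by field.
move: Ww; rewrite ler_pdivrMr ?mulr_gt0//; apply: le_trans.
by rewrite lerDl.
Qed.

End Smallness.

Section History.
Variables (T : Type) (x0 : T) (step : seq T -> T).

(** Course-of-values recursion: each new term sees the list of all earlier ones, as convolution
    recurrences require. It serves the Catalan numbers, the Riccati terms, the exponential
    coefficients and the lists of words. *)
Fixpoint history n : seq T :=
  if n is m.+1 then rcons (history m) (step (history m)) else [::].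

Definition hrec n : T := step (history n).

Lemma size_history n : size (history n) = n.
Proof. by elim: n => //= n IH; rewrite size_rcons IH. Qed.

Lemma nth_history n k : (k < n)%N -> nth x0 (history n) k = hrec k.
Proof.
elim: n => //= n IH; rewrite ltnS leq_eqVlt nth_rcons size_history => /predU1P[->|kn].
  by rewrite ltnn eqxx.
by rewrite kn IH.
Qed.

End History.

Section Triangle.
Context {A : comNzRingType}.

Lemma triangle_sum (f : nat -> nat -> A) N :
  \sum_(n < N) \sum_(k < n.+1) f k (n - k)%N =
  \sum_(i < N) \sum_(j < N | (i + j < N)%N) f i j.
Proof.
elim: N => [|N IH]; first by rewrite !big_ord0.
rewrite big_ord_recr /= IH.
rewrite [RHS](_ : _ = \sum_(i < N.+1) (\sum_(j < N.+1 | (i + j < N)%N) f i j +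
   f i (N - i)%N)); last first.
  apply: eq_bigr => i _.
  have iN : (N - i < N.+1)%N by rewrite ltnS leq_subr.
  rewrite (bigD1 (Ordinal iN)) /=; last by rewrite subnKC// -ltnS.
  rewrite addrC; congr (_ + _); apply: eq_bigl => j.
  by rewrite -val_eqE /=; have := ltn_ord i; lia.
rewrite big_split /=; congr (_ + _).
rewrite big_ord_recr /= [X in _ = _ + X]big1 ?addr0; last first.
  by move=> j; rewrite ltnNge leq_addr.
apply: eq_bigr => i _; rewrite big_mkcond [RHS]big_mkcond big_ord_recr /=.
by rewrite ltnNge leq_addl /= addr0.
Qed.

End Triangle.

Section Catalan.
Context {R : realType}.

Definition cat_rec : seq R -> R := fun s =>
  if size s is n.+1 then \sum_(k < n.+1) s`_k * s`_(n - k) else 1.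

(** Catalan numbers. Their convolution recurrence is that of the Riccati terms with each term
    replaced by a bound of its size. *)
Definition catalan : nat -> R := hrec cat_rec.

Lemma catalan0 : catalan 0 = 1. Proof. by []. Qed.

Lemma catalanS n : catalan n.+1 = \sum_(k < n.+1) catalan k * catalan (n - k).
Proof.
rewrite /catalan /hrec /cat_rec size_history; apply: eq_bigr => k _.
by rewrite !(nth_history 0)// ltnS leq_subr.
Qed.

Lemma catalan_ge0 n : 0 <= catalan n.
Proof.
elim/ltn_ind: n => -[_|n IH]; first by rewrite catalan0.
rewrite catalanS sumr_ge0// => k _.
by rewrite mulr_ge0// IH// ltnS leq_subr.
Qed.

Lemma triangle_le (a : nat -> R) N : (forall n, 0 <= a n) ->
  \sum_(n < N) \sum_(k < n.+1) a k * a (n - k)%N <= (\sum_(n < N) a n) ^+ 2.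
Proof.
move=> a0; rewrite (triangle_sum (fun i j => a i * a j)) expr2 mulr_suml.
apply: ler_sum => i _; rewrite mulr_sumr big_mkcond /=.
by apply: ler_sum => j _; case: ifP => // _; rewrite mulr_ge0.
Qed.

(* The partial sums of the generating function at 1/4 are at most the fixed
   point 2 of s = 1 + s^2 / 4. *)
Lemma catalan_partial N : \sum_(n < N) catalan n / 4 ^+ n <= 2.
Proof.
elim: N => [|N IH]; first by rewrite big_ord0.
rewrite big_ord_recl /= catalan0 expr0 divr1.
rewrite (eq_bigr (fun n : 'I_N => 4^-1 * \sum_(k < n.+1)
   (catalan k / 4 ^+ k) * (catalan (n - k) / 4 ^+ (n - k)))); last first.
  move=> n _; rewrite /bump /= add1n catalanS mulr_suml mulr_sumr; apply: eq_bigr => k _.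
  have kn : (k <= n)%N by rewrite -ltnS.
  have -> : 4 ^+ n.+1 = 4 * (4 ^+ k * 4 ^+ (n - k)) :> R.
    by rewrite -exprD subnKC// exprS.
  by field; rewrite !expf_neq0// pnatr_eq0.
rewrite -mulr_sumr.
have := @triangle_le (fun n => catalan n / 4 ^+ n) N.
have p0 n : 0 <= catalan n / 4 ^+ n by rewrite divr_ge0 ?catalan_ge0// exprn_ge0.
move=> /(_ p0).
have : (\sum_(n < N) catalan n / 4 ^+ n) ^+ 2 <= 2 ^+ 2.
  by rewrite ler_pXn2r ?nnegrE// sumr_ge0.
rewrite (_ : 2 ^+ 2 = 4 :> R); last by rewrite -natrX.
move: (\sum_(n < N) _) (_ ^+ 2) => {p0 IH} a b; lra.
Qed.

Lemma catalan_le n : catalan n <= 2 * 4 ^+ n.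
Proof.
rewrite -ler_pdivrMr ?exprn_gt0//.
have := catalan_partial n.+1; rewrite big_ord_recr /=; apply: le_trans.
by rewrite lerDr sumr_ge0// => i _; rewrite divr_ge0 ?catalan_ge0// exprn_ge0.
Qed.

End Catalan.

Section GeomSeries.
Context {R : realType}.

(** With ratio at most $1/2$ the tail is at most twice its first term. The rate matters as much as
    the limit: both the expansion in $\varepsilon$ and the large-$\lambda$ limit use it. *)
Lemma geom_series_limit (x : nat -> R) (C r : R) : 0 <= C -> 0 <= r -> r <= 2^-1 ->
  (forall n, `|x n| <= C * r ^+ n) ->
  exists l, forall N, `|l - \sum_(n < N) x n| <= 2 * C * r ^+ N.
Proof.
move=> C0 r0 r12 xC.
have r1 : r < 1 by rewrite (le_lt_trans r12)// invf_lt1// ltr1n.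
have step N j : `|\sum_(n < N + j) x n - \sum_(n < N) x n| <=
    2 * C * (r ^+ N - r ^+ (N + j)).
  elim: j => [|j IH]; first by rewrite addn0 !subrr normr0 mulr0.
  rewrite addnS big_ord_recr /= addrAC (le_trans (ler_normD _ _))//.
  rewrite (le_trans (lerD IH (xC _)))// exprS.
  have := exprn_ge0 (N + j) r0.
  move: (r ^+ (N + j)) (r ^+ N) => a b a0.
  rewrite -subr_ge0 (_ : _ - _ = 2 * C * a * (2^-1 - r)); last by field.
  by rewrite !mulr_ge0// subr_ge0.
have cv : cvgn (series x).
  apply: normed_cvg; apply: (@series_le_cvg _ _ (geometric C r)).
  - by move=> n; exact: normr_ge0.
  - by move=> n; rewrite /geometric /= mulr_ge0// exprn_ge0.
  - by move=> n; exact: xC.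
  - by apply: is_cvg_geometric_series; rewrite ger0_norm.
exists (limn (series x)) => N.
have cvN : (fun n => `|series x n - \sum_(n < N) x n|) @ \oo -->
    `|limn (series x) - \sum_(n < N) x n|.
  by apply: cvg_norm; apply: cvgB => //; exact: cvg_cst.
rewrite -(cvg_lim (@Rhausdorff R) cvN); apply: limr_le.
  by apply/cvg_ex; eexists; exact: cvN.
exists N => // n /= Nn; rewrite /series /= big_mkord -(subnKC Nn).
rewrite (le_trans (step _ _))// ler_wpM2l ?mulr_ge0// gerBl exprn_ge0//.
Qed.

Lemma geom_series_limitC (z : nat -> R[i]) (C r : R) :
  0 <= C -> 0 <= r -> r <= 2^-1 -> (forall n, cabs (z n) <= C * r ^+ n) ->
  exists l, forall N, cabs (l - \sum_(n < N) z n) <= 4 * C * r ^+ N.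
Proof.
move=> C0 r0 r12 zC.
have [|a Ha] := @geom_series_limit (fun n => complex.Re (z n)) C r C0 r0 r12.
  by move=> n; rewrite (le_trans (Re_le_cabs _)).
have [|b Hb] := @geom_series_limit (fun n => complex.Im (z n)) C r C0 r0 r12.
  by move=> n; rewrite (le_trans (Im_le_cabs _)).
exists (Complex a b) => N; rewrite (le_trans (cabs_le _))//.
have Rs : complex.Re (\sum_(n < N) z n) = \sum_(n < N) complex.Re (z n).
  by apply: (big_morph (@complex.Re R)); [exact: cReD|].
have Is : complex.Im (\sum_(n < N) z n) = \sum_(n < N) complex.Im (z n).
  by apply: (big_morph (@complex.Im R)); [exact: cImD|].
rewrite cReD cImD cReN cImN Rs Is /=.
rewrite (_ : 4 * C * r ^+ N = 2 * C * r ^+ N + 2 * C * r ^+ N); last by ring.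
by apply: lerD; [exact: Ha|exact: Hb].
Qed.

End GeomSeries.

Section WavgPairing.
Context {R : realType}.
Local Notation mu := (@lebesgue_measure R).
Local Notation mble := (@measurable _ (measurableTypeR R)).

(** Weighted arithmetic-geometric mean together with [wavg_L2]. The gain $1/w$ compensates
    $|\lambda|^2$ in a sector, and the free [th] later lets a small [p] (a mollification defect) be
    weighed against a fixed [f]. *)
Lemma wavg_pairing (f p : R -> R[i]) (w th : R) : sqint f -> sqint p ->
  0 < w -> 0 < th ->
  mu.-integrable [set: R] (EFin \o (fun t => cabs (f t) * wavg p w t)) /\
  \int[mu]_t (cabs (f t) * wavg p w t) <=
    th * sqn p / (4 * w) + sqn f / (4 * th * w).
Proof.
move=> hf hp w0 th0; have [jm Im] := wavg_L2 hp w0.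
have thw : 0 < th * w by rewrite mulr_gt0.
have jm' : mu.-integrable [set: R] (EFin \o (fun t => th * w * wavg p w t ^+ 2)).
  by have := integrableZl (measurableT : mble setT) (th * w) jm.
have jf' : mu.-integrable [set: R]
    (EFin \o (fun t => (4 * th * w)^-1 * cabs (f t) ^+ 2)).
  by have := integrableZl (measurableT : mble setT) (4 * th * w)^-1 hf.2.
have js : mu.-integrable [set: R] (EFin \o (fun t =>
    th * w * wavg p w t ^+ 2 + (4 * th * w)^-1 * cabs (f t) ^+ 2)).
  by have := integrableD (measurableT : mble setT) jm' jf'.
have le t : cabs (f t) * wavg p w t <=
    th * w * wavg p w t ^+ 2 + (4 * th * w)^-1 * cabs (f t) ^+ 2.
  rewrite -subr_ge0 (_ : _ - _ =
    (2 * th * w * wavg p w t - cabs (f t)) ^+ 2 / (4 * (th * w))).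
    by rewrite divr_ge0 ?sqr_ge0 ?mulr_ge0// ltW.
  by field; rewrite !lt0r_neq0.
have jfm : mu.-integrable [set: R] (EFin \o (fun t => cabs (f t) * wavg p w t)).
  apply: (le_integrable _ _ _ js) => //.
    apply/measurable_EFinP/measurable_funM; last exact: wavg_measurable.
    by apply: measurable_cabs; case: hf.
  move=> t _ /=; rewrite lee_fin ger0_norm ?(mulr_ge0 (cabs_ge0 _)) ?wavg_ge0//.
  by rewrite (le_trans (le t))// ler_norm.
split; first exact: jfm.
apply: (le_trans (le_Rintegral _ jfm js (fun t _ => le t))); first exact: measurableT.
rewrite RintegralD// !RintegralZl//; last by case: hf.
apply: lerD; last by rewrite mulrC.
rewrite (le_trans (ler_wpM2l (ltW thw) Im))// le_eqVlt; apply/orP; left; apply/eqP.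
by field; rewrite lt0r_neq0.
Qed.

End WavgPairing.

Section Riccati.
Context {R : realType}.
Local Notation mu := (@lebesgue_measure R).
Local Notation mble := (@measurable _ (measurableTypeR R)).

Definition ric_step (aX aY : R -> R[i]) (s : seq (R -> R[i])) : R -> R[i] :=
  if size s is n.+1 then fun t => cint `]-oo, t] (fun x => aY x *
    \sum_(k < n.+1) nth (fun=> 0) s k x * nth (fun=> 0) s (n - k) x)
  else fun t => cint `]-oo, t] aX.

Definition ric (aX aY : R -> R[i]) : nat -> R -> R[i] := hrec (ric_step aX aY).

Lemma ric0 aX aY t : ric aX aY 0 t = cint `]-oo, t] aX.
Proof. by []. Qed.

Lemma ricS aX aY n t : ric aX aY n.+1 t = cint `]-oo, t] (fun x => aY x *
  \sum_(k < n.+1) ric aX aY k x * ric aX aY (n - k) x).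
Proof.
rewrite /ric /hrec /ric_step size_history; apply: eq_cint => x _.
congr (_ * _); apply: eq_bigr => k _.
by rewrite !(nth_history (fun=> 0))// ltnS leq_subr.
Qed.

Variables (q aX aY : R -> R[i]) (w M : R).
Hypotheses (hq : sqint q) (w0 : 0 < w) (mX : cmeas aX) (mY : cmeas aY).
Hypothesis absX : forall s, cabs (aX s) = cabs (q s) * expR (2 * w * s).
Hypothesis absY : forall s, cabs (aY s) = cabs (q s) * expR (- (2 * w) * s).
Hypotheses (M0 : 0 <= M) (mM : forall t, wavg q w t <= M).

Local Notation W := (wprim q w).
Local Notation u := (ric aX aY).

Lemma absY_wprim s : cabs (aY s) * W s = cabs (q s) * wavg q w s.
Proof. by rewrite absY /wavg mulrA. Qed.

Lemma cintb_X t : cintb `]-oo, t] aX.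
Proof.
split => //; rewrite (_ : (fun x => _) = (fun s => cabs (q s) * expR (2 * w * s))).
  exact: wprim_integrable.
by apply/funext.
Qed.

Lemma cabs_cint_X t : cabs (cint `]-oo, t] aX) <= W t.
Proof.
rewrite (le_trans (cabs_cint _ (cintb_X t)))//.
by under eq_Rintegral do rewrite absX.
Qed.

(** The growing factor of $a_Y$ is cancelled by one [W]: $|a_Y|W^2=|q|e^{2ws}m^2\le M^2|q|e^{2ws}$,
    with $m$ the weighted average, and the integral of the right side is $M^2W$. So a quadratic
    expression in [W] returns to a linear one at the price $M^2$. *)
Lemma cint_Y_sq g C : 0 <= C -> cmeas g -> (forall s, cabs (g s) <= C * W s ^+ 2) ->
  forall t, cintb `]-oo, t] (fun s => aY s * g s) /\
    cabs (cint `]-oo, t] (fun s => aY s * g s)) <= C * M ^+ 2 * W t.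
Proof.
move=> C0 mg gC t.
have jd : mu.-integrable `]-oo, t] (EFin \o (fun s =>
    C * M ^+ 2 * (cabs (q s) * expR (2 * w * s)))).
  by have := integrableZl (measurable_itv _ : mble `]-oo, t]) (C * M ^+ 2)
    (wprim_integrable hq w0 t).
have le s : cabs (aY s * g s) <= C * M ^+ 2 * (cabs (q s) * expR (2 * w * s)).
  rewrite cabsM (le_trans (ler_wpM2l (cabs_ge0 _) (gC s)))//.
  rewrite mulrCA -mulrA ler_wpM2l// expr2 mulrA absY_wprim wprim_wavg.
  rewrite mulrA [M ^+ 2 * _]mulrC -[leRHS]mulrA [_ * M ^+ 2]mulrC.
  rewrite -[_ * _ * wavg _ _ _]mulrA -[leLHS]mulrA ler_wpM2l ?cabs_ge0//.
  rewrite mulrCA [M ^+ 2 * _]mulrC ler_wpM2l ?expR_ge0// expr2.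
  by rewrite ler_pM ?wavg_ge0.
have mYg : cmeas (fun s => aY s * g s) by exact: cmeasM.
split; first exact: cintb_dom mYg jd (fun s _ => le s).
rewrite (le_trans (cabs_cint_le _ mYg jd (fun s _ => le s)))//.
by rewrite RintegralZl//; exact: wprim_integrable.
Qed.

(** Used for the last integration, over the whole line: against a single [W] the letter $a_Y$ gives
    $|q|$ times the weighted average, which is integrable. *)
Lemma cint_Y_lin g C D : 0 <= C -> cmeas g -> (forall s, cabs (g s) <= C * W s) ->
  mble D -> cintb D (fun s => aY s * g s) /\
  cabs (cint D (fun s => aY s * g s)) <= C * \int[mu]_s (cabs (q s) * wavg q w s).
Proof.
move=> C0 mg gC mD; have [jqT _] := wavg_pairing hq hq w0 ltr01.
have jq : mu.-integrable D (EFin \o (fun s => cabs (q s) * wavg q w s)).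
  exact: integrableS jqT.
have jd : mu.-integrable D (EFin \o (fun s => C * (cabs (q s) * wavg q w s))).
  by have := integrableZl mD C jq.
have le s : cabs (aY s * g s) <= C * (cabs (q s) * wavg q w s).
  by rewrite cabsM (le_trans (ler_wpM2l (cabs_ge0 _) (gC s)))// mulrCA absY_wprim.
have mYg : cmeas (fun s => aY s * g s) by exact: cmeasM.
split; first exact: cintb_dom mYg jd (fun s _ => le s).
rewrite (le_trans (cabs_cint_le _ mYg jd (fun s _ => le s)))//.
rewrite RintegralZl// ler_wpM2l// Rintegral_subset// => x.
by rewrite mulr_ge0 ?cabs_ge0 ?wavg_ge0.
Qed.

Lemma conv_bound n :
  (forall k, (k <= n)%N -> cmeas (u k) /\
     forall t, cabs (u k t) <= catalan k * M ^+ k.*2 * W t) ->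
  cmeas (fun x => \sum_(k < n.+1) u k x * u (n - k)%N x) /\
  forall s, cabs (\sum_(k < n.+1) u k s * u (n - k)%N s) <=
    catalan n.+1 * M ^+ n.*2 * W s ^+ 2.
Proof.
move=> IH; split.
  apply: cmeas_sum => k; apply: cmeasM; apply IH; last exact: leq_subr.
  by rewrite -ltnS.
move=> s; rewrite (le_trans (cabs_sum _ _ _))// catalanS !mulr_suml.
apply: ler_sum => k _; have kn : (k <= n)%N by rewrite -ltnS.
rewrite cabsM; have [_ /(_ s) H1] := IH k kn.
have [_ /(_ s) H2] := IH (n - k)%N (leq_subr _ _).
rewrite (le_trans (ler_pM (cabs_ge0 _) (cabs_ge0 _) H1 H2))//.
rewrite (_ : n.*2 = k.*2 + (n - k).*2)%N ?exprD; last by lia.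
by rewrite le_eqVlt; apply/orP; left; apply/eqP; ring.
Qed.

(** Each passage through the recurrence costs $M^2$ by [cint_Y_sq], while the Catalan numbers count
    the products produced by the convolutions. *)
Lemma ric_bound n : cmeas (u n) /\
  forall t, cabs (u n t) <= catalan n * M ^+ n.*2 * W t.
Proof.
elim/ltn_ind: n => -[_|n IH].
  split; first exact: prim_cmeas (primNy cintb_X).
  by move=> t; rewrite ric0 catalan0 expr0 !mul1r cabs_cint_X.
have [mg gC] := @conv_bound n IH.
have c0 : 0 <= catalan n.+1 * M ^+ n.*2 by rewrite mulr_ge0 ?catalan_ge0 ?exprn_ge0.
have H := cint_Y_sq c0 mg gC.
rewrite (_ : u n.+1 = fun t => cint `]-oo, t] (fun s => aY s *
    \sum_(k < n.+1) u k s * u (n - k)%N s)); last by apply/funext => t; rewrite ricS.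
split; first by apply: prim_cmeas (primNy _) => t; case: (H t).
by move=> t; rewrite doubleS -[n.*2.+2]addn2 exprD mulrA; case: (H t).
Qed.

Lemma ric_conv n : cmeas (fun x => \sum_(k < n.+1) u k x * u (n - k)%N x) /\
  forall t, cintb `]-oo, t]
    (fun x => aY x * \sum_(k < n.+1) u k x * u (n - k)%N x).
Proof.
have [mg gC] := @conv_bound n (fun k _ => ric_bound k); split => // t.
have c0 : 0 <= catalan n.+1 * M ^+ n.*2 by rewrite mulr_ge0 ?catalan_ge0 ?exprn_ge0.
by case: (cint_Y_sq c0 mg gC t).
Qed.

Section RicSeries.
Variable lam : R[i].
Hypothesis small : 32 * (cabs lam ^+ 2 * M ^+ 2) <= 1.

Local Notation v n s := (lam ^+ n.*2.+1 * u n s).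
Local Notation rho := (4 * (cabs lam ^+ 2 * M ^+ 2)).

Let rho0 : 0 <= rho. Proof. by rewrite !mulr_ge0 ?exprn_ge0 ?cabs_ge0. Qed.
Let rho8 : rho <= 8^-1. Proof. by have := small; move: (cabs lam ^+ 2 * M ^+ 2) => x; lra. Qed.
Let rho2 : rho <= 2^-1. Proof. by apply: le_trans rho8 _; lra. Qed.

Lemma ric_term_bound n s : cabs (v n s) <= 2 * cabs lam * W s * rho ^+ n.
Proof.
rewrite cabsM cabsX exprS -muln2 mulnC exprM.
have [_ /(_ s) H] := ric_bound n.
rewrite (le_trans (ler_wpM2l _ H))//.
  by rewrite mulr_ge0 ?exprn_ge0 ?cabs_ge0.
have H2 : catalan n * M ^+ n.*2 * W s <= 2 * 4 ^+ n * M ^+ n.*2 * W s.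
  by rewrite ler_wpM2r ?wprim_ge0// ler_wpM2r ?exprn_ge0// catalan_le.
rewrite (le_trans (ler_wpM2l _ H2))//.
  by rewrite mulr_ge0 ?exprn_ge0 ?cabs_ge0.
rewrite -[in M ^+ n.*2]muln2 [(n * 2)%N]mulnC exprM !exprMn.
by rewrite le_eqVlt; apply/orP; left; apply/eqP; ring.
Qed.

Lemma pow2_ge n : (n%:R : R) <= 2 ^+ n.
Proof. by rewrite -natrX ler_nat; apply/ltnW/ltn_expl. Qed.

(** The partial sums satisfy the integral equation exactly, with the Cauchy product [Q n] truncated
    by total degree in place of $V^2$. Letting [n] grow on both sides and comparing the limits gives
    the Riccati equation for [V]. *)
Lemma ric_series : exists V : R -> R[i],
  [/\ cmeas V, (forall t, cabs (V t) <= 8 * cabs lam * W t),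
      (forall n t, cabs (V t - \sum_(k < n) v k t)
          <= 8 * cabs lam * rho ^+ n * W t) &
      forall t, V t = lam * (cint `]-oo, t] aX +
        cint `]-oo, t] (fun s => aY s * V s ^+ 2))].
Proof.
have al0 := cabs_ge0 lam; have W0 := wprim_ge0 q w.
have /choice[V HV] : forall t, exists l, forall N,
    cabs (l - \sum_(n < N) v n t) <= 8 * cabs lam * rho ^+ N * W t.
  move=> t; have [|l Hl] := @geom_series_limitC _ (fun n => v n t)
    (2 * cabs lam * W t) rho _ rho0 rho2 (fun n => ric_term_bound n t).
    by rewrite !mulr_ge0.
  exists l => N; rewrite (le_trans (Hl N))// le_eqVlt; apply/orP; left; apply/eqP.
  by ring.
have rho1 : rho < 1 by apply: le_lt_trans rho8 _; rewrite invf_lt1// ltr1n.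
have cvrho (C : R) : (fun n => C * rho ^+ n) @ \oo --> (0 : R).
  by have := @cvg_geometric _ C rho; rewrite ger0_norm//; exact.
have mVn n : cmeas (fun t => \sum_(k < n) v k t).
  by apply: cmeas_sum => k; apply: cmeasZ; case: (ric_bound k).
have mV : cmeas V.
  apply: cmeas_lim mVn _ => t.
  apply: (@squeezeC _ _ _ (fun n => (8 * cabs lam * W t) * rho ^+ n)) => // n.
  by rewrite cabs_distC mulrAC.
have V8 t : cabs (V t) <= 8 * cabs lam * W t.
  by have := HV t 0%N; rewrite big_ord0 subr0 expr0 mulr1.
exists V; split => // t.
pose Q n s := \sum_(m < n) \sum_(k < m.+1) v k s * v (m - k)%N s.
have V2C s : cabs (V s ^+ 2) <= (8 * cabs lam) ^+ 2 * W s ^+ 2.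
  by rewrite cabsX -exprMn ler_pXn2r ?nnegrE ?cabs_ge0 ?mulr_ge0.
have mV2 : cmeas (fun s => V s ^+ 2) by under eq_fun do rewrite expr2; exact: cmeasM.
have [jV2 _] := cint_Y_sq (sqr_ge0 _) mV2 V2C t.
have VQ n : \sum_(k < n.+1) v k t =
    lam * (cint `]-oo, t] aX + cint `]-oo, t] (fun s => aY s * Q n s)).
  rewrite big_ord_recl /= expr1 mulrDr; congr (_ + _).
  have -> : cint `]-oo, t] (fun s => aY s * Q n s) = \sum_(m < n) lam ^+ m.*2.+2 *
      cint `]-oo, t] (fun s => aY s * \sum_(k < m.+1) u k s * u (m - k)%N s).
    rewrite [RHS](eq_bigr (fun m : 'I_n => cint `]-oo, t] (fun s =>
      lam ^+ m.*2.+2 * (aY s * \sum_(k < m.+1) u k s * u (m - k)%N s)))); last first.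
      by move=> m _; rewrite cintZ//; case: (ric_conv m).
    rewrite -cint_sum//; last by move=> i; apply: cintbZ => //; case: (ric_conv i).
    apply: eq_cint => s _; rewrite mulr_sumr; apply: eq_bigr => m _.
    rewrite mulrCA; congr (_ * _); rewrite mulr_sumr; apply: eq_bigr => k _.
    rewrite mulrACA -exprD; congr (lam ^+ _ * _).
    by have := ltn_ord k; lia.
  rewrite mulr_sumr; apply: eq_bigr => m _; rewrite ricS mulrA -exprS.
  by congr (lam ^+ _ * _); rewrite /bump; lia.
have Vn16 n s : cabs (\sum_(k < n) v k s) <= 16 * cabs lam * W s.
  rewrite -[X in cabs X](subrK (V s)) (le_trans (cabsD _ _))//.
  rewrite cabs_distC (le_trans (lerD (HV s n) (V8 s)))//.
  have : rho ^+ n <= 1 by rewrite exprn_ile1// ltW.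
  have : 0 <= 8 * cabs lam * W s by rewrite !mulr_ge0.
  move: (rho ^+ n) (W s) => r y y0 r1.
  rewrite -subr_ge0 (_ : _ - _ = (8 * cabs lam * y) * (1 - r)); last by ring.
  by rewrite mulr_ge0// subr_ge0.
(* [Q n] omits at most $n^2$ products from the square of the partial sum, each of order $\rho^n$.
   The factor $n^2\le4^n$ is beaten by $\rho\le1/8$, which is what the 32 in [small] provides;
   $196=4+8\cdot24$ adds the two errors. *)
have QV n s : cabs (Q n s - V s ^+ 2) <=
    (196 * cabs lam ^+ 2 * 2^-1 ^+ n) * W s ^+ 2.
  apply: (le_trans (cabs_distD _ ((\sum_(k < n) v k s) ^+ 2) _)).
  have E1 : cabs (Q n s - (\sum_(k < n) v k s) ^+ 2) <=
      n%:R ^+ 2 * (4 * cabs lam ^+ 2 * rho ^+ n * W s ^+ 2).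
    rewrite /Q (triangle_sum (fun i j => v i s * v j s)) expr2 mulr_suml -sumrB.
    rewrite (le_trans (cabs_sum _ _ _))//.
    set K := 4 * _ * _ * _.
    have K0 : 0 <= K by rewrite !mulr_ge0 ?exprn_ge0.
    rewrite (_ : n%:R ^+ 2 * K = \sum_(i < n) \sum_(j < n) K); last first.
      by rewrite !sumr_const !card_ord -[RHS]mulr_natl -[X in _ = _ * X]mulr_natl expr2 mulrA.
    apply: ler_sum => i _; rewrite mulr_sumr big_mkcond /= -sumrB.
    rewrite (le_trans (cabs_sum _ _ _))//; apply: ler_sum => j _.
    case: ltnP => [_|nij]; first by rewrite subrr cabs0.
    rewrite sub0r cabsN cabsM.
    rewrite (le_trans (ler_pM (cabs_ge0 _) (cabs_ge0 _) (ric_term_bound i s)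
      (ric_term_bound j s)))//.
    rewrite [leLHS](_ : _ = 4 * cabs lam ^+ 2 * W s ^+ 2 * rho ^+ (i + j)); last first.
      by rewrite (exprD rho i j); ring.
    rewrite (_ : K = 4 * cabs lam ^+ 2 * W s ^+ 2 * rho ^+ n); last by rewrite /K; ring.
    by rewrite ler_wpM2l ?mulr_ge0 ?exprn_ge0// ler_wiXn2l// ltW.
  have E2 : cabs ((\sum_(k < n) v k s) ^+ 2 - V s ^+ 2) <=
      192 * cabs lam ^+ 2 * rho ^+ n * W s ^+ 2.
    rewrite subr_sqr cabsM cabs_distC.
    have H := lerD (Vn16 n s) (V8 s).
    rewrite (le_trans (ler_pM (cabs_ge0 _) (cabs_ge0 _) (HV s n)
      (le_trans (cabsD _ _) H)))//.
    by rewrite le_eqVlt; apply/orP; left; apply/eqP; ring.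
  rewrite (le_trans (lerD E1 E2))//.
  rewrite (_ : _ + _ = (4 * n%:R ^+ 2 + 192) * rho ^+ n *
    (cabs lam ^+ 2 * W s ^+ 2)); last by ring.
  rewrite [leRHS](_ : _ = 196 * 2^-1 ^+ n * (cabs lam ^+ 2 * W s ^+ 2)); last by ring.
  rewrite ler_wpM2r ?mulr_ge0 ?exprn_ge0//.
  have H1 : 4 * n%:R ^+ 2 + 192 <= 196 * 4 ^+ n :> R.
    have : (n%:R : R) ^+ 2 <= 4 ^+ n.
      rewrite (_ : 4 = 2 ^+ 2); last by rewrite -natrX.
      by rewrite -exprM mulnC exprM ler_pXn2r ?nnegrE ?exprn_ge0// pow2_ge.
    have : 1 <= 4 ^+ n :> R by rewrite exprn_ege1// ler1n.
    move: (4 ^+ n) (n%:R ^+ 2) => a b; lra.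
  have H2 : rho ^+ n <= 8^-1 ^+ n by apply: lerXn2r; rewrite ?nnegrE ?invr_ge0.
  apply: (le_trans (ler_pM _ _ H1 H2)); [|exact: exprn_ge0|].
    by rewrite addr_ge0// mulr_ge0// exprn_ge0.
  rewrite -mulrA -exprMn (_ : 4 * 8^-1 = 2^-1 :> R)//; last by field.
have mQ n : cmeas (Q n).
  apply: cmeas_sum => m; apply: cmeas_sum => k.
  by apply: cmeasM; apply: cmeasZ; [case: (ric_bound k)|case: (ric_bound (m - k))].
have jQ n : cintb `]-oo, t] (fun s => aY s * (Q n s - V s ^+ 2)) /\
    cabs (cint `]-oo, t] (fun s => aY s * (Q n s - V s ^+ 2))) <=
    196 * cabs lam ^+ 2 * 2^-1 ^+ n * M ^+ 2 * W t.
  apply: cint_Y_sq => //; first by rewrite !mulr_ge0 ?exprn_ge0// invr_ge0.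
  exact: cmeasB.
have lim1 : cvgC (fun n => \sum_(k < n.+1) v k t) \oo
    (lam * (cint `]-oo, t] aX + cint `]-oo, t] (fun s => aY s * V s ^+ 2))).
  apply: (@squeezeC _ _ _ (fun n => (cabs lam * (196 * cabs lam ^+ 2 * M ^+ 2 * W t))
     * 2^-1 ^+ n)).
    move=> n; rewrite VQ -mulrBr cabsM.
    have -> : cint `]-oo, t] aX + cint `]-oo, t] (fun s => aY s * Q n s) -
      (cint `]-oo, t] aX + cint `]-oo, t] (fun s => aY s * V s ^+ 2)) =
      cint `]-oo, t] (fun s => aY s * (Q n s - V s ^+ 2)).
      rewrite opprD addrACA subrr add0r -cintB//.
        by apply: eq_cint => s _; rewrite mulrBr.
      have := cintbD (measurable_itv _) (jQ n).1 jV2.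
      by apply: cintb_ext => s; rewrite -mulrDr subrK.
    rewrite -mulrA ler_wpM2l// (le_trans (jQ n).2)// le_eqVlt; apply/orP; left.
    by apply/eqP; ring.
  by apply: cvg_geometric; rewrite ger0_norm ?invr_ge0// invf_lt1// ltr1n.
have lim2 : cvgC (fun n => \sum_(k < n.+1) v k t) \oo (V t).
  apply: (@squeezeC _ _ _ (fun n => (8 * cabs lam * W t) * rho ^+ n)) => // n.
  rewrite cabs_distC (le_trans (HV t n.+1))// mulrAC ler_wpM2l ?mulr_ge0//.
  by rewrite ler_wiXn2l// ltW.
exact: cvgC_unique lim2 lim1.
Qed.

End RicSeries.

End Riccati.

(** * Jost solutions *)

Section LimitsInfinity.
Context {R : realType}.

Lemma cvgC_nyP (f : R -> R[i]) (l : R[i]) : cvgC f -oo l <->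
  (forall e : R, 0 < e -> exists T, forall x, x < T -> cabs (f x - l) < e).
Proof.
rewrite cvgCP; last by move=> A B FA AB; apply: filterS FA.
split=> H e e0; have := H e e0.
  by move=> [T [_ HT]]; exists T => x /HT.
by move=> [T HT]; exists T; split; [exact: num_real|].
Qed.

Lemma cvgC_yP (f : R -> R[i]) (l : R[i]) : cvgC f +oo l <->
  (forall e : R, 0 < e -> exists T, forall x, T < x -> cabs (f x - l) < e).
Proof.
rewrite cvgCP; last by move=> A B FA AB; apply: filterS FA.
split=> H e e0; have := H e e0.
  by move=> [T [_ HT]]; exists T => x /HT.
by move=> [T HT]; exists T; split; [exact: num_real|].
Qed.

Lemma cvgC_eq (T : Type) (F : set_system T) (f g : T -> R[i]) (l : R[i]) :
  (forall x, f x = g x) -> cvgC f F l -> cvgC g F l.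
Proof. by move=> fg; rewrite (_ : g = f)//; apply/funext. Qed.

Lemma cvgC_cexp (T : Type) (F : set_system T) {FF : Filter F} (f : T -> R[i])
  (l : R[i]) : cvgC f F l -> cvgC (fun x => cexp (f x)) F (cexp l).
Proof.
move=> /cvgC_filterP fl.
apply: (@squeezeC _ _ _ (fun x => cabs (cexp l) *
  (2 * cabs (f x - l) * expR (cabs (f x - l))))).
  move=> t; rewrite (_ : cexp (f t) - cexp l = cexp l * (cexp (f t - l) - 1)).
    by rewrite cabsM ler_wpM2l ?cabs_ge0 ?cexp_sub1.
  by rewrite mulrBr -cexpD mulr1 [l + _]addrC subrK.
rewrite [X in _ --> X](_ : 0 = cabs (cexp l) * (2 * 0 * expR 0)); last by ring.
apply: cvgM; first exact: cvg_cst.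
apply: cvgM; first by apply: cvgM => //; exact: cvg_cst.
by apply: (cvg_comp _ _ fl); exact: continuous_expR.
Qed.

End LimitsInfinity.

Section Jost.
Context {R : realType}.
Local Notation mu := (@lebesgue_measure R).
Local Notation mble := (@measurable _ (measurableTypeR R)).

Definition potX (q : R -> R[i]) (lam : R[i]) (s : R) : R[i] :=
  (q s)^*%C * cexp (- (2 * ('i%C * lam ^+ 2)) * s%:C%C).

Definition potY (q : R -> R[i]) (lam : R[i]) (s : R) : R[i] :=
  q s * cexp (2 * ('i%C * lam ^+ 2) * s%:C%C).

Lemma Re_iM (z : R[i]) (x : R) : complex.Re ('i%C * z * x%:C%C) = - complex.Im z * x.
Proof. by case: z => a b /=; ring. Qed.

Lemma Im_natM n (z : R[i]) : complex.Im (n%:R * z) = n%:R * complex.Im z.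
Proof. by rewrite -(rmorph_nat (real_complex R)) cImM /= mul0r addr0. Qed.

Lemma cabs_cexpi (z : R[i]) (x : R) :
  cabs (cexp ('i%C * z * x%:C%C)) = expR (- complex.Im z * x).
Proof. by rewrite cabs_cexp Re_iM. Qed.

Section Abs.
Variables (q : R -> R[i]) (lam : R[i]).

Lemma cabs_potX s :
  cabs (potX q lam s) = cabs (q s) * expR (2 * complex.Im (lam ^+ 2) * s).
Proof.
rewrite cabsM cabsJ; congr (_ * _).
rewrite (_ : - (2 * ('i%C * lam ^+ 2)) = 'i%C * (- 2%:R * lam ^+ 2)); last by ring.
rewrite cabs_cexpi -(rmorph_nat (real_complex R)) -rmorphN.
by congr (expR _); rewrite [in LHS]cImM /=; ring.
Qed.

Lemma cabs_potY s :
  cabs (potY q lam s) = cabs (q s) * expR (- (2 * complex.Im (lam ^+ 2)) * s).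
Proof.
rewrite cabsM; congr (_ * _).
rewrite (_ : 2 * ('i%C * lam ^+ 2) = 'i%C * (2%:R * lam ^+ 2)); last by ring.
rewrite cabs_cexpi -(rmorph_nat (real_complex R)).
by congr (expR _); rewrite [in LHS]cImM /=; ring.
Qed.

Lemma cmeas_cexpZ (z : R[i]) : cmeas (fun s : R => cexp (z * s%:C%C)).
Proof. exact: prim_cmeas (prim_cexpZ z). Qed.

Lemma cmeas_potX : cmeas q -> cmeas (potX q lam).
Proof. by move=> mq; apply: cmeasM; [exact: cmeasJ|exact: cmeas_cexpZ]. Qed.

Lemma cmeas_potY : cmeas q -> cmeas (potY q lam).
Proof. by move=> mq; apply: cmeasM => //; exact: cmeas_cexpZ. Qed.

End Abs.

Lemma sqint_cintb (q : R -> R[i]) (a b : R) : sqint q -> cintb `[a, b] q.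
Proof.
move=> hq; apply: (@cintb_dom _ _ _ (fun x => 1 + cabs (q x) ^+ 2)) => //.
- by case: hq.
- have := integrableD (measurable_itv _ : mble `[a, b]) (integrable_itv_cst a b 1)
    (sqint_integrable hq (measurable_itv _)).
  by [].
- move=> x _; have := sqr_ge0 (cabs (q x) - 1); have := cabs_ge0 (q x).
  by move: (cabs (q x)) => c; nra.
Qed.

Lemma continuous_cabs_bounded (f : R -> R[i]) (a b : R) :
  continuous (f : R -> R[i]^o) ->
  exists K, forall x, a <= x -> x <= b -> cabs (f x) <= K.
Proof.
move=> cf; have [ab|ba] := leP a b; last first.
  by exists 0 => x ax xb; have := lt_le_trans ba (le_trans ax xb); rewrite ltxx.
have cc : continuous (fun x => cabs (f x)).
  move=> x; have /(cvgC_filterP f) fx := cf x.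
  apply/cvgrPdist_lt => e e0; move/cvgrPdist_lt : fx => /(_ e e0).
  apply: filterS => t /=; rewrite sub0r normrN ger0_norm ?cabs_ge0//.
  apply: le_lt_trans; rewrite ler_norml; apply/andP; split.
    by rewrite lerNl opprB lerBlDr -{1}[f t](subrK (f x)) cabsD.
  by rewrite lerBlDr cabs_distC -{1}[f x](subrK (f t)) cabsD.
have [c _ Hc] := EVT_max ab (continuous_subspaceT cc).
by exists (cabs (f c)) => x ax xb; apply: Hc; rewrite in_itv /= ax xb.
Qed.

Lemma zs_prim (q : R -> R[i]) (lam : R[i]) (f1 f2 : R -> R[i]) : sqint q ->
  zs_solution q lam f1 f2 ->
  prim f1 (fun x => - 'i%C * lam ^+ 2 * f1 x + lam * q x * f2 x) /\
  prim f2 (fun x => 'i%C * lam ^+ 2 * f2 x - lam * (q x)^*%C * f1 x).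
Proof.
move=> hq [c1 c2 sol].
have mul p f : (forall a b, cintb `[a, b] p) -> continuous (f : R -> R[i]^o) ->
    forall a b, cintb `[a, b] (fun x => p x * f x).
  move=> jp cf a b; have [K HK] := continuous_cabs_bounded a b cf.
  apply: (@cintbM _ _ _ _ K) => //; first exact: cmeas_continuous.
  by move=> x /=; rewrite in_itv /= => /andP[]; exact: HK.
have jq a b := sqint_cintb a b hq.
have jqJ a b : cintb `[a, b] (fun x => (q x)^*%C).
  have [mq jq'] := jq a b; split; first exact: cmeasJ.
  by rewrite (_ : (fun x => _) = (fun x => cabs (q x)))//; apply/funext => x;
    rewrite cabsJ.
split; split => a b; [|by case/(sol a b)| |by case/(sol a b)].
  apply: cintbD => //.
    exact: (mul (fun=> _)) (fun a b => cintb_itv_cst a b _) c1 a b.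
  apply: (@cintb_ext _ _ (fun x => (lam * q x) * f2 x)) => //.
  by apply: mul => // a' b'; exact: cintbZ.
apply: cintbB => //.
  exact: (mul (fun=> _)) (fun a b => cintb_itv_cst a b _) c2 a b.
apply: (@cintb_ext _ _ (fun x => (lam * (q x)^*%C) * f1 x)) => //.
by apply: mul => // a' b'; exact: cintbZ.
Qed.

Section Solution.
Variables (q : R -> R[i]) (lam : R[i]) (M : R).
Local Notation zeta := ('i%C * lam ^+ 2).
Local Notation w := (complex.Im (lam ^+ 2)).
Local Notation aX := (potX q lam).
Local Notation aY := (potY q lam).
Local Notation W := (wprim q w).
Hypotheses (hq : sqint q) (w0 : 0 < w) (M0 : 0 <= M).
Hypothesis mM : forall t, wavg q w t <= M.
Variables (V : R -> R[i]) (C : R).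
Hypotheses (mV : cmeas V) (C0 : 0 <= C) (VC : forall t, cabs (V t) <= C * W t).
Hypothesis Vric : forall t, V t = lam * (cint `]-oo, t] aX +
  cint `]-oo, t] (fun s => aY s * V s ^+ 2)).

Let mX : cmeas aX. Proof. by apply: cmeas_potX; case: hq. Qed.
Let mY : cmeas aY. Proof. by apply: cmeas_potY; case: hq. Qed.

(** The Riccati substitution undone: $e^{L}$ is the first component stripped of its phase, and [V]
    is minus the ratio of the second component to the first, phases removed. The limit of [L] at
    $+\infty$ is then $\ln s_{11}$. *)
Let L t := - lam * cint `]-oo, t] (fun s => aY s * V s).
Let Loo := - lam * cint [set: R] (fun s => aY s * V s).
Let psi1 t := cexp (- zeta * t%:C%C) * cexp (L t).
Let psi2 t := - (cexp (zeta * t%:C%C) * V t * cexp (L t)).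

Let jYV D : mble D -> cintb D (fun s => aY s * V s).
Proof.
by move=> mD; case: (cint_Y_lin hq w0 mY (cabs_potY q lam) C0 mV VC mD).
Qed.

Let primL : prim L (fun s => - lam * (aY s * V s)).
Proof. by apply/primZ/primNy => t; exact: jYV. Qed.

Let primV : prim V (fun s => lam * (aX s + aY s * V s ^+ 2)).
Proof.
have mV2 : cmeas (fun s => V s ^+ 2) by under eq_fun do rewrite expr2; exact: cmeasM.
have V2C s : cabs (V s ^+ 2) <= C ^+ 2 * W s ^+ 2.
  by rewrite cabsX -exprMn ler_pXn2r ?nnegrE ?cabs_ge0 ?mulr_ge0 ?wprim_ge0.
rewrite [X in prim X _](_ : V = fun t => lam * (cint `]-oo, t] aX +
  cint `]-oo, t] (fun s => aY s * V s ^+ 2))); last by apply/funext.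
apply: (primZ lam (primD (primNy (f := aX) _) (primNy (f := fun s => aY s * V s ^+ 2) _))) => t.
  exact: (cintb_X hq w0 mX (cabs_potX q lam)).
by case: (cint_Y_sq hq w0 mY (cabs_potY q lam) mM (sqr_ge0 C) mV2 V2C t).
Qed.

Let eN t : cexp (- zeta * t%:C%C) * cexp (zeta * t%:C%C) = 1.
Proof. by rewrite -cexpD mulNr addNr cexp0. Qed.

Let e2 t : cexp (2 * zeta * t%:C%C) = cexp (zeta * t%:C%C) * cexp (zeta * t%:C%C).
Proof. by rewrite -cexpD; congr cexp; ring. Qed.

Let eN2 t : cexp (- (2 * zeta) * t%:C%C) =
  cexp (- zeta * t%:C%C) * cexp (- zeta * t%:C%C).
Proof. by rewrite -cexpD; congr cexp; ring. Qed.

Let aYE t : aY t = q t * (cexp (zeta * t%:C%C) * cexp (zeta * t%:C%C)).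
Proof. by rewrite /potY e2. Qed.

Let aXE t : aX t = (q t)^*%C * (cexp (- zeta * t%:C%C) * cexp (- zeta * t%:C%C)).
Proof. by rewrite /potX eN2. Qed.

Let prim_psi1 : prim psi1 (fun x => - 'i%C * lam ^+ 2 * psi1 x + lam * q x * psi2 x).
Proof.
apply: (prim_eq (primM (prim_cexpZ (- zeta)) (prim_cexp primL))) => x.
rewrite /psi1 /psi2 aYE.
have := eN x; move: (cexp (- zeta * x%:C%C)) (cexp (zeta * x%:C%C)) => e' e ee.
rewrite (_ : e' * (- lam * (q x * (e * e) * V x) * cexp (L x)) =
  (e' * e) * (- lam * q x * e * V x * cexp (L x))); last by ring.
by rewrite ee; ring.
Qed.

Let prim_psi2 : prim psi2 (fun x => 'i%C * lam ^+ 2 * psi2 x - lam * (q x)^*%C * psi1 x).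
Proof.
apply: (prim_eq (primN (primM (primM (prim_cexpZ zeta) primV) (prim_cexp primL)))) => x.
rewrite /psi1 /psi2 aXE.
have := eN x; move: (cexp (- zeta * x%:C%C)) (cexp (zeta * x%:C%C)) => e' e ee.
set qJ := (q x)^*%C.
rewrite (_ : lam * (qJ * (e' * e') + aY x * V x ^+ 2) =
  lam * qJ * e' * e' + lam * aY x * V x ^+ 2); last by ring.
rewrite (_ : _ + e * (_ + _) = zeta * e * V x +
  lam * qJ * e' * (e' * e) + e * lam * aY x * V x ^+ 2); last by ring.
by rewrite ee; ring.
Qed.

Let g1 x : cexp (zeta * x%:C%C) * psi1 x = cexp (L x).
Proof. by rewrite /psi1 mulrA [cexp (zeta * _) * _]mulrC eN mul1r. Qed.

Lemma L_tail e : 0 < e -> exists n : nat, forall D, mble D ->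
  (forall x, D x -> n%:R < `|x|) ->
  cabs (cint D (fun s => aY s * V s)) <= e.
Proof.
move=> e0; have [|||n Hn] := @Rintegral_tail _ (fun s => cabs (aY s * V s)) e e0.
- by move=> x; exact: cabs_ge0.
- by case: (jYV measurableT).
- by apply: measurable_cabs; exact: cmeasM.
exists n => D mD Dn; rewrite (le_trans (cabs_cint mD (jYV mD)))//.
exact: Hn.
Qed.

Lemma L_cvgNy : cvgC L -oo 0.
Proof.
rewrite -(mulr0 (- lam)); apply: cvgCM; first exact: cvgC_cst.
apply/cvgC_nyP => e e0; have e20 : 0 < e / 2 by rewrite divr_gt0.
have [n Hn] := L_tail e20; exists (- n%:R) => x xn; rewrite subr0.
apply: (@le_lt_trans _ _ (e / 2)); last by lra.
apply: Hn => // y /=; rewrite in_itv /= => yx.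
by rewrite ltr_normr ltrNr (le_lt_trans yx xn) orbT.
Qed.

Lemma L_cvgy : cvgC L +oo Loo.
Proof.
apply: cvgCM; first exact: cvgC_cst.
apply/cvgC_yP => e e0; have e20 : 0 < e / 2 by rewrite divr_gt0.
have [n Hn] := L_tail e20; exists n%:R => x xn.
apply: (@le_lt_trans _ _ (e / 2)); last by lra.
have -> : [set: R] = `]-oo, x]%classic `|` `]x, +oo[%classic.
  by rewrite -setCitvl setUCr.
rewrite cint_setU//.
- rewrite opprD addrA subrr sub0r cabsN; apply: Hn => // y /=.
  by rewrite in_itv /= andbT => xy; rewrite ltr_normr (lt_trans xn xy).
- by apply: jYV; exact: measurableU.
- by rewrite -setCitvl; apply/disj_setPCl.
Qed.

Lemma psi_left_jost : left_jost q lam psi1 psi2.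
Proof.
split.
- split; [exact: prim_continuous prim_psi1|exact: prim_continuous prim_psi2|].
  by move=> a b ab; rewrite prim_psi1.2// prim_psi2.2.
- apply: (@cvgC_eq _ _ _ (fun x => cexp (L x))) => [x|]; first by rewrite g1.
  by rewrite -[X in cvgC _ _ X]cexp0; apply: cvgC_cexp; exact: L_cvgNy.
- apply: (@cvgC_eq _ _ _ (fun x => - (cexp (2 * zeta * x%:C%C) * V x) * cexp (L x))).
    by move=> x; rewrite /psi2 e2; ring.
  rewrite -(mul0r (cexp 0)); apply: cvgCM; last by apply: cvgC_cexp; exact: L_cvgNy.
  (* The phase $e^{2i\lambda^2x}$ grows like $e^{-2wx}$ at $-\infty$, but $|V|\le CW$ turns the
     product into $C$ times the weighted average, which does tend to 0 there. *)
  have wV x : cabs (cexp (2 * zeta * x%:C%C) * V x) <= C * wavg q w x.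
    rewrite cabsM (_ : 2 * zeta = 'i%C * (2%:R * lam ^+ 2)); last by ring.
    rewrite cabs_cexpi -(rmorph_nat (real_complex R)).
    rewrite (le_trans (ler_wpM2l (expR_ge0 _) (VC x)))// mulrCA ler_wpM2l//.
    rewrite /wavg [in leLHS]cImM /= mul0r addr0.
    by [].
  apply/cvgC_nyP => e e0.
  have C10 : 0 < C + 1 by rewrite ltr_wpDl.
  have [T HT] := wavg_cvgNy hq w0 (exprn_gt0 2 (divr_gt0 e0 C10)).
  exists T => x xT; rewrite subr0 cabsN (le_lt_trans (wV x))//.
  have := HT x (ltW xT); rewrite ler_pXn2r ?nnegrE ?wavg_ge0 ?(ltW (divr_gt0 e0 C10))//.
  move=> H; apply: (le_lt_trans (ler_wpM2l C0 H)).
  by rewrite mulrA ltr_pdivrMr// mulrC ltr_pM2l// ltrDl.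
Qed.

Lemma psi_s11 : is_s11 q lam (cexp Loo).
Proof.
exists psi1, psi2; split; first exact: psi_left_jost.
apply: (@cvgC_eq _ _ _ (fun x => cexp (L x))) => [x|]; first by rewrite g1.
by apply: cvgC_cexp; exact: L_cvgy.
Qed.

(* The Wronskian of two left Jost solutions is constant and tends to 0 at -oo. *)
Lemma jost_unique f1 f2 : left_jost q lam f1 f2 ->
  forall x, cexp (zeta * x%:C%C) * f1 x = cexp (L x).
Proof.
move=> [solf f1l f2l]; have [pf1 pf2] := zs_prim hq solf.
have [_ g1l g2l] := psi_left_jost.
pose Wr x := f1 x * psi2 x - f2 x * psi1 x.
have pW : prim Wr (fun=> 0).
  by apply: (prim_eq (primB (primM pf1 prim_psi2) (primM pf2 prim_psi1))) => x; ring.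
have Wr0 x : Wr x = 0.
  have cst : cvgC (fun _ : R => Wr x) -oo (Wr x) by exact: cvgC_cst.
  apply: cvgC_unique cst _.
  (* Two factors $e^{i\lambda^2y}$ normalise the two solutions; what remains is $e^{-2i\lambda^2y}$,
     of modulus $e^{2wy}$, which vanishes at $-\infty$. *)
  apply: (@cvgC_eq _ _ _ (fun y => cexp (- (2 * zeta) * y%:C%C) *
    ((cexp (zeta * y%:C%C) * f1 y) * (cexp (zeta * y%:C%C) * psi2 y) +
     (- 1) * ((cexp (zeta * y%:C%C) * f2 y) * (cexp (zeta * y%:C%C) * psi1 y))))).
    move=> y; rewrite eN2 (prim0_cst pW x y) /Wr.
    move: (psi1 y) (psi2 y) (eN y) => p1 p2.
    move: (cexp (- zeta * y%:C%C)) (cexp (zeta * y%:C%C)) => e' e ee.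
    rewrite (_ : e' * e' * _ = (e' * e) * (e' * e) * (f1 y * p2 - f2 y * p1)); last ring.
    by rewrite ee !mul1r.
  rewrite -[X in cvgC _ _ X](mulr0 (0 : R[i])); apply: cvgCM; last first.
    rewrite [X in cvgC _ _ X](_ : 0 = 1 * 0 + (-1) * (0 * 1)); last by ring.
    apply: cvgCD; first exact: cvgCM f1l g2l.
    by apply: cvgCM; [exact: cvgC_cst|exact: cvgCM f2l g1l].
  apply/cvgC_nyP => e e0; exists (ln e / (2 * w)) => y yT; rewrite subr0.
  rewrite (_ : - (2 * zeta) = 'i%C * - (2%:R * lam ^+ 2)); last by ring.
  rewrite cabs_cexpi cImN Im_natM opprK -[ltRHS]lnK ?posrE// ltr_expR.
  by move: yT; rewrite ltr_pdivlMr ?mulr_gt0// mulrC.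
(* [P] is the quotient of [f1] by [psi1]. Once the Wronskian vanishes, [f2] is a known multiple of
   [f1], so both first components solve the same scalar linear equation and [P] is constant; the
   normalisation at $-\infty$ makes it 1. *)
pose P x := f1 x * (cexp (zeta * x%:C%C) * cexp (- L x)).
have f2E x : f2 x = - (cexp (zeta * x%:C%C) * cexp (zeta * x%:C%C)) * V x * f1 x.
  have := Wr0 x; rewrite /Wr /psi1 /psi2 => /eqP; rewrite subr_eq0 => /eqP H.
  apply: (@mulIf _ (cexp (- zeta * x%:C%C) * cexp (L x))).
    by rewrite mulf_neq0 ?cexp_neq0.
  rewrite -H.
  have := eN x; move: (cexp (- zeta * x%:C%C)) (cexp (zeta * x%:C%C)) => e' e ee.
  rewrite (_ : - (e * e) * V x * f1 x * (e' * cexp (L x)) =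
    (e' * e) * (- e * V x * f1 x * cexp (L x))); last by ring.
  by rewrite ee; ring.
have pP : prim P (fun=> 0).
  apply: (prim_eq (primM pf1 (primM (prim_cexpZ zeta) (prim_cexp (primN primL))))) => x.
  by rewrite f2E aYE; ring.
move=> x; have P1 : P x = 1.
  have cst : cvgC (fun _ : R => P x) -oo (P x) by exact: cvgC_cst.
  apply: cvgC_unique cst _.
  apply: (@cvgC_eq _ _ _ (fun y => (cexp (zeta * y%:C%C) * f1 y) * cexp (- 1 * L y))).
    by move=> y; rewrite (prim0_cst pP x y) /P mulN1r; ring.
  rewrite [X in cvgC _ _ X](_ : 1 = 1 * cexp (- 1 * 0)); last first.
    by rewrite mulr0 cexp0 mul1r.
  apply: (cvgCM f1l); apply: cvgC_cexp; apply: (cvgCM _ L_cvgNy).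
  exact: cvgC_cst.
rewrite -[cexp (L x)]mul1r -P1 /P cexpN.
by field; exact: cexp_neq0.
Qed.

(** As [s11] is picked by [get], existence ([psi_s11]) makes the choice a genuine limit, and
    uniqueness of the Jost solution identifies it. *)
Lemma s11E : s11 q lam = cexp (- lam * cint [set: R] (fun s => aY s * V s)).
Proof.
have ex : is_s11 q lam (s11 q lam).
  by apply: (@getPex _ [set s : R[i]^o | is_s11 q lam s]); exists (cexp Loo); exact: psi_s11.
have [f1 [f2 [fj fs]]] := ex.
apply: cvgC_unique fs _.
apply: (@cvgC_eq _ _ _ (fun x => cexp (L x))) => [x|].
  by rewrite (jost_unique fj).
by apply: cvgC_cexp; exact: L_cvgy.
Qed.

End Solution.

End Jost.

(** * The logarithm of s11 as a series *)

Section LogSeries.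
Context {R : realType}.
Local Notation mu := (@lebesgue_measure R).
Local Notation mble := (@measurable _ (measurableTypeR R)).
Implicit Types (q : R -> R[i]) (lam : R[i]).

(** With the index shifted: this will be $b_{2n+2}$. *)
Definition log_coef q lam (n : nat) : R[i] := - lam ^+ n.*2.+2 *
  cint [set: R] (fun s => potY q lam s * ric (potX q lam) (potY q lam) n s).

Local Notation w lam := (complex.Im (lam ^+ 2)).

Definition pairing q lam : R :=
  \int[mu]_s (cabs (q s) * wavg q (w lam) s).

Lemma pairing_ge0 q lam : 0 <= pairing q lam.
Proof.
apply: Rintegral_ge0 => s _; apply: mulr_ge0 (cabs_ge0 _) _; exact: wavg_ge0.
Qed.

Section Fixed.
Variables (q : R -> R[i]) (lam : R[i]) (M : R).
Hypotheses (hq : sqint q) (w0 : 0 < w lam) (M0 : 0 <= M).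
Hypothesis mM : forall t, wavg q (w lam) t <= M.

Local Notation rho := (4 * (cabs lam ^+ 2 * M ^+ 2)).
Local Notation u := (ric (potX q lam) (potY q lam)).

Let mX : cmeas (potX q lam). Proof. by apply: cmeas_potX; case: hq. Qed.
Let mY : cmeas (potY q lam). Proof. by apply: cmeas_potY; case: hq. Qed.

Lemma ric_pot_bound n : cmeas (u n) /\
  forall t, cabs (u n t) <= catalan n * M ^+ n.*2 * wprim q (w lam) t.
Proof. exact: (ric_bound hq w0 mX mY (cabs_potX q lam) (cabs_potY q lam)). Qed.

Lemma cintb_potY_ric n D : mble D -> cintb D (fun s => potY q lam s * u n s).
Proof.
have [mu_ ub] := ric_pot_bound n => mD.
have c0 : 0 <= catalan n * M ^+ n.*2 by rewrite mulr_ge0 ?catalan_ge0 ?exprn_ge0.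
by case: (cint_Y_lin hq w0 mY (cabs_potY q lam) c0 mu_ ub mD).
Qed.

Hypothesis small : 32 * (cabs lam ^+ 2 * M ^+ 2) <= 1.

(** [S] is an actual logarithm of [s11], not only a formal one. The error keeps the factor [pairing]
    for every [N], so that already $N=1$ isolates $b_2$ when $\lambda$ is large. *)
Lemma s11_series : exists2 S, s11 q lam = cexp S & forall N,
  cabs (S - \sum_(n < N) log_coef q lam n) <= 8 * cabs lam ^+ 2 * pairing q lam * rho ^+ N.
Proof.
have [V [mV VC Vn Vric]] := ric_series hq w0 mX mY (cabs_potX q lam)
  (cabs_potY q lam) M0 mM small.
have C0 : 0 <= 8 * cabs lam by rewrite mulr_ge0 ?cabs_ge0.
exists (- lam * cint [set: R] (fun s => potY q lam s * V s)).
  exact: (s11E hq w0 mM mV C0 VC Vric).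
move=> N.
have [jV _] := cint_Y_lin hq w0 mY (cabs_potY q lam) C0 mV VC measurableT.
pose vN s := \sum_(n < N) lam ^+ n.*2.+1 * u n s.
have jv n : cintb [set: R] (fun s => lam ^+ n.*2.+1 * (potY q lam s * u n s)).
  by apply: cintbZ => //; exact: cintb_potY_ric.
have mv : cmeas vN.
  by apply: cmeas_sum => n; apply: cmeasZ; case: (ric_pot_bound n).
have jvN : cintb [set: R] (fun s => potY q lam s * vN s).
  have : cintb [set: R] (fun s => \sum_(n < N) lam ^+ n.*2.+1 * (potY q lam s * u n s)).
    exact: cintb_sum.
  by apply: cintb_ext => s; rewrite mulr_sumr; apply: eq_bigr => n _; rewrite mulrCA.
have -> : \sum_(n < N) log_coef q lam n =
    - lam * cint [set: R] (fun s => potY q lam s * vN s).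
  rewrite (@eq_cint _ _ _ (fun s =>
    \sum_(n < N) lam ^+ n.*2.+1 * (potY q lam s * u n s))); last first.
    by move=> s _; rewrite mulr_sumr; apply: eq_bigr => n _; rewrite mulrCA.
  rewrite cint_sum// mulr_sumr; apply: eq_bigr => n _.
  rewrite cintZ//; last exact: cintb_potY_ric.
  by rewrite /log_coef !mulrA; congr (_ * _); rewrite exprS mulNr.
rewrite -mulrBr cabsM cabsN -cintB//.
have Dn s : cabs (V s - vN s) <= 8 * cabs lam * rho ^+ N * wprim q (w lam) s.
  exact: Vn.
have r0 : 0 <= 8 * cabs lam * rho ^+ N.
  by rewrite mulr_ge0// exprn_ge0// !mulr_ge0 ?exprn_ge0 ?cabs_ge0.
have [_ H] := cint_Y_lin hq w0 mY (cabs_potY q lam) r0 (cmeasB mV mv) Dn measurableT.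
rewrite (@eq_cint _ _ _ (fun s => potY q lam s * (V s - vN s))); last first.
  by move=> s _; rewrite mulrBr.
rewrite (le_trans (ler_wpM2l (cabs_ge0 _) H))// le_eqVlt; apply/orP; left.
by apply/eqP; rewrite /pairing; ring.
Qed.

End Fixed.

Section Scaling.
Variables (q : R -> R[i]) (lam : R[i]) (M e : R).
Hypotheses (hq : sqint q) (w0 : 0 < w lam) (M0 : 0 <= M).
Hypothesis mM : forall t, wavg q (w lam) t <= M.
Local Notation eq := (fun x => e%:C%C * q x).

Lemma sqint_scale : sqint eq.
Proof.
split; first by apply: cmeasZ; case: hq.
rewrite (_ : _ \o _ = fun x => (`|e| ^+ 2 * cabs (q x) ^+ 2)%:E).
  by have := integrableZl (measurableT : mble setT) (`|e| ^+ 2) hq.2.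
by apply/funext => x /=; rewrite cabsM cabsR exprMn.
Qed.

Lemma wavg_scale t : wavg eq (w lam) t = `|e| * wavg q (w lam) t.
Proof.
rewrite /wavg mulrCA; congr (_ * _).
rewrite /wprim -RintegralZl//; last exact: wprim_integrable.
by apply: eq_Rintegral => s _; rewrite cabsM cabsR mulrA.
Qed.

Lemma wavg_scale_le t : wavg eq (w lam) t <= `|e| * M.
Proof. by rewrite wavg_scale ler_wpM2l. Qed.

Lemma pairing_scale : pairing eq lam = `|e| ^+ 2 * pairing q lam.
Proof.
rewrite /pairing -RintegralZl//; last by case: (wavg_pairing hq hq w0 ltr01).
apply: eq_Rintegral => s _; rewrite wavg_scale cabsM cabsR; ring.
Qed.

Lemma potX_scale s : potX eq lam s = e%:C%C * potX q lam s.
Proof.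
rewrite /potX [RHS]mulrA; congr (_ * _).
by case: (q s) => a b; apply: complex_eqP => /=; ring.
Qed.

Lemma potY_scale s : potY eq lam s = e%:C%C * potY q lam s.
Proof. by rewrite /potY [RHS]mulrA. Qed.

Lemma ric_scale n t : ric (potX eq lam) (potY eq lam) n t =
  e%:C%C ^+ n.*2.+1 * ric (potX q lam) (potY q lam) n t.
Proof.
have mX : cmeas (potX q lam) by apply: cmeas_potX; case: hq.
have mY : cmeas (potY q lam) by apply: cmeas_potY; case: hq.
elim/ltn_ind: n t => -[_|n IH] t.
  rewrite !ric0 expr1 -cintZ//; last exact: (cintb_X hq w0 mX (cabs_potX q lam)).
  by apply: eq_cint => s _; rewrite potX_scale.
rewrite !ricS -cintZ//; last first.
  by case: (ric_conv hq w0 mX mY (cabs_potX q lam) (cabs_potY q lam) M0 mM n).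
apply: eq_cint => s _; rewrite potY_scale.
rewrite doubleS [in RHS]exprS -mulrACA; congr (_ * _).
rewrite mulr_sumr; apply: eq_bigr => k _.
rewrite !IH//; last by rewrite ltnS leq_subr.
rewrite (_ : n.*2.+2 = k.*2.+1 + (n - k).*2.+1)%N; last by have := ltn_ord k; lia.
by rewrite exprD mulrACA.
Qed.

Lemma log_coef_scale n : log_coef eq lam n = e%:C%C ^+ n.*2.+2 * log_coef q lam n.
Proof.
rewrite /log_coef mulrCA; congr (_ * _).
rewrite -cintZ//; last exact: (cintb_potY_ric hq w0 M0 mM).
apply: eq_cint => s _; rewrite potY_scale ric_scale -mulrA mulrCA [in RHS]exprS.
by ring.
Qed.

End Scaling.

Lemma s11_scale_series q lam : sqint q -> 0 < w lam ->
  exists K r d, [/\ 0 <= K, 0 <= r, 0 < d & forall e : R, `|e| < d ->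
    exists2 S, s11 (fun x => e%:C%C * q x) lam = cexp S & forall N,
    cabs (S - \sum_(n < N) e%:C%C ^+ n.*2.+2 * log_coef q lam n)
       <= K * `|e| ^+ 2 * (r * `|e| ^+ 2) ^+ N].
Proof.
move=> hq w0; have n0 := sqn_ge0 q.
(* [wavg_bound] gives $m^2\le X$, hence $m\le1+X$ without a square root; for fixed $\lambda$ any
   finite bound will do, since $\varepsilon$ supplies the smallness. *)
pose M := 1 + sqn q / (2 * w lam).
have X0 : 0 <= sqn q / (2 * w lam) by rewrite divr_ge0// mulr_ge0// ltW.
have M0 : 0 <= M by rewrite addr_ge0.
have mM t : wavg q (w lam) t <= M.
  have := wavg_bound hq w0 t; have := wavg_ge0 q (w lam) t.
  by rewrite /M; move: (wavg _ _ _) (_ / _) X0 => m x; nra.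
pose c := 32 * (cabs lam ^+ 2 * M ^+ 2).
have c0 : 0 <= c by rewrite !mulr_ge0 ?exprn_ge0 ?cabs_ge0.
(* The radius $1/(1+c)$ forces both $|e|\le1$ and $c|e|<1$, hence $c|e|^2\le1$, which is the
   smallness condition for the potential $eq$. *)
exists (8 * cabs lam ^+ 2 * pairing q lam), (4 * (cabs lam ^+ 2 * M ^+ 2)), (1 + c)^-1.
split.
- by rewrite !mulr_ge0 ?exprn_ge0 ?cabs_ge0 ?pairing_ge0.
- by rewrite !mulr_ge0 ?exprn_ge0 ?cabs_ge0.
- by rewrite invr_gt0 ltr_wpDr.
move=> e ed.
have sm : 32 * (cabs lam ^+ 2 * (`|e| * M) ^+ 2) <= 1.
  rewrite (_ : 32 * _ = c * `|e| ^+ 2); last by rewrite /c; ring.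
  have e0 := normr_ge0 e.
  have e1 : `|e| <= 1 by rewrite (le_trans (ltW ed))// invf_le1 ?lerDl// ltr_wpDr.
  have : `|e| * (1 + c) < 1 by rewrite -ltr_pdivlMr ?div1r// ltr_wpDr.
  by move: (`|e|) e0 e1 => x x0 x1; nra.
have [|S ES SN] := s11_series (sqint_scale e hq) w0 _ (wavg_scale_le e hq w0 mM) sm.
  by rewrite mulr_ge0.
exists S => // N.
have := SN N; rewrite (pairing_scale e hq w0).
under eq_bigr do rewrite (log_coef_scale e hq w0 M0 mM).
move=> /le_trans; apply; rewrite le_eqVlt; apply/orP; left; apply/eqP.
rewrite (_ : 4 * (cabs lam ^+ 2 * (`|e| * M) ^+ 2) =
  4 * (cabs lam ^+ 2 * M ^+ 2) * `|e| ^+ 2); last by ring.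
by ring.
Qed.

End LogSeries.

(** * Homogeneous expansions *)

Section FormalExpLog.
Context {F : numFieldType}.
Variable b : nat -> F.

Definition exp_step (s : seq F) : F :=
  if size s is n.+1 then n.+1%:R^-1 * \sum_(k < n.+1) k.+1%:R * b k * s`_(n - k) else 1.

(* Coefficients of exp (\sum_k b_k X^(k+1)), from the logarithmic derivative. *)
Definition exp_coef : nat -> F := hrec exp_step.

Lemma exp_coef0 : exp_coef 0 = 1. Proof. by []. Qed.

Lemma exp_coefS n : n.+1%:R * exp_coef n.+1 =
  \sum_(k < n.+1) k.+1%:R * b k * exp_coef (n - k).
Proof.
rewrite /exp_coef /hrec /exp_step size_history mulVKf ?pnatr_eq0//.
by apply: eq_bigr => k _; rewrite (nth_history 0)// ltnS leq_subr.
Qed.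

Lemma coefXn_mul (p r : {poly F}) n j : 'X^n %| p -> (j < n)%N -> (r * p)`_j = 0.
Proof.
move=> /dvdpP[c ->] jn; rewrite mulrA coefMXn jn//.
Qed.

(** The truncated exponential satisfies $E'=B'(E-B^N/N!)$, and $B^N$ is divisible by $X^N$. Up to
    degree $N$ its coefficients therefore obey the recurrence defining [exp_coef]. *)
Lemma exp_poly_coef N (B : {poly F}) :
  B`_0 = 0 -> (forall k, (k < N)%N -> B`_k.+1 = b k) ->
  forall j, (j <= N)%N ->
    (\sum_(n < N.+1) (n`!%:R)^-1 *: B ^+ n)`_j = exp_coef j.
Proof.
move=> B0 Bb; set E := \sum_(n < N.+1) _.
have XB : 'X %| B.
  by rewrite -['X]subr0 -polyC0 -root_factor_theorem /root horner_coef0 B0.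
have dE : E^`() = B^`() * (E - (N`!%:R)^-1 *: B ^+ N).
  have -> : E - (N`!%:R)^-1 *: B ^+ N = \sum_(n < N) (n`!%:R)^-1 *: B ^+ n.
    by rewrite /E big_ord_recr /= addrK.
  rewrite /E big_ord_recl /= expr0 linearD /= derivZ derivC scaler0 add0r.
  rewrite linear_sum mulr_sumr; apply: eq_bigr => n _ /=.
  rewrite derivZ deriv_exp /= /bump /= add1n.
  rewrite -scalerMnr scalerMnl -scalerAr; congr (_ *: _).
  by rewrite factS natrM invfM -[LHS]mulr_natl mulVKf ?pnatr_eq0.
have E0 : E`_0 = 1.
  rewrite /E big_ord_recl /= expr0 invr1 scale1r coefD coefC coef_sum big1 ?addr0//.
  move=> i _; rewrite coefZ /bump /= add1n -(mul1r (B ^+ _)).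
  rewrite (@coefXn_mul _ _ i.+1) ?mulr0//.
  exact: dvdp_exp2r.
elim/ltn_ind => -[_ _|j IH jN]; first by rewrite E0.
apply: (@mulfI _ j.+1%:R); first by rewrite pnatr_eq0.
rewrite exp_coefS mulr_natl -coef_deriv dE mulrBr coefB.
have XN : 'X^N %| B ^+ N by exact: dvdp_exp2r.
rewrite -scalerAr coefZ (coefXn_mul _ XN jN) mulr0 subr0.
rewrite coefM; apply: eq_bigr => k _.
have kj : (k <= j)%N by rewrite -ltnS.
rewrite coef_deriv -[X in X * _ = _]mulr_natl Bb; last exact: leq_ltn_trans kj jN.
by rewrite IH ?ltnS ?leq_subr// (leq_trans (leq_subr _ _))// ltnW.
Qed.

(** The truncated logarithm [l] of $1+u$ satisfies $(1+u)l'=u'-u'(-u)^N$, and the last term has no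
    coefficient below degree $N$. Comparison with the recurrence of [exp_coef], which is the same
    identity with $B'$ for $l'$, recovers the [b k] one at a time. *)
Lemma formal_logK j : formal_log exp_coef j.+1 = b j.
Proof.
rewrite /formal_log; set s := exp_coef; set N := j.+1.
set u := (\sum_(1 <= i < N.+1) s i *: 'X^i : {poly F}).
have uE i : u`_i = if (0 < i <= N)%N then s i else 0.
  rewrite /u coef_sum (eq_bigr (fun k => if i == k then s k else 0)); last first.
    by move=> k _; rewrite coefZ coefXn; case: eqP; rewrite ?mulr1 ?mulr0.
  rewrite -big_mkcond /=; case: ifP => [iN|iN].
    rewrite (big_cat_nat (n := i)) //=; [|lia|lia].
    rewrite big_nat_cond big_pred0 ?add0r; last by move=> k; lia.
    rewrite big_ltn_cond ?eqxx; last by lia.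
    rewrite big_nat_cond big_pred0 ?addr0// => k; lia.
  by rewrite big_nat_cond big_pred0// => k; lia.
have u0 : u`_0 = 0 by rewrite uE.
have Xu : 'X %| u.
  by rewrite -['X]subr0 -polyC0 -root_factor_theorem /root horner_coef0 u0.
pose l := \sum_(1 <= n < N.+1) ((-1) ^+ n.+1 / n%:R) *: u ^+ n.
have -> : \sum_(1 <= n < N.+1) (-1) ^+ n.+1 / n%:R * (u ^+ n)`_N = l`_N.
  by rewrite /l coef_sum; apply: eq_bigr => n _; rewrite coefZ.
have dl : (1 + u) * l^`() = u^`() - u^`() * (- u) ^+ N.
  have -> : l^`() = u^`() * \sum_(n < N) (- u) ^+ n.
    rewrite /l linear_sum big_add1 big_mkord mulr_sumr; apply: eq_bigr => n _ /=.
    rewrite derivZ deriv_exp /= -scalerMnr scalerMnl scalerAr; congr (_ * _).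
    rewrite -[X in X *: _]mulr_natr divfK ?pnatr_eq0// 2!exprS mulrA mulrNN !mul1r.
    by rewrite [(- u) ^+ n]exprNn -mul_polyC rmorphXn rmorphN rmorph1.
  rewrite mulrCA -{2}[u^`()]mulr1 -mulrBr; congr (_ * _).
  have := subrX1 (- u) N.
  rewrite (_ : - u - 1 = - (1 + u)); last by ring.
  by rewrite mulNr => H; rewrite -[LHS]opprK -H opprB.
have rec k : (k < N)%N -> \sum_(i < k.+1) s i * ((k - i).+1%:R * l`_(k - i).+1) =
    k.+1%:R * s k.+1.
  move=> kN; have := congr1 (fun p : {poly F} => p`_k) dl.
  have XN : 'X^N %| (- u) ^+ N by rewrite dvdp_exp2r// dvdpNr.
  rewrite /= coefB (coefXn_mul _ XN kN) subr0.
  rewrite coef_deriv uE /= kN mulr_natl => <-.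
  rewrite coefM; apply: eq_bigr => i _.
  rewrite coef_deriv mulr_natl coefD coef1 uE.
  by case: i => [[|i] /= Hi]; rewrite ?addr0 ?add0r ?ifT//; lia.
suff H k : (k < N)%N -> l`_k.+1 = b k by exact: H.
elim/ltn_ind: k => k IH kN.
have := rec k kN; rewrite exp_coefS big_ord_recl subn0 /= [s 0%N]exp_coef0 mul1r.
rewrite [RHS](reindex_inj rev_ord_inj) big_ord_recl /=.
rewrite subSS subn0 subnn exp_coef0 mulr1.
have -> : \sum_(i < k) s (bump 0 i) * ((k - bump 0 i).+1%:R * l`_(k - bump 0 i).+1) =
  \sum_(i < k) (k.+1 - (bump 0 i).+1).+1%:R * b (k.+1 - (bump 0 i).+1)%N *
    exp_coef (k - (k.+1 - (bump 0 i).+1)).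
  apply: eq_bigr => i _; have ik := ltn_ord i; rewrite /bump /= add1n subSS.
  rewrite IH; [|lia|lia].
  rewrite (_ : (k - (k - i.+1) = i.+1)%N); last by lia.
  by rewrite mulrC.
by move=> /addIr /mulfI; apply; rewrite pnatr_eq0.
Qed.

End FormalExpLog.

(** * Orders of vanishing in the scaling parameter *)

Section BigOAtZero.
Context {R : realType}.
Implicit Types f g : R -> R[i].

(** Only nonzero [e] is tested, matching the punctured limits in [homogeneous_expansion]; the radius
    is kept at most 1 so that a higher order implies every lower one. *)
Definition bigO0 (k : nat) f : Prop := exists K d, [/\ 0 <= K, 0 < d, d <= 1 &
  forall e : R, 0 < `|e| -> `|e| < d -> cabs (f e) <= K * `|e| ^+ k].

Lemma bigO0_eq k f g : (forall e, f e = g e) -> bigO0 k f -> bigO0 k g.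
Proof. by move=> fg; rewrite (_ : g = f)//; apply/funext. Qed.

Lemma bigO0_weak k l f : (k <= l)%N -> bigO0 l f -> bigO0 k f.
Proof.
move=> kl [K [d [K0 d0 d1 H]]]; exists K, d; split => // e e0 ed.
rewrite (le_trans (H e e0 ed))// ler_wpM2l// ler_wiXn2l//.
by rewrite (le_trans (ltW ed)).
Qed.

Lemma bigO0D k f g : bigO0 k f -> bigO0 k g -> bigO0 k (fun e => f e + g e).
Proof.
move=> [K [d [K0 d0 d1 H]]] [L [c [L0 c0 c1 G]]].
exists (K + L), (Num.min d c); split; rewrite ?addr_ge0 ?lt_min ?d0 ?ge_min ?d1//.
move=> e e0; rewrite lt_min => /andP[ed ec].
by rewrite (le_trans (cabsD _ _))// mulrDl lerD ?H ?G.
Qed.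

Lemma bigO0M k l f g : bigO0 k f -> bigO0 l g -> bigO0 (k + l) (fun e => f e * g e).
Proof.
move=> [K [d [K0 d0 d1 H]]] [L [c [L0 c0 c1 G]]].
exists (K * L), (Num.min d c); split; rewrite ?mulr_ge0 ?lt_min ?d0 ?ge_min ?d1//.
move=> e e0; rewrite lt_min => /andP[ed ec].
by rewrite cabsM exprD mulrACA ler_pM ?cabs_ge0 ?H ?G.
Qed.

Lemma bigO0_cst z : bigO0 0 (fun=> z).
Proof.
exists (cabs z), 1; split => //; first exact: cabs_ge0.
by move=> e _ _; rewrite expr0 mulr1.
Qed.

Lemma bigO0Z z k f : bigO0 k f -> bigO0 k (fun e => z * f e).
Proof. by move=> /(bigO0M (bigO0_cst z)). Qed.

Lemma bigO0_pow k : bigO0 k (fun e => e%:C%C ^+ k).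
Proof.
exists 1, 1; split => // e _ _.
by rewrite cabsX cabsR mul1r.
Qed.

Lemma bigO00 k : bigO0 k (fun=> 0).
Proof.
by exists 0, 1; split => // e _ _; rewrite cabs0 mul0r.
Qed.

Lemma bigO0_sum k (I : Type) (r : seq I) (h : I -> R -> R[i]) :
  (forall i, bigO0 k (h i)) -> bigO0 k (fun e => \sum_(i <- r) h i e).
Proof.
move=> Oh; elim: r => [|i r IH].
  by apply: bigO0_eq (bigO00 k) => e; rewrite big_nil.
by apply: bigO0_eq (bigO0D (Oh i) IH) => e; rewrite big_cons.
Qed.

Lemma bigO0X k n f : bigO0 k f -> bigO0 (k * n) (fun e => f e ^+ n).
Proof.
move=> Of; elim: n => [|n IH].
  by rewrite muln0; apply: bigO0_eq (bigO0_cst 1) => e; rewrite expr0.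
rewrite mulnS; apply: bigO0_eq (bigO0M Of IH) => e.
by rewrite exprS.
Qed.

Lemma bigO0_subX k n f g : bigO0 0 f -> bigO0 0 g ->
  bigO0 k (fun e => f e - g e) -> bigO0 k (fun e => f e ^+ n - g e ^+ n).
Proof.
move=> Of Og Ofg.
apply: (@bigO0_eq _ (fun e => (f e - g e) *
    (\sum_(i < n) f e ^+ (n.-1 - i) * g e ^+ i))) => [e|]; first by rewrite subrXX.
rewrite -[k]addn0; apply: bigO0M Ofg _; apply: bigO0_sum => i.
by apply: (bigO0M (bigO0X _ Of) (bigO0X _ Og)).
Qed.

Lemma bigO0_cexp N f : bigO0 2 f ->
  bigO0 N.+1.*2 (fun e => cexp (f e) - \sum_(n < N.+1) f e ^+ n / n`!%:R).
Proof.
move=> [K [d [K0 d0 d1 H]]].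
exists ((2 * K) ^+ N.+1 * expR K), d; split => //.
  by rewrite mulr_ge0 ?expR_ge0// exprn_ge0// mulr_ge0.
move=> e e0 ed; rewrite (le_trans (cexp_taylor _ _))//.
have fK := H e e0 ed.
have e1 : `|e| <= 1 by rewrite (le_trans (ltW ed)).
have fK1 : cabs (f e) <= K by rewrite (le_trans fK)// ler_piMr// exprn_ile1.
rewrite mulrAC ler_pM ?expR_ge0 ?ler_expR// ?exprn_ge0 ?mulr_ge0 ?cabs_ge0//.
rewrite -mul2n exprM -exprMn; apply: lerXn2r;
  rewrite ?nnegrE ?mulr_ge0 ?cabs_ge0 ?exprn_ge0//.
by rewrite -mulrA ler_wpM2l.
Qed.

Lemma bigO0_cvg N f : bigO0 N.+1.*2 f ->
  cvgC (fun e : R => f e / e%:C%C ^+ N.*2) (0 : R)^' 0.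
Proof.
move=> [K [d [K0 d0 d1 H]]].
rewrite cvgCP; last by move=> A B FA AB; apply: filterS FA.
move=> c c0; have cK : 0 < c / (K + 1) by rewrite divr_gt0// ltr_wpDl.
have : nbhs (0 : R) (fun e => `|e| < Num.min d (c / (K + 1))).
  apply/(nbhs_ballP (0 : R)); exists (Num.min d (c / (K + 1))).
    by rewrite /= lt_min d0.
  by move=> y; rewrite /ball /= sub0r normrN.
apply: filterS => e; rewrite lt_min => /andP[ed ec] e0.
have ne0 : 0 < `|e| by rewrite normr_gt0.
rewrite /= subr0 cabsM cabsV cabsX cabsR ltr_pdivrMr ?exprn_gt0//.
rewrite (le_lt_trans (H e ne0 ed))// doubleS -addn2 exprD mulrCA mulrC.
rewrite ltr_pM2r ?exprn_gt0//.
have e1 : `|e| <= 1 by rewrite (le_trans (ltW ed)).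
move: ec; rewrite ltr_pdivlMr ?ltr_wpDl// => ec; apply: le_lt_trans ec.
rewrite mulrDr mulr1 expr2 mulrCA mulrA -[leLHS]addr0.
by rewrite [`|e| * K]mulrC lerD// ler_piMr// mulr_ge0.
Qed.

End BigOAtZero.

Section Expansion.
Context {R : realType}.

(** As for any asymptotic expansion: if the coefficients agree below $N$, the two quotients of order
    $N$ differ by exactly $s_N-s'_N$, while both tend to 0. *)
Lemma homogeneous_expansion_unique (q : R -> R[i]) (lam : R[i]) s s' :
  homogeneous_expansion q lam s -> homogeneous_expansion q lam s' -> s = s'.
Proof.
move=> [s0 Hs] [s'0 Hs']; apply/funext; elim/ltn_ind => N IH.
apply/eqP; rewrite -subr_eq0; apply/eqP; apply: cabs_le0.
apply/ler_addgt0Pr => e e0; rewrite add0r.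
have e20 : 0 < e / 2 by rewrite divr_gt0.
have F A B : (0 : R)^' A -> A `<=` B -> (0 : R)^' B by move=> FA AB; apply: filterS FA.
have := (cvgCP _ _ F).1 (Hs N) _ e20; have := (cvgCP _ _ F).1 (Hs' N) _ e20.
move=> H1 H2; have Hn : (0 : R)^' [set x | x != 0] by exact: (nbhs_dnbhs_neq (0 : R)).
have [x [[/= A B] xn0]] := filter_ex (filterI (filterI H1 H2) Hn).
have xC0 : x%:C%C ^+ N.*2 != 0 :> R[i].
  by rewrite expf_neq0//; apply: contra_neq xn0 => /complexI.
move: A B; rewrite !subr0 !big_ord_recr /=.
rewrite (eq_bigr (fun j : 'I_N => s j * x%:C%C ^+ j.*2)); last first.
  by move=> j _; rewrite IH.
move: (s11 _ _) (\sum_(j < N) _) => S T A B.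
rewrite (_ : s N - s' N = (S - (T + s' N * x%:C%C ^+ N.*2)) / x%:C%C ^+ N.*2 -
  (S - (T + s N * x%:C%C ^+ N.*2)) / x%:C%C ^+ N.*2); last by field.
rewrite (le_trans (cabsB _ _))// (_ : e = e / 2 + e / 2); last by lra.
by rewrite lerD// ltW.
Qed.

(** Three replacements, each with error $O(\varepsilon^{2N+2})$: the exponential of [S] by its
    Taylor polynomial, [S] by the partial sum [P], and the resulting polynomial [E] in
    $\varepsilon^2$ by its part of degree at most $N$, whose coefficients [exp_poly_coef]
    supplies. *)
Lemma homogeneous_expansion_exp_coef (q : R -> R[i]) (lam : R[i]) :
  sqint q -> 0 < complex.Im (lam ^+ 2) ->
  homogeneous_expansion q lam (exp_coef (log_coef q lam)).
Proof.
move=> hq w0; split => // N; apply: bigO0_cvg.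
have [K [r [d [K0 r0 d0 HS]]]] := s11_scale_series hq w0.
have /choice[S HSe] : forall e : R, exists S, `|e| < d ->
    s11 (fun x => e%:C%C * q x) lam = cexp S /\ forall N,
    cabs (S - \sum_(n < N) e%:C%C ^+ n.*2.+2 * log_coef q lam n)
       <= K * `|e| ^+ 2 * (r * `|e| ^+ 2) ^+ N.
  move=> e; have [ed|ed] := ltP `|e| d; last by exists 0.
  by have [S H1 H2] := HS e ed; exists S.
set b := log_coef q lam.
pose P (e : R) := \sum_(n < N) e%:C%C ^+ n.*2.+2 * b n.
have d10 : 0 < Num.min d 1 by rewrite lt_min d0 ltr01.
have O1 : bigO0 N.+1.*2 (fun e => S e - P e).
  exists (K * r ^+ N), (Num.min d 1); split => //.
  - by rewrite mulr_ge0 ?exprn_ge0.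
  - by rewrite ge_min lexx orbT.
  move=> e e0; rewrite lt_min => /andP[ed _].
  have [_ /(_ N) H] := HSe e ed; rewrite (le_trans H)//.
  rewrite [(r * _) ^+ N]exprMn (_ : `|e| ^+ N.+1.*2 = `|e| ^+ 2 * (`|e| ^+ 2) ^+ N).
    2: by rewrite -exprM mul2n -exprD add2n doubleS.
  move: ((`|e| ^+ 2) ^+ N) (r ^+ N) => x y.
  by rewrite le_eqVlt; apply/orP; left; apply/eqP; ring.
have OS : bigO0 2 S.
  exists K, (Num.min d 1); split => //; first by rewrite ge_min lexx orbT.
  move=> e e0; rewrite lt_min => /andP[ed _].
  by have [_ /(_ 0%N)] := HSe e ed; rewrite big_ord0 subr0 expr0 mulr1.
have OP : bigO0 0 P.
  apply: bigO0_sum => n; apply: (@bigO0_weak _ _ n.*2.+2) => //.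
  by have := bigO0M (bigO0_pow n.*2.+2) (bigO0_cst (b n)); rewrite addn0.
have OS0 : bigO0 0 S by apply: bigO0_weak OS.
pose B : {poly R[i]} := \sum_(n < N) b n *: 'X^(n.+1).
have B0 : B`_0 = 0.
  by rewrite /B coef_sum big1// => i _; rewrite coefZ coefXn mulr0.
have Bb k : (k < N)%N -> B`_k.+1 = b k.
  move=> kN; rewrite /B coef_sum (bigD1 (Ordinal kN)) //= coefZ coefXn eqxx mulr1.
  rewrite big1 ?addr0// => i ik; rewrite coefZ coefXn eqSS.
  by case: eqP => [E|]; rewrite ?mulr0//; case/eqP: ik; apply: val_inj.
pose E := \sum_(n < N.+1) (n`!%:R)^-1 *: B ^+ n.
have EP (e : R) : E.[e%:C%C ^+ 2] = \sum_(n < N.+1) P e ^+ n / n`!%:R.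
  rewrite /E horner_sum; apply: eq_bigr => n _; rewrite hornerZ horner_exp mulrC.
  congr (_ ^+ _ * _); rewrite /B horner_sum; apply: eq_bigr => k _.
  by rewrite hornerZ hornerXn mulrC -exprM mulnC muln2.
have OE : bigO0 N.+1.*2 (fun e => E.[e%:C%C ^+ 2] -
    \sum_(j < N.+1) exp_coef b j * e%:C%C ^+ j.*2).
  have OT : bigO0 N.+1.*2 (fun e =>
      \sum_(i < size E) E`_(N.+1 + i) * e%:C%C ^+ (N.+1 + i).*2).
    apply: bigO0_sum => i; apply: bigO0Z; apply: bigO0_weak (bigO0_pow _).
    by rewrite leq_double leq_addr.
  apply: bigO0_eq OT => e.
  rewrite (@horner_coef_wide _ (N.+1 + size E)) ?leq_addl// big_split_ord /=.
  rewrite addrAC [X in X + _](_ : _ = 0) ?add0r; last first.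
    apply/eqP; rewrite subr_eq0; apply/eqP; apply: eq_bigr => j _.
    have jN : (j <= N)%N by rewrite -ltnS.
    by rewrite (exp_poly_coef B0 Bb jN) -exprM mul2n.
  by apply: eq_bigr => j _; rewrite -exprM mul2n.
have OSP : bigO0 N.+1.*2 (fun e => \sum_(n < N.+1) S e ^+ n / n`!%:R -
    \sum_(n < N.+1) P e ^+ n / n`!%:R).
  have : bigO0 N.+1.*2 (fun e => \sum_(n < N.+1) n`!%:R^-1 * (S e ^+ n - P e ^+ n)).
    by apply: bigO0_sum => n; apply: bigO0Z; exact: bigO0_subX.
  apply: bigO0_eq => e; rewrite -sumrB; apply: eq_bigr => n _.
  by rewrite mulrC mulrBl.
have := bigO0D (bigO0D (bigO0_cexp N OS) OSP) OE.
move=> [K' [d' [K'0 d'0 d'1 H']]].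
exists K', (Num.min d d'); split => //.
- by rewrite lt_min d0.
- by rewrite ge_min d'1 orbT.
move=> e e0; rewrite lt_min => /andP[ed ed'].
have [-> _] := HSe e ed; rewrite (le_trans _ (H' e e0 ed'))//.
by rewrite EP !addrA !subrK.
Qed.

Lemma s_homE (q : R -> R[i]) (lam : R[i]) :
  sqint q -> 0 < complex.Im (lam ^+ 2) ->
  homogeneous_expansion q lam (s_hom q lam) /\
  s_hom q lam = exp_coef (log_coef q lam).
Proof.
move=> hq w0; have H := homogeneous_expansion_exp_coef hq w0.
have H' : homogeneous_expansion q lam (s_hom q lam).
  by apply: (@getPex _ [set s : nat -> R[i]^o | homogeneous_expansion q lam s]); exists (exp_coef (log_coef q lam)).
by split => //; exact: homogeneous_expansion_unique H' H.
Qed.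

Lemma b_homE (q : R -> R[i]) (lam : R[i]) n :
  sqint q -> 0 < complex.Im (lam ^+ 2) -> b_hom q lam n.+1 = log_coef q lam n.
Proof.
by move=> hq w0; rewrite /b_hom (s_homE hq w0).2 formal_logK.
Qed.

End Expansion.

(** * Words and the shuffle product *)

(* Words are listed from the largest variable to the smallest. *)
Fixpoint shuffle (u : seq bool) : seq bool -> seq (seq bool) :=
  if u is l :: u' then
    fix shuffle_u (v : seq bool) : seq (seq bool) :=
      if v is k :: v' then
        map (cons l) (shuffle u' v) ++ map (cons k) (shuffle_u v')
      else [:: u]
  else fun v => [:: v].

Lemma shuffle_nil u : shuffle u [::] = [:: u]. Proof. by case: u. Qed.

Lemma shuffle_cons l u k v : shuffle (l :: u) (k :: v) =
  map (cons l) (shuffle u (k :: v)) ++ map (cons k) (shuffle (l :: u) v).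
Proof. by []. Qed.

Local Notation nX := (count_mem letterX).
Local Notation nY := (count_mem letterY).

(** Since words run downwards from the largest variable, the suffixes tested here are the prefixes
    of the increasing listing. The strict excess of [letterX] is also what keeps all partial
    integrals decaying at $-\infty$. *)
Fixpoint excess_pos (w : seq bool) : bool :=
  if w is _ :: w' then (nY w < nX w)%N && excess_pos w' else true.

Lemma shuffle_count u v w : w \in shuffle u v ->
  nX w = (nX u + nX v)%N /\ nY w = (nY u + nY v)%N.
Proof.
have [n] := ubnP (size u + size v); elim: n => // n IH in u v w *.
case: u => [|l u]; first by rewrite /= inE => _ /eqP->.
case: v => [|k v]; first by rewrite shuffle_nil inE => _ /eqP->; rewrite /= !addn0.
rewrite shuffle_cons mem_cat /= => sn /orP[] /mapP[w' w'in ->] /=.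
  have [|-> ->] := IH u (k :: v) w' _ w'in; first by move: sn => /=; lia.
  by rewrite /= !addnA.
have [|-> ->] := IH (l :: u) v w' _ w'in; first by move: sn => /=; lia.
by rewrite /=; split; lia.
Qed.

(** A suffix of a shuffle is a shuffle of suffixes of the two words, not both empty, and letter
    counts add. *)
Lemma shuffle_pos u v w : excess_pos u -> excess_pos v -> w \in shuffle u v ->
  excess_pos w.
Proof.
have [n] := ubnP (size u + size v); elim: n => // n IH in u v w *.
case: u => [|l u]; first by rewrite /= inE => _ _ pv /eqP->.
case: v => [|k v]; first by rewrite shuffle_nil inE => _ pu _ /eqP->.
rewrite shuffle_cons mem_cat => sn pu pv.
have cnt := @shuffle_count (l :: u) (k :: v) w; rewrite shuffle_cons mem_cat in cnt.
move=> win; have [cX cY] := cnt win; move: win cX cY.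
have nu : (nY (l :: u) < nX (l :: u))%N by move: pu => /andP[].
have nv : (nY (k :: v) < nX (k :: v))%N by move: pv => /andP[].
move=> /orP[] /mapP[w' w'in ->] cX cY.
  apply/andP; split; first by rewrite cX cY; move: nu nv; clear; lia.
  by apply: IH w'in => //; case/andP: pu.
apply/andP; split; first by rewrite cX cY; move: nu nv; clear; lia.
by apply: IH w'in => //; [move: sn => /=; clear; lia|case/andP: pv].
Qed.

Definition words_step (s : seq (seq (seq bool))) : seq (seq bool) :=
  if size s is n.+1 then
    map (cons letterY) (flatten [seq flatten [seq flatten [seq shuffle u v
      | v <- nth [::] s (n - k)] | u <- nth [::] s k] | k <- iota 0 n.+1])
  else [:: [:: letterX]].

(** A list with repetitions, deliberately: the multiplicities become the coefficients of the formal
    linear combination. *)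
Definition ric_words : nat -> seq (seq bool) := hrec words_step.

Lemma ric_wordsS n : ric_words n.+1 =
  map (cons letterY) (flatten [seq flatten [seq flatten [seq shuffle u v
      | v <- ric_words (n - k)] | u <- ric_words k] | k <- iota 0 n.+1]).
Proof.
rewrite /ric_words /hrec /words_step size_history; congr (map _ (flatten _)).
apply/eq_in_map => k; rewrite mem_iota add0n => /andP[_ kn].
rewrite !(nth_history [::]) ?ltnS ?leq_subr//.
Qed.

Lemma ric_words_count n w : w \in ric_words n ->
  [/\ excess_pos w, nX w = n.+1 & nY w = n].
Proof.
elim/ltn_ind: n w => -[_ w|n IH w].
  by rewrite inE => /eqP->.
rewrite ric_wordsS => /mapP[w1 /flattenP[_ /mapP[k kn ->]]].
move=> /flattenP[_ /mapP[u uin ->]] /flattenP[_ /mapP[v vin ->]] w1in ->.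
move: kn; rewrite mem_iota add0n => /andP[_ kn].
have [pu Xu Yu] := IH k kn u uin.
have [|pv Xv Yv] := IH (n - k)%N _ v vin; first by rewrite ltnS leq_subr.
have [X1 Y1] := shuffle_count w1in.
have XE : nX w1 = n.+2 by rewrite X1 Xu Xv; move: kn; clear; lia.
have YE : nY w1 = n by rewrite Y1 Yu Yv; move: kn; clear; lia.
by split; rewrite /= ?XE ?YE ?(shuffle_pos pu pv w1in) ?andbT//; lia.
Qed.

(** * Iterated integrals attached to words, and the shuffle product formula *)

Section WordFunctions.
Context {R : realType}.
Local Notation mu := (@lebesgue_measure R).
Local Notation mble := (@measurable _ (measurableTypeR R)).

Fixpoint word_fun (aX aY : R -> R[i]) (w : seq bool) (t : R) : R[i] :=
  if w is l :: w' then
    cint `]-oo, t] (fun s => (if l then aX else aY) s * word_fun aX aY w' s)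
  else 1.

Variables (q aX aY : R -> R[i]) (w M : R).
Hypotheses (hq : sqint q) (w0 : 0 < w) (mX : cmeas aX) (mY : cmeas aY).
Hypothesis absX : forall s, cabs (aX s) = cabs (q s) * expR (2 * w * s).
Hypothesis absY : forall s, cabs (aY s) = cabs (q s) * expR (- (2 * w) * s).
Hypotheses (M0 : 0 <= M) (mM : forall t, wavg q w t <= M).

Local Notation W := (wprim q w).
Local Notation J := (word_fun aX aY).
Local Notation let_fun l := (if l then aX else aY).

Lemma wprim_le t : W t <= M * expR (2 * w * t).
Proof. by rewrite wprim_wavg mulrC ler_wpM2r ?expR_ge0. Qed.

(** A word with [d.+1] more X's than Y's has a word function of size $e^{2wds}W(s)$. A further X
    raises the exponent by one step and a Y lowers it; either way $W\le Me^{2ws}$ recreates the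
    factor [W] at the cost of one [M]. *)
Lemma letter_bound l (F : R -> R[i]) (C : R) (d d' : nat) : cmeas F -> 0 <= C ->
  (forall s, cabs (F s) <= C * expR (2 * w * d%:R * s) * W s) ->
  (if l then d' = d.+1 else d = d'.+1) -> forall t,
  cintb `]-oo, t] (fun s => let_fun l s * F s) /\
  cabs (cint `]-oo, t] (fun s => let_fun l s * F s)) <=
    C * M * expR (2 * w * d'%:R * t) * W t.
Proof.
move=> mF C0 FC dd' t.
have aE s : cabs (let_fun l s) * (expR (2 * w * d%:R * s) * expR (2 * w * s)) =
    expR (2 * w * d'%:R * s) * (cabs (q s) * expR (2 * w * s)).
  case: l dd' => ->.
    by rewrite absX -[d.+1%:R]natr1 [_ * (_ + 1)]mulrDr mulr1 mulrDl expRD; ring.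
  rewrite absY -[d'.+1%:R]natr1 [_ * (_ + 1)]mulrDr mulr1 mulrDl expRD mulNr expRN.
  by field; rewrite lt0r_neq0 ?expR_gt0.
have le s : s <= t -> cabs (let_fun l s * F s) <=
    C * M * expR (2 * w * d'%:R * t) * (cabs (q s) * expR (2 * w * s)).
  move=> st; rewrite cabsM (le_trans (ler_wpM2l (cabs_ge0 _) (FC s)))//.
  have CE : 0 <= C * expR (2 * w * d%:R * s) by rewrite mulr_ge0 ?expR_ge0.
  rewrite (le_trans (ler_wpM2l (cabs_ge0 _) (ler_wpM2l CE (wprim_le s))))//.
  rewrite [leLHS](_ : _ = C * M * (cabs (let_fun l s) *
    (expR (2 * w * d%:R * s) * expR (2 * w * s)))); last by ring.
  rewrite aE mulrA ler_wpM2r ?mulr_ge0 ?cabs_ge0 ?expR_ge0// ler_wpM2l ?mulr_ge0//.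
  by rewrite ler_expR ler_wpM2l// !mulr_ge0// ltW.
have ml : cmeas (let_fun l) by case: (l).
have mlF : cmeas (fun s => let_fun l s * F s) by exact: cmeasM.
have jd : mu.-integrable `]-oo, t] (EFin \o (fun s =>
    C * M * expR (2 * w * d'%:R * t) * (cabs (q s) * expR (2 * w * s)))).
  by have := integrableZl (measurable_itv _ : mble `]-oo, t])
    (C * M * expR (2 * w * d'%:R * t)) (wprim_integrable hq w0 t).
have le' s : `]-oo, t]%classic s -> cabs (let_fun l s * F s) <=
    C * M * expR (2 * w * d'%:R * t) * (cabs (q s) * expR (2 * w * s)).
  by rewrite /= in_itv /=; exact: le.
split; first exact: cintb_dom mlF jd le'.
rewrite (le_trans (cabs_cint_le _ mlF jd le'))//.
by rewrite RintegralZl//; exact: wprim_integrable.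
Qed.

Definition word_deg (v : seq bool) : nat := (nX v - nY v).-1.

Lemma word_deg_cons l k v : excess_pos (l :: k :: v) ->
  if l then word_deg (l :: k :: v) = (word_deg (k :: v)).+1
  else word_deg (k :: v) = (word_deg (l :: k :: v)).+1.
Proof.
rewrite /word_deg; move=> /andP[]; rewrite -/(excess_pos (k :: v)) => h1 /andP[h2 _].
by move: h1 h2; case: l => /= ; clear; lia.
Qed.

Lemma word_fun_bound v : excess_pos v ->
  (v != [::] -> cmeas (J v) /\ exists2 C, 0 <= C & forall t,
     cabs (J v t) <= C * expR (2 * w * (word_deg v)%:R * t) * W t) /\
  (forall l t, excess_pos (l :: v) ->
     cintb `]-oo, t] (fun s => let_fun l s * J v s)).
Proof.
elim: v => [_|k v IH].
  split => // l t; case: l => //= _.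
  apply: (@cintb_ext _ _ aX) => [x|]; first by rewrite mulr1.
  exact: (cintb_X hq w0 mX absX).
move=> pkv; have /andP[nkv pv] := pkv; have [IH1 IH2] := IH pv.
have H1 : cmeas (J (k :: v)) /\ exists2 C, 0 <= C & forall t,
    cabs (J (k :: v) t) <= C * expR (2 * w * (word_deg (k :: v))%:R * t) * W t.
  split.
    by apply: prim_cmeas (primNy (f := fun s => let_fun k s * J v s) _) => t; exact: IH2.
  case: v IH1 {IH IH2} pv pkv nkv => [_ _ _|l v IH1 _ plv _].
    case: k => // _; exists 1 => // t; rewrite /word_deg /= !mulr0 mul0r expR0 !mul1r.
    rewrite (@eq_cint _ _ _ aX); last by move=> s _; rewrite mulr1.
    exact: (cabs_cint_X hq w0 mX absX).
  have [mJ [C C0 JC]] := IH1 isT.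
  exists (C * M); first by rewrite mulr_ge0.
  by move=> t; case: (letter_bound mJ C0 JC (word_deg_cons plv) t).
split => // l t plkv; have [mJ [C C0 JC]] := H1.
by case: (letter_bound mJ C0 JC (word_deg_cons plkv) t).
Qed.

Lemma cintb_word l v t : excess_pos (l :: v) ->
  cintb `]-oo, t] (fun s => let_fun l s * J v s).
Proof. by move=> plv; have /andP[_ pv] := plv; apply: (word_fun_bound pv).2. Qed.

Lemma word_fun_prim l v : excess_pos (l :: v) ->
  prim (J (l :: v)) (fun s => let_fun l s * J v s).
Proof. by move=> plv; apply: primNy => t; exact: cintb_word. Qed.

Lemma wprim_cvgNy e : 0 < e -> exists T, forall t, t < T -> W t < e.
Proof.
move=> e0; have M1 : 0 < M + 1 by rewrite ltr_wpDl.
have eM : 0 < e / (M + 1) by rewrite divr_gt0.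
have w20 : 0 < 2 * w by rewrite mulr_gt0.
exists (ln (e / (M + 1)) / (2 * w)) => t tT.
rewrite (le_lt_trans (wprim_le t))//.
apply: (@le_lt_trans _ _ ((M + 1) * expR (2 * w * t))).
  by rewrite ler_wpM2r ?expR_ge0// lerDl.
rewrite mulrC -ltr_pdivlMr// -[ltRHS]lnK ?posrE// ltr_expR mulrC -ltr_pdivlMr//.
Qed.

Lemma word_fun_cvgNy v : excess_pos v -> v != [::] -> cvgC (J v) -oo 0.
Proof.
move=> pv vn; have [mJ [C C0 JC]] := (word_fun_bound pv).1 vn.
apply/cvgC_nyP => e e0; have C1 : 0 < C + 1 by rewrite ltr_wpDl.
have eC : 0 < e / (C + 1) by rewrite divr_gt0.
have [T HT] := wprim_cvgNy eC; exists (Num.min T 0) => x.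
rewrite lt_min => /andP[xT x0]; rewrite subr0 (le_lt_trans (JC x))//.
apply: (@le_lt_trans _ _ ((C + 1) * W x)).
  rewrite ler_wpM2r ?wprim_ge0// (@le_trans _ _ C) ?lerDl// ler_piMr//.
  by rewrite -[leRHS]expR0 ler_expR mulr_ge0_le0 ?(ltW x0)// !mulr_ge0// ltW.
by rewrite mulrC -ltr_pdivlMr// HT.
Qed.

(** By the product rule and the induction hypotheses both sides have the same density, the two
    branches of the shuffle being the two choices of the largest variable. Both sides tend to 0 at
    $-\infty$, so they agree. *)
Lemma word_fun_shuffle u v : excess_pos u -> excess_pos v -> forall t,
  J u t * J v t = \sum_(x <- shuffle u v) J x t.
Proof.
have [n] := ubnP (size u + size v); elim: n => // n IH in u v *.
case: u => [|l u]; first by move=> _ _ _ t; rewrite /= big_seq1 mul1r.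
case: v => [|k v]; first by move=> _ _ _ t; rewrite shuffle_nil big_seq1 mulr1.
move=> sn pu pv.
have pu' : excess_pos u by case/andP: pu.
have pv' : excess_pos v by case/andP: pv.
have IH1 := IH u (k :: v) sn pu' pv.
have sn2 : (size (l :: u) + size v < n)%N by move: sn => /=; clear; lia.
have IH2 := IH (l :: u) v sn2 pu pv'.
pose S t := \sum_(x <- shuffle (l :: u) (k :: v)) J x t.
have pmap b xs : {in xs, forall x, excess_pos (b :: x)} ->
    prim (fun t => \sum_(x <- map (cons b) xs) J x t)
         (fun s => let_fun b s * \sum_(x <- xs) J x s).
  elim: xs => [_|x xs IHx pxs].
    apply: (@prim_eq _ _ (fun=> 0)); last by move=> x; rewrite big_nil mulr0.
    rewrite (_ : (fun _ => _) = fun=> 0); first exact: prim_cst.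
    by apply/funext => t; rewrite big_nil.
  rewrite (_ : (fun _ => _) = fun t => J (b :: x) t +
      \sum_(y <- map (cons b) xs) J y t); last first.
    by apply/funext => t; rewrite /= big_cons.
  apply: (@prim_eq _ _ (fun s => let_fun b s * J x s + let_fun b s * \sum_(y <- xs) J y s)).
    apply: primD; first by apply: word_fun_prim; apply: pxs; exact: mem_head.
    by apply: IHx => y yin; apply: pxs; rewrite inE yin orbT.
  by move=> s; rewrite big_cons mulrDr.
have pS : prim S (fun s => let_fun l s * (J u s * J (k :: v) s) +
    let_fun k s * (J (l :: u) s * J v s)).
  rewrite /S (_ : (fun _ => _) = fun t =>
    \sum_(x <- map (cons l) (shuffle u (k :: v))) J x t +
    \sum_(x <- map (cons k) (shuffle (l :: u) v)) J x t); last first.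
    by apply/funext => t; rewrite shuffle_cons big_cat.
  apply: (@prim_eq _ _ (fun s => let_fun l s * \sum_(x <- shuffle u (k :: v)) J x s +
    let_fun k s * \sum_(x <- shuffle (l :: u) v) J x s)).
    apply: primD; apply: pmap => x xin.
      by apply: (shuffle_pos pu pv); rewrite shuffle_cons mem_cat map_f.
    by apply: (shuffle_pos pu pv); rewrite shuffle_cons mem_cat map_f ?orbT.
  by move=> s; rewrite IH1 IH2.
have pJ := primM (word_fun_prim pu) (word_fun_prim pv).
have p0 : prim (fun t => J (l :: u) t * J (k :: v) t - S t) (fun=> 0).
  apply: (prim_eq (primB pJ pS)) => s.
  by move: (J (l :: u) s) (J (k :: v) s) => x y; ring.
move=> t; apply/eqP; rewrite -subr_eq0; apply/eqP.
have Slim : cvgC S -oo 0.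
  rewrite /S; have : {in shuffle (l :: u) (k :: v), forall x, cvgC (J x) -oo 0}.
    move=> x xin; apply: word_fun_cvgNy; first exact: shuffle_pos xin.
    have [cX _] := shuffle_count xin; apply/eqP => x0; move: cX; rewrite x0.
    by move: pu => /andP[]; clear; move=> /= ; lia.
  elim: (shuffle _ _) => [_|x xs IHx Hx].
    by apply: (@cvgC_eq _ R _ (fun=> 0)) => [s|]; [rewrite big_nil|exact: cvgC_cst].
  apply: (@cvgC_eq _ _ _ (fun s => J x s + \sum_(y <- xs) J y s)).
    by move=> s; rewrite big_cons.
  rewrite -[X in cvgC _ _ X](addr0 (0 : R[i])); apply: cvgCD.
    by apply: Hx; exact: mem_head.
  by apply: IHx => y yin; apply: Hx; rewrite inE yin orbT.
have cst : cvgC (fun _ : R => J (l :: u) t * J (k :: v) t - S t) -oo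
  (J (l :: u) t * J (k :: v) t - S t) by exact: cvgC_cst.
apply: cvgC_unique cst _.
apply: (@cvgC_eq _ _ _ (fun s => J (l :: u) s * J (k :: v) s + (-1) * S s)).
  by move=> s; rewrite mulN1r (prim0_cst p0 t s).
rewrite [X in cvgC _ _ X](_ : 0 = 0 * 0 + (-1) * 0 :> R[i]); last by ring.
apply: cvgCD.
  by apply: cvgCM; apply: word_fun_cvgNy.
by apply: (cvgCM _ Slim); exact: cvgC_cst.
Qed.

Lemma ric_word_fun n t : ric aX aY n t = \sum_(v <- ric_words n) J v t.
Proof.
elim/ltn_ind: n t => -[_|n IH] t.
  rewrite ric0 big_seq1 /=; apply: eq_cint => s _.
  by rewrite mulr1.
rewrite ricS ric_wordsS.
set L := flatten _.
have Lin x : x \in L -> excess_pos (letterY :: x).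
  move=> xL; have : (letterY :: x) \in ric_words n.+1 by rewrite ric_wordsS map_f.
  by move=> /ric_words_count[].
have -> : cint `]-oo, t] (fun x => aY x * \sum_(k < n.+1) ric aX aY k x * ric aX aY (n - k) x)
    = cint `]-oo, t] (fun s => \sum_(x <- L) aY s * J x s).
  apply: eq_cint => s _; rewrite -mulr_sumr; congr (_ * _).
  rewrite /L big_flatten big_map -{1}[iota 0 n.+1]val_enum_ord big_map big_enum /=.
  apply: eq_bigr => k _; have kn : (k <= n)%N by rewrite -ltnS.
  rewrite !IH ?ltnS ?leq_subr//.
  rewrite mulr_suml big_flatten big_map big_seq [RHS]big_seq.
  apply: eq_bigr => u uin; rewrite mulr_sumr big_flatten big_map big_seq [RHS]big_seq.
  apply: eq_bigr => v vin; apply: word_fun_shuffle.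
    by case: (ric_words_count uin).
  by case: (ric_words_count vin).
rewrite big_map; elim: L Lin => [_|x L IHL Lin].
  by rewrite big_nil -[RHS](cint0 `]-oo, t]); apply: eq_cint => s _; rewrite big_nil.
rewrite big_cons -IHL; last by move=> y yL; apply: Lin; rewrite inE yL orbT.
rewrite (@eq_cint _ _ _ (fun s => aY s * J x s + \sum_(y <- L) aY s * J y s)); last first.
  by move=> s _; rewrite big_cons.
rewrite cintD//; first by apply: (@cintb_word letterY); apply: Lin; exact: mem_head.
elim: L Lin {IHL} => [_|y L IHL Lin].
  by apply: (@cintb_ext _ _ (fun=> 0)) => [s|]; [rewrite big_nil|exact: cintb0].
apply: (@cintb_ext _ _ (fun s => aY s * J y s + \sum_(z <- L) aY s * J z s)).
  by move=> s; rewrite big_cons.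
apply: cintbD => //.
  by apply: (@cintb_word letterY); apply: Lin; rewrite !inE eqxx orbT.
apply: IHL => z; rewrite inE => /orP[/eqP->|zL]; apply: Lin; first exact: mem_head.
by rewrite !inE zL !orbT.
Qed.

End WordFunctions.

(** * Iterated integrals *)

Section ProductIntegrals.
Context {R : realType}.
Local Notation mu := (@lebesgue_measure R).
Local Notation mble := (@measurable _ (measurableTypeR R)).
Local Notation RM := (measurableTypeR R).

Lemma measurable_integral_section d (T : measurableType d) (h : T * RM -> \bar R) :
  measurable_fun [set: T * RM] h -> (forall z, (0 <= h z)%E) ->
  measurable_fun [set: T] (fun x => \int[mu]_t h (x, t))%E.
Proof. by move=> mh h0; exact: (measurable_fun_fubini_tonelli_F (m2 := mu) h). Qed.

Lemma measurable_Rintegral_section d (T : measurableType d) (h : T * RM -> R) :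
  measurable_fun [set: T * RM] h ->
  measurable_fun [set: T] (fun x => \int[mu]_t h (x, t)).
Proof.
move=> mh; rewrite /Rintegral.
apply: (@measurableT_comp _ _ _ _ _ _ fine); first exact: fine_measurable.
have mE : measurable_fun [set: T * RM] (EFin \o h) by apply/measurable_EFinP.
rewrite (_ : (fun x => _) = (fun x =>
  \int[mu]_t (fun z => (EFin \o h)^\+ z) (x, t) - \int[mu]_t (fun z => (EFin \o h)^\- z) (x, t))%E).
  apply: emeasurable_funB; apply: measurable_integral_section.
  - exact: measurable_funepos.
  - by move=> z; exact: funepos_ge0.
  - exact: measurable_funeneg.
  - by move=> z; exact: funeneg_ge0.
apply/funext => x; rewrite [LHS]integralE; congr (_ - _)%E; apply: eq_integral => t _.
  by rewrite !unlock.
by rewrite !unlock.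
Qed.

Lemma cmeas_cint_section d (T : measurableType d) (h : T * RM -> R[i]) :
  cmeas h -> cmeas (fun x => cint [set: R] (fun t => h (x, t))).
Proof.
move=> [hr hi]; split.
  exact: (measurable_Rintegral_section hr).
exact: (measurable_Rintegral_section hi).
Qed.

(** Stated without integrability, the bound being trivial when the right side is infinite; it can
    thus be iterated although sections are integrable only almost everywhere. *)
Lemma cabs_cint_ereal (h : R -> R[i]) : cmeas h ->
  ((cabs (cint [set: R] h))%:E <= \int[mu]_t (cabs (h t))%:E)%E.
Proof.
move=> mh; have [foo|] := ltP (\int[mu]_t (cabs (h t))%:E)%E +oo%E; last first.
  by rewrite leye_eq => /eqP ->; exact: leey.
have jh : cintb [set: R] h.
  split => //; apply/integrableP; split.
    by apply/measurable_EFinP; exact: measurable_cabs.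
  by under eq_integral do rewrite /= ger0_norm ?cabs_ge0//.
rewrite -[leRHS]fineK; last by rewrite ge0_fin_numE// integral_ge0// => t _; rewrite lee_fin cabs_ge0.
by rewrite lee_fin; exact: (cabs_cint (measurableT : mble setT) jh).
Qed.

Lemma ae_mono (P Q : R -> Prop) : (forall t, P t -> Q t) ->
  {ae mu, forall t, P t} -> {ae mu, forall t, Q t}.
Proof. by move=> PQ; apply: filterS PQ; exact: (ae_filter_ringOfSetsType mu). Qed.

Lemma ae_eq_Rintegral (f g : R -> R) : measurable_fun [set: R] f ->
  measurable_fun [set: R] g -> {ae mu, forall t, f t = g t} ->
  \int[mu]_t f t = \int[mu]_t g t.
Proof.
move=> mf mg fg; rewrite /Rintegral; congr fine; apply: ae_eq_integral => //.
- exact/measurable_EFinP.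
- exact/measurable_EFinP.
- by move: fg; apply: ae_mono => t fg _; rewrite fg.
Qed.

Lemma ae_eq_cint (f g : R -> R[i]) : cmeas f -> cmeas g ->
  {ae mu, forall t, f t = g t} -> cint [set: R] f = cint [set: R] g.
Proof.
move=> [fr fi] [gr gi] fg; rewrite /cint; congr (Complex _ _).
  by apply: ae_eq_Rintegral => //; move: fg; apply: ae_mono => t ->.
by apply: ae_eq_Rintegral => //; move: fg; apply: ae_mono => t ->.
Qed.

(** The real-valued inner integrals agree with the extended ones only where the section is
    integrable, that is almost everywhere; the outer integrals do not see the difference. *)
Lemma Rintegral_fubini (r : RM * RM -> R) : measurable_fun [set: RM * RM] r ->
  (\int[mu]_s \int[mu]_t `|r (s, t)|%:E < +oo)%E ->
  \int[mu]_s (\int[mu]_t r (s, t)) = \int[mu]_t (\int[mu]_s r (s, t)).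
Proof.
move=> mr foo.
have mE : measurable_fun [set: RM * RM] (EFin \o r) by apply/measurable_EFinP.
have jr : (mu \x mu)%E.-integrable setT (EFin \o r) by apply/integrable12ltyP.
transitivity (fine (\int[mu]_s \int[mu]_t (r (s, t))%:E)%E).
  rewrite {1}/Rintegral; congr fine; apply: ae_eq_integral => //.
  - by apply/measurable_EFinP; exact: measurable_Rintegral_section.
  - exact: (measurable_fubini_F jr).
  - have := ae_integrable1 jr; apply: ae_mono => s js _.
    by rewrite /Rintegral fineK//; exact: (integrable_fin_num (measurableT : mble setT) js).
rewrite (Fubini jr) /Rintegral; congr fine; apply/esym; apply: ae_eq_integral => //.
- apply/measurable_EFinP; apply: (measurable_Rintegral_section (h := fun z => r (z.2, z.1))).
  by apply: (measurableT_comp mr); exact: measurable_swap.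
- exact: (measurable_fubini_G jr).
- have := ae_integrable2 jr; apply: ae_mono => s js _.
  by rewrite /Rintegral fineK//; exact: (integrable_fin_num (measurableT : mble setT) js).
Qed.

Lemma cint_fubini (h : RM * RM -> R[i]) : cmeas h ->
  (\int[mu]_s \int[mu]_t (cabs (h (s, t)))%:E < +oo)%E ->
  cint [set: R] (fun s => cint [set: R] (fun t => h (s, t))) =
  cint [set: R] (fun t => cint [set: R] (fun s => h (s, t))).
Proof.
move=> mh foo; have [hr hi] := mh.
have fin (p : R[i] -> R) : (forall z, `|p z| <= cabs z) ->
    measurable_fun [set: RM * RM] (fun z => p (h z)) ->
    (\int[mu]_s \int[mu]_t `|p (h (s, t))|%:E < +oo)%E.
  move=> pz mp; apply: le_lt_trans foo.
  have mph : measurable_fun [set: RM * RM] (fun z => `|p (h z)|%:E).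
    by apply/measurable_EFinP; exact: measurableT_comp.
  have mch : measurable_fun [set: RM * RM] (fun z => (cabs (h z))%:E).
    by apply/measurable_EFinP; exact: measurable_cabs.
  apply: ge0_le_integral => //.
  - by move=> s _; apply: integral_ge0 => t _; rewrite lee_fin.
  - exact: (measurable_integral_section mph).
  - apply: (measurable_integral_section mch) => z; rewrite lee_fin; exact: cabs_ge0.
  - move=> s _; apply: ge0_le_integral => //.
    + exact: (measurableT_comp mph (measurable_pair1 s)).
    + exact: (measurableT_comp mch (measurable_pair1 s)).
    + by move=> t _; rewrite lee_fin.
apply: complex_eqP => /=.
  exact: (Rintegral_fubini hr (fin _ (@Re_le_cabs R) hr)).
exact: (Rintegral_fubini hi (fin _ (@Im_le_cabs R) hi)).
Qed.

End ProductIntegrals.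

Section IteratedIntegrals.
Context {R : realType}.
Local Notation mu := (@lebesgue_measure R).
Local Notation mble := (@measurable _ (measurableTypeR R)).
Local Notation RM := (measurableTypeR R).
Local Notation env := (nat -> R).

Definition upd (e : env) (i : nat) (t : R) : env := fun k => if k == i then t else e k.

Lemma updC e i k s t : i != k -> upd (upd e i s) k t = upd (upd e k t) i s.
Proof.
move=> ik; apply/funext => m; rewrite /upd; case: (eqVneq m k) => [->|//].
by rewrite eq_sym (negbTE ik).
Qed.

(* Joint measurability in finitely many coordinates, tested by composing with
   arbitrary measurable families. *)
Definition jmeas (f : env -> R[i]) : Prop :=
  forall d (T : measurableType d) (g : nat -> T -> R),
    (forall i, measurable_fun [set: T] (g i)) -> cmeas (fun x => f (fun i => g i x)).

Definition jmease (F : env -> \bar R) : Prop :=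
  forall d (T : measurableType d) (g : nat -> T -> R),
    (forall i, measurable_fun [set: T] (g i)) ->
    measurable_fun [set: T] (fun x => F (fun i => g i x)).

(** The list names the coordinates and gives the order of integration, so that Fubini becomes
    invariance under permutation of the list. *)
Fixpoint iterc (l : seq nat) (f : env -> R[i]) (e : env) : R[i] :=
  if l is i :: l' then cint [set: R] (fun t => iterc l' f (upd e i t)) else f e.

Fixpoint itere (l : seq nat) (F : env -> \bar R) (e : env) : \bar R :=
  if l is i :: l' then (\int[mu]_t itere l' F (upd e i t))%E else F e.

Lemma measurable_upd d (T : measurableType d) (g : nat -> T -> R) i :
  (forall k, measurable_fun [set: T] (g k)) ->
  forall k, measurable_fun [set: T * RM] (fun z => upd (fun m => g m z.1) i z.2 k).
Proof.
move=> mg k; rewrite /upd; case: eqP => _; first exact: measurable_snd.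
by apply: (measurableT_comp (mg k)); exact: measurable_fst.
Qed.

Lemma measurable_upd1 e i k : measurable_fun [set: RM] (fun t => upd e i t k).
Proof. by rewrite /upd; case: eqP => _; [exact: measurable_id|exact: measurable_cst]. Qed.

(** Integrating out one coordinate uses the hypothesis on the product of [T] with the line; this is
    why families over arbitrary measurable spaces are allowed. *)
Lemma jmeas_iterc l f : jmeas f -> jmeas (iterc l f).
Proof.
move=> jf; elim: l => //= i l IH d T g mg.
exact: (cmeas_cint_section (IH _ _ _ (measurable_upd i mg))).
Qed.

Lemma itere_ge0 l F e : (forall e, (0 <= F e)%E) -> (0 <= itere l F e)%E.
Proof.
move=> F0; elim: l e => //= i l IH e.
by apply: integral_ge0 => t _; exact: IH.
Qed.

Lemma jmease_itere l F : jmease F -> (forall e, (0 <= F e)%E) -> jmease (itere l F).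
Proof.
move=> jF F0; elim: l => //= i l IH d T g mg.
apply: (measurable_integral_section (IH _ _ _ (measurable_upd i mg))) => z.
exact: itere_ge0.
Qed.

Lemma jmease_cabs f : jmeas f -> jmease (fun e => (cabs (f e))%:E).
Proof.
by move=> jf d T g mg; apply/measurable_EFinP; apply: measurable_cabs; exact: jf.
Qed.

Lemma cabs_iterc l f e : jmeas f ->
  ((cabs (iterc l f e))%:E <= itere l (fun e => (cabs (f e))%:E) e)%E.
Proof.
move=> jf; elim: l e => //= i l IH e.
have mh : cmeas (fun t => iterc l f (upd e i t)).
  exact: (jmeas_iterc l jf (measurable_upd1 e i)).
apply: (le_trans (cabs_cint_ereal mh)).
apply: ge0_le_integral => //.
- by move=> t _; rewrite lee_fin cabs_ge0.
- by apply/measurable_EFinP; exact: measurable_cabs.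
- apply: (jmease_itere l (jmease_cabs jf) _ (measurable_upd1 e i)) => e'.
  by rewrite lee_fin cabs_ge0.
Qed.

Lemma itere_swap i k l F e : i != k -> jmease F -> (forall e, (0 <= F e)%E) ->
  itere (i :: k :: l) F e = itere (k :: i :: l) F e.
Proof.
move=> ik jF F0 /=.
have mh : measurable_fun [set: RM * RM]
    (fun z : RM * RM => itere l F (upd (upd e i z.1) k z.2)).
  apply: (jmease_itere l jF F0 (T := (RM * RM)%type)) => m.
  apply: (measurable_upd (T := RM) (g := fun m s => upd e i s m)) => m'.
  exact: measurable_upd1.
rewrite (fubini_tonelli (m1 := mu) (m2 := mu)
  (fun z : RM * RM => itere l F (upd (upd e i z.1) k z.2)) mh
  (fun z => itere_ge0 l _ F0)).
by under eq_integral do under eq_integral do rewrite /= updC//.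
Qed.

Lemma itere_front i l1 l2 F e : i \notin l1 -> jmease F -> (forall e, (0 <= F e)%E) ->
  itere (l1 ++ i :: l2) F e = itere (i :: l1 ++ l2) F e.
Proof.
move=> + jF F0; elim: l1 e => // k l1 IH e; rewrite inE negb_or => /andP[ik il1].
rewrite [RHS](itere_swap _ _ ik)//=; apply: eq_integral => t _.
exact: IH.
Qed.

Lemma ae_finite (G : R -> \bar R) : measurable_fun [set: R] G ->
  (forall t, (0 <= G t)%E) -> (\int[mu]_t G t < +oo)%E ->
  {ae mu, forall t, (G t < +oo)%E}.
Proof.
move=> mG G0 foo; have jG : mu.-integrable [set: R] G.
  by apply/integrableP; split => //; under eq_integral do rewrite gee0_abs//.
have := integrable_ae (measurableT : mble setT) jG; apply: ae_mono => t /(_ I).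
by move=> /fin_numPlt /andP[].
Qed.

Lemma itere_perm l l' F e : uniq l -> perm_eq l l' -> jmease F ->
  (forall e, (0 <= F e)%E) -> itere l F e = itere l' F e.
Proof.
move=> + + jF F0; elim: l l' e => [|k l IHl] m e.
  by rewrite perm_sym => _ /perm_nilP ->.
move=> /andP[kl ul] pm.
have km : k \in m by rewrite -(perm_mem pm) mem_head.
case/splitPr: km pm => m1 m2 pm.
have pm' : perm_eq l (m1 ++ m2).
  by rewrite -(perm_cons k) (perm_trans pm)// perm_catC /= perm_cons perm_catC.
have km1 : k \notin m1.
  by apply: contra kl => km1; rewrite (perm_mem pm') mem_cat km1.
by rewrite itere_front//=; apply: eq_integral => t _; exact: IHl.
Qed.

Section Permutation.
Variable f : env -> R[i].
Hypothesis jf : jmeas f.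
Local Notation F := (fun e => (cabs (f e))%:E).
Let F0 e : (0 <= F e)%E. Proof. by rewrite lee_fin cabs_ge0. Qed.
Let jF : jmease F := jmease_cabs jf.

Lemma ae_itere_finite i l e : (itere (i :: l) F e < +oo)%E ->
  {ae mu, forall t, (itere l F (upd e i t) < +oo)%E}.
Proof.
apply: ae_finite => [|t]; last exact: itere_ge0.
exact: (jmease_itere l jF F0 (measurable_upd1 e i)).
Qed.

(** Finiteness of the absolute integral passes to the inner integrals for almost every value of the
    outer variable only, and equality almost everywhere is enough under [cint]. *)
Lemma iterc_congr i l l' e : (itere (i :: l) F e < +oo)%E ->
  (forall e', (itere l F e' < +oo)%E -> iterc l f e' = iterc l' f e') ->
  iterc (i :: l) f e = iterc (i :: l') f e.
Proof.
move=> fin H /=; apply: ae_eq_cint.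
- exact: (jmeas_iterc l jf (measurable_upd1 e i)).
- exact: (jmeas_iterc l' jf (measurable_upd1 e i)).
- by move: (ae_itere_finite fin); apply: ae_mono => t /H.
Qed.

Lemma iterc_swap i k l e : i != k -> (itere (i :: k :: l) F e < +oo)%E ->
  iterc (i :: k :: l) f e = iterc (k :: i :: l) f e.
Proof.
move=> ik fin /=.
have mg m : measurable_fun [set: RM * RM]
    (fun z : RM * RM => upd (upd e i z.1) k z.2 m).
  apply: (measurable_upd (T := RM) (g := fun m s => upd e i s m)) => m'.
  exact: measurable_upd1.
have mh : cmeas (fun z : RM * RM => iterc l f (upd (upd e i z.1) k z.2)).
  exact: (jmeas_iterc l jf mg).
have me : measurable_fun [set: RM * RM]
    (fun z : RM * RM => itere l F (upd (upd e i z.1) k z.2)).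
  exact: (jmease_itere l jF F0 mg).
have mc : measurable_fun [set: RM * RM]
    (fun z : RM * RM => (cabs (iterc l f (upd (upd e i z.1) k z.2)))%:E).
  by apply/measurable_EFinP; exact: measurable_cabs.
rewrite (cint_fubini mh).
  by apply: eq_cint => t _; apply: eq_cint => s _; rewrite /= updC.
apply: le_lt_trans fin; apply: ge0_le_integral => //.
- by move=> s _; apply: integral_ge0 => t _; rewrite lee_fin cabs_ge0.
- by apply: (measurable_integral_section mc) => z; rewrite lee_fin cabs_ge0.
- by apply: (measurable_integral_section me) => z; exact: itere_ge0.
- move=> s _; apply: ge0_le_integral => //.
  + by move=> t _; rewrite lee_fin cabs_ge0.
  + exact: (measurableT_comp mc (measurable_pair1 s)).
  + exact: (measurableT_comp me (measurable_pair1 s)).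
  + by move=> t _; exact: cabs_iterc.
Qed.

Lemma iterc_front i l1 l2 e : i \notin l1 ->
  (itere (i :: l1 ++ l2) F e < +oo)%E ->
  iterc (i :: l1 ++ l2) f e = iterc (l1 ++ i :: l2) f e.
Proof.
elim: l1 e => // k l1 IH e; rewrite inE negb_or => /andP[ik il1] fin.
rewrite iterc_swap//; apply: iterc_congr.
  by rewrite -(itere_swap _ _ ik).
by move=> e' fin'; apply: IH.
Qed.

Lemma iterc_perm l l' e : uniq l -> perm_eq l l' ->
  (itere l F e < +oo)%E -> iterc l f e = iterc l' f e.
Proof.
elim: l l' e => [|i l IH] l' e; first by rewrite perm_sym => _ /perm_nilP ->.
move=> /andP[il ul] pl fin.
have il' : i \in l' by rewrite -(perm_mem pl) mem_head.
case/splitPr: il' pl => l1 l2 pl.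
have pl' : perm_eq l (l1 ++ l2).
  by rewrite -(perm_cons i) (perm_trans pl)// perm_catC /= perm_cons perm_catC.
have il1 : i \notin l1.
  by apply: contra il => il1; rewrite (perm_mem pl') mem_cat il1.
rewrite (@iterc_congr i l (l1 ++ l2))//; last by move=> e' ?; exact: IH.
apply: iterc_front => //; rewrite -(@itere_perm (i :: l))//=; first by rewrite il.
by rewrite perm_cons.
Qed.

End Permutation.

End IteratedIntegrals.

(** * Word functions as iterated integrals over decreasing chains of variables *)

Section ChainIntegrals.
Context {R : realType}.
Local Notation mu := (@lebesgue_measure R).
Local Notation mble := (@measurable _ (measurableTypeR R)).
Local Notation env := (nat -> R).
Local Notation gt := (fun y x : R => x < y).
Local Notation nX := (count_mem letterX).
Local Notation nY := (count_mem letterY).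

Lemma iterc_ext l (f g : env -> R[i]) e :
  (forall e', (forall k, k \notin l -> e' k = e k) -> f e' = g e') ->
  iterc l f e = iterc l g e.
Proof.
elim: l e => [|i l IH] e fg /=; first exact: fg.
apply: eq_cint => t _; apply: IH => e' e'E; apply: fg => k.
rewrite inE negb_or => /andP[ki kl]; rewrite e'E// /upd.
by rewrite (negbTE ki).
Qed.

Lemma itere_ext l (F G : env -> \bar R) e :
  (forall e', (forall k, k \notin l -> e' k = e k) -> F e' = G e') ->
  itere l F e = itere l G e.
Proof.
elim: l e => [|i l IH] e fg /=; first exact: fg.
apply: eq_integral => t _; apply: IH => e' e'E; apply: fg => k.
rewrite inE negb_or => /andP[ki kl]; rewrite e'E// /upd.
by rewrite (negbTE ki).
Qed.

Lemma integral_below (g : R -> R) t : measurable_fun [set: R] g ->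
  (\int[mu]_s (if (s < t)%R then g s else 0%R)%:E = \int[mu]_(s in `]-oo, t]) (g s)%:E)%E.
Proof.
move=> mg; have mE : measurable_fun `]-oo, t[ (EFin \o g).
  by apply/measurable_EFinP; exact: measurable_funTS.
rewrite -(@integral_itv_bndo_bndc _ -oo%O t (EFin \o g) mE).
rewrite [RHS]integral_mkcond; apply: eq_integral => s _; rewrite patchE.
by rewrite mem_setE in_itv /=; case: ifP.
Qed.

Lemma cint_below (f : R -> R[i]) t : cmeas f ->
  cint [set: R] (fun s => if s < t then f s else 0) = cint `]-oo, t] f.
Proof.
move=> [fr fi]; rewrite /cint /Rintegral.
have E (p : R[i] -> R) : p 0 = 0 -> measurable_fun [set: R] (fun s => p (f s)) ->
    (\int[mu]_s (p (if s < t then f s else 0%R))%:E =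
     \int[mu]_(s in `]-oo, t]) (p (f s))%:E)%E.
  by move=> p0 mp; rewrite -(integral_below t mp); apply: eq_integral => s _; case: ifP; rewrite ?p0.
by rewrite (E (@complex.Re R))// (E (@complex.Im R)).
Qed.

Section Chain.
Variables (q aX aY : R -> R[i]) (w M : R).
Hypotheses (hq : sqint q) (w0 : 0 < w) (mX : cmeas aX) (mY : cmeas aY).
Hypothesis absX : forall s, cabs (aX s) = cabs (q s) * expR (2 * w * s).
Hypothesis absY : forall s, cabs (aY s) = cabs (q s) * expR (- (2 * w) * s).
Hypotheses (M0 : 0 <= M) (mM : forall t, wavg q w t <= M).
Local Notation J := (word_fun aX aY).
Local Notation let_fun l := (if l then aX else aY).

Lemma cintb_letterY v : excess_pos v -> nX v = (nY v).+1 ->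
  cintb [set: R] (fun s => aY s * J v s).
Proof.
move=> pv Xv; have vn : v != [::] by case: (v) Xv.
have [mJ [C C0 JC]] := (word_fun_bound hq w0 mX mY absX absY M0 mM pv).1 vn.
have dv : word_deg v = 0%N by rewrite /word_deg Xv subSnn.
have JC' s : cabs (J v s) <= C * wprim q w s.
  by rewrite (le_trans (JC s))// dv mulr0 mul0r expR0 mulr1.
by case: (cint_Y_lin hq w0 mY absY C0 mJ JC' (measurableT : mble setT)).
Qed.

Implicit Type z : seq (bool * nat).
Local Notation wd z := [seq x.1 | x <- z].
Local Notation ix z := [seq x.2 | x <- z].

Definition letter_prod z (e : env) : R[i] := \prod_(x <- z) (let_fun x.1) (e x.2).

(** Integrand over chains descending from [t]. The constant [c] is kept general for the induction:
    peeling off a letter moves its factor into [c], and its variable becomes the new upper bound. *)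
Definition below_fun (c : R[i]) (t : R) z (e : env) : R[i] :=
  if path gt t [seq e x.2 | x <- z] then c * letter_prod z e else 0.

Definition sorted_fun (c : R[i]) z (e : env) : R[i] :=
  if sorted gt [seq e x.2 | x <- z] then c * letter_prod z e else 0.

Lemma below_fun_cons c t l i z e : below_fun c t ((l, i) :: z) e =
  below_fun (if e i < t then c * (let_fun l) (e i) else 0) (e i) z e.
Proof.
rewrite /below_fun /letter_prod big_cons /= mulrA.
by case: ltP => //= _; rewrite mul0r if_same.
Qed.

Lemma sorted_fun_cons c l i z e : sorted_fun c ((l, i) :: z) e =
  below_fun (c * (let_fun l) (e i)) (e i) z e.
Proof. by rewrite /sorted_fun /below_fun /letter_prod big_cons /= mulrA. Qed.

Lemma upd_outside (e : env) i s z (e' : env) : i \notin ix z ->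
  (forall k, k \notin ix z -> e' k = upd e i s k) -> e' i = s.
Proof. by move=> iz /(_ i iz) ->; rewrite /upd eqxx. Qed.

Lemma cmeas_word l v : excess_pos (l :: v) -> cmeas (fun s => (let_fun l) s * J v s).
Proof.
by move=> plv; case: (cintb_word hq w0 mX mY absX absY M0 mM 0 plv).
Qed.

Lemma iterc_below z : excess_pos (wd z) -> uniq (ix z) -> forall c t e,
  iterc (ix z) (below_fun c t z) e = c * J (wd z) t.
Proof.
elim: z => [_ _ c t e|[l i] z IH pz /andP[iz uz] c t e].
  by rewrite /= /below_fun /letter_prod big_nil.
have pz' : excess_pos (wd z) by case/andP: pz.
transitivity (cint [set: R] (fun s => if s < t then c * ((let_fun l) s * J (wd z) s) else 0)).
  apply: eq_cint => s _.
  rewrite (_ : (if _ then _ else _) = (if s < t then c * (let_fun l) s else 0) * J (wd z) s).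
    rewrite -(IH pz' uz _ s (upd e i s)); apply: iterc_ext => e' He'.
    by rewrite below_fun_cons (upd_outside iz He').
  by case: ifP; rewrite ?mul0r ?mulrA.
rewrite cint_below; last by apply: cmeasZ; exact: cmeas_word pz.
by rewrite cintZ//; exact: (cintb_word hq w0 mX mY absX absY M0 mM).
Qed.

Lemma iterc_sorted c i z e : uniq (i :: ix z) ->
  excess_pos (wd z) -> nX (wd z) = (nY (wd z)).+1 ->
  iterc (i :: ix z) (sorted_fun c ((letterY, i) :: z)) e =
  c * cint [set: R] (fun s => aY s * J (wd z) s).
Proof.
move=> /andP[iz uz] pz Xz; rewrite -cintZ//; last exact: cintb_letterY.
apply: eq_cint => s _; rewrite mulrA -(iterc_below pz uz _ s (upd e i s)).
apply: iterc_ext => e' He'; rewrite sorted_fun_cons.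
by rewrite (upd_outside iz He').
Qed.

End Chain.

End ChainIntegrals.

(** * Absolute convergence of the chain integrals *)

Section ChainFinite.
Context {R : realType}.
Local Notation mu := (@lebesgue_measure R).
Local Notation mble := (@measurable _ (measurableTypeR R)).
Local Notation env := (nat -> R).
Local Notation gt := (fun y x : R => x < y).
Local Notation nX := (count_mem letterX).
Local Notation nY := (count_mem letterY).
Variables (q aX aY : R -> R[i]) (w M : R).
Hypotheses (hq : sqint q) (w0 : 0 < w) (mX : cmeas aX) (mY : cmeas aY).
Hypothesis absX : forall s, cabs (aX s) = cabs (q s) * expR (2 * w * s).
Hypothesis absY : forall s, cabs (aY s) = cabs (q s) * expR (- (2 * w) * s).
Hypotheses (M0 : 0 <= M) (mM : forall t, wavg q w t <= M).
Local Notation rX := (fun s => (cabs (aX s))%:C%C).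
Local Notation rY := (fun s => (cabs (aY s))%:C%C).
Local Notation J := (word_fun rX rY).
Local Notation let_fun l := (if l then aX else aY).
Local Notation wd z := [seq x.1 | x <- z].
Local Notation ix z := [seq x.2 | x <- z].

Let mrX : cmeas rX. Proof. by apply: cmeas_real; exact: measurable_cabs. Qed.
Let mrY : cmeas rY. Proof. by apply: cmeas_real; exact: measurable_cabs. Qed.
Let absrX s : cabs (rX s) = cabs (q s) * expR (2 * w * s).
Proof. by rewrite cabsR ger0_norm ?cabs_ge0. Qed.
Let absrY s : cabs (rY s) = cabs (q s) * expR (- (2 * w) * s).
Proof. by rewrite cabsR ger0_norm ?cabs_ge0. Qed.

Lemma abs_letter l s : cabs ((if l then rX else rY) s) = cabs ((let_fun l) s).
Proof. by case: l; rewrite cabsR ger0_norm ?cabs_ge0. Qed.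

Lemma abs_word_integrable l v t : excess_pos (l :: v) ->
  mu.-integrable `]-oo, t] (EFin \o (fun s => cabs ((let_fun l) s) * cabs (J v s))).
Proof.
move=> plv; have [_] := cintb_word hq w0 mrX mrY absrX absrY M0 mM t plv.
by congr (integrable _ _ (_ \o _)); apply/funext => s; rewrite cabsM abs_letter.
Qed.

Lemma word_fun_real v t : excess_pos v -> J v t = (cabs (J v t))%:C%C.
Proof.
elim: v t => [|l v IH] t plv; first by rewrite /= cabs1.
have pv : excess_pos v by case/andP: plv.
have E : J (l :: v) t = (\int[mu]_(s in `]-oo, t]) (cabs ((let_fun l) s) * cabs (J v s)))%:C%C.
  rewrite -(cint_real (abs_word_integrable t plv)) /=.
  by apply: eq_cint => s _; rewrite [word_fun _ _ v s]IH//; case: (l); rewrite cabsR ger0_norm ?cabs_ge0// -rmorphM.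
rewrite {2}E cabsR ger0_norm -?E// Rintegral_ge0// => s _.
by rewrite mulr_ge0 ?cabs_ge0.
Qed.

Lemma word_fun_realS l v t : excess_pos (l :: v) ->
  cabs (J (l :: v) t) = \int[mu]_(s in `]-oo, t]) (cabs ((let_fun l) s) * cabs (J v s)).
Proof.
move=> plv; have pv : excess_pos v by case/andP: plv.
rewrite [J _ _](_ : _ =
    (\int[mu]_(s in `]-oo, t]) (cabs ((let_fun l) s) * cabs (J v s)))%:C%C).
  rewrite cabsR ger0_norm// Rintegral_ge0// => s _.
  by rewrite mulr_ge0 ?cabs_ge0.
rewrite -(cint_real (abs_word_integrable t plv)) /=.
by apply: eq_cint => s _; rewrite [word_fun _ _ v s]word_fun_real//; case: (l); rewrite cabsR ger0_norm ?cabs_ge0// -rmorphM.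
Qed.

(** The estimates on word functions involve the letters only through their moduli, so they hold
    verbatim for the letters [rX] and [rY]. The integral of the modulus is thus itself a word
    function, hence finite. *)
Lemma itere_below z : excess_pos (wd z) -> uniq (ix z) -> forall c t e,
  itere (ix z) (fun e => (cabs (below_fun aX aY c t z e))%:E) e =
  (cabs c * cabs (J (wd z) t))%:E.
Proof.
elim: z => [_ _ c t e|[l i] z IH pz /andP[iz uz] c t e].
  by rewrite /= /below_fun /letter_prod big_nil cabsM.
have pz' : excess_pos (wd z) by case/andP: pz.
pose g s := cabs c * (cabs ((let_fun l) s) * cabs (J (wd z) s)).
transitivity (\int[mu]_s (if (s < t)%R then g s else 0%R)%:E)%E.
  apply: eq_integral => s _.
  rewrite (_ : (if _ then _ else _) =
      cabs (if s < t then c * (let_fun l) s else 0) * cabs (J (wd z) s)); last first.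
    by rewrite /g; case: ifP; rewrite ?cabs0 ?mul0r ?cabsM ?mulrA.
  rewrite -(IH pz' uz _ s (upd e i s)); apply: itere_ext => e' He'.
  by rewrite below_fun_cons (upd_outside iz He').
have jg := abs_word_integrable t pz.
have mg : measurable_fun [set: R] g.
  have [mJ _] := cintb_word hq w0 mrX mrY absrX absrY M0 mM t pz.
  rewrite /g; apply: measurable_funM => //.
  rewrite (_ : (fun _ => _) = fun s => cabs ((if l then rX else rY) s * J (wd z) s)).
    exact: measurable_cabs.
  by apply/funext => s; rewrite cabsM abs_letter.
rewrite integral_below// [word_fun _ _ _ _]/(J (l :: wd z) t) word_fun_realS//.
rewrite -RintegralZl// /Rintegral fineK//.
apply: integrable_fin_num => //.
by have := integrableZl (measurable_itv _ : mble `]-oo, t]) (cabs c) jg.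
Qed.

Lemma itere_sorted c i z e : uniq (i :: ix z) ->
  excess_pos (wd z) -> nX (wd z) = (nY (wd z)).+1 ->
  (itere (i :: ix z)
    (fun e => (cabs (sorted_fun aX aY c ((letterY, i) :: z) e))%:E) e < +oo)%E.
Proof.
move=> /andP[iz uz] pz Xz.
rewrite (_ : itere _ _ _ = (\int[mu]_s (cabs c * cabs (rY s * J (wd z) s))%:E)%E).
  have [_ jJ] := cintb_letterY hq w0 mrX mrY absrX absrY M0 mM pz Xz.
  have jcJ := integrableZl (measurableT : mble setT) (cabs c) jJ.
  by have /fin_numPlt/andP[] := integrable_fin_num (measurableT : mble setT) jcJ.
apply: eq_integral => s _; rewrite cabsM (abs_letter letterY) mulrA -cabsM.
rewrite -(itere_below pz uz _ s (upd e i s)).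
apply: itere_ext => e' He'; rewrite sorted_fun_cons.
by rewrite (upd_outside iz He').
Qed.

Lemma measurable_path d (T : measurableType d) (g : nat -> T -> R) (h : T -> R) l :
  measurable_fun [set: T] h -> (forall i, measurable_fun [set: T] (g i)) ->
  measurable_fun [set: T] (fun x => path gt (h x) [seq g i x | i <- l]).
Proof.
move=> + mg; elim: l h => [|i l IH] h mh /=; first exact: measurable_cst.
by apply: measurable_and; [exact: measurable_fun_ltr|exact: IH].
Qed.

Lemma jmeas_sorted c z : jmeas (sorted_fun aX aY c z).
Proof.
move=> d T g mg; apply: cmeas_if; last exact: cmeas_cst.
- rewrite (_ : (fun x => _) = fun x => sorted gt [seq g i x | i <- ix z]).
    case: (ix z) => [|i l] /=; first exact: measurable_cst.
    exact: measurable_path.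
  by apply/funext => x; rewrite -map_comp.
- apply: cmeasZ; apply: cmeas_prod => x.
  by apply: cmeas_comp => //; case: x => -[].
Qed.

End ChainFinite.

(** * Word integrals and connected words *)

Section Listing.
Local Notation nX := (count_mem letterX).
Local Notation nY := (count_mem letterY).

Lemma map_listing (T U : Type) (h : T -> U) x y w :
  [seq h t | t <- listing x y w] = listing (h \o x) (h \o y) w.
Proof. by rewrite /listing -map_comp; apply: eq_map => i /=; case: ifP. Qed.

Lemma listing_rcons (T : Type) (x y : nat -> T) w l :
  listing x y (rcons w l) = rcons (listing x y w) (if l then x (nX w) else y (nY w)).
Proof.
rewrite /listing size_rcons -[(size w).+1]addn1 iotaD map_cat /= add0n cats1.
rewrite nth_rcons ltnn eqxx -[rcons w l]cats1 take_size_cat//; congr rcons.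
apply/eq_in_map => i; rewrite mem_iota add0n => /andP[_ iw].
by rewrite nth_cat iw !takel_cat ?(ltnW iw).
Qed.

Lemma perm_listing (T : eqType) (x y : nat -> T) w : perm_eq (listing x y w)
  ([seq x k | k <- iota 0 (nX w)] ++ [seq y k | k <- iota 0 (nY w)]).
Proof.
elim/last_ind: w => // w l IH; rewrite listing_rcons perm_rcons -cats1 !count_cat /=.
case: l; rewrite /= !addn0 ?addn1.
  rewrite -[(nX w).+1]addn1 iotaD map_cat /= add0n -catA perm_sym perm_catCA /=.
  by rewrite perm_cons perm_sym.
rewrite -[(nY w).+1]addn1 iotaD map_cat /= add0n catA cats1 perm_sym perm_rcons.
by rewrite perm_cons perm_sym.
Qed.

Lemma listing_letters w : listing (fun=> letterX) (fun=> letterY) w = w.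
Proof.
rewrite /listing -[RHS](mkseq_nth letterX) /mkseq; apply: eq_map => i.
by case: (nth _ _ _).
Qed.

Lemma perm_iota_double j : perm_eq
  ([seq k.*2 | k <- iota 0 j] ++ [seq k.*2.+1 | k <- iota 0 j]) (iota 0 j.*2).
Proof.
elim: j => // j IH.
have iotaS m : iota 0 m.+1 = rcons (iota 0 m) m by rewrite -addn1 iotaD cats1.
rewrite iotaS !map_rcons doubleS !iotaS perm_sym perm_rcons perm_sym.
rewrite -rcons_cat perm_rcons perm_cons -cats1 -catA perm_catCA /= perm_sym.
by rewrite perm_rcons perm_cons perm_sym.
Qed.

(** Each letter carries the coordinate of its variable in the integration order
    $x_1,y_1,\dots,x_j,y_j$ of [word_integral]: even places for the $x$'s, odd ones for the
    $y$'s. *)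
Definition indexed_letters (w : seq bool) : seq (bool * nat) :=
  listing (fun k => (letterX, k.*2)) (fun k => (letterY, k.*2.+1)) w.

Lemma indexed_letters1 w : [seq x.1 | x <- indexed_letters w] = w.
Proof. by rewrite map_listing listing_letters. Qed.

Lemma indexed_letters2 j w : nX w = j -> nY w = j ->
  perm_eq [seq x.2 | x <- indexed_letters w] (iota 0 j.*2).
Proof.
move=> Xw Yw; rewrite map_listing (perm_trans (perm_listing _ _ _))//.
by rewrite Xw Yw perm_iota_double.
Qed.

End Listing.

Section WordIntegral.
Context {R : realType}.
Local Notation nX := (count_mem letterX).
Local Notation nY := (count_mem letterY).

(** Generalised to [k] variables already fixed, so that the induction can proceed from the outermost
    integral inwards. *)
Lemma cint_iter_prefix (G : seq R -> R[i]) n k (e : nat -> R) :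
  cint_iter n (fun v => G ([seq e i | i <- iota 0 k] ++ v)) =
  iterc (iota k n) (fun e' => G [seq e' i | i <- iota 0 (k + n)]) e.
Proof.
elim: n k e => [|n IH] k e /=; first by rewrite cats0 addn0.
apply: eq_cint => t _; rewrite addnS -addSn -IH; congr cint_iter.
apply/funext => v; congr G; rewrite -addn1 iotaD map_cat -catA /= add0n.
congr (_ ++ _); last by rewrite /upd eqxx.
apply/eq_in_map => i; rewrite mem_iota add0n /upd => /andP[_ ik].
by rewrite ltn_eqF.
Qed.

Lemma cint_iterE (G : seq R -> R[i]) n (e : nat -> R) : cint_iter n G =
  iterc (iota 0 n) (fun e' => G [seq e' i | i <- iota 0 n]) e.
Proof. exact: (cint_iter_prefix G n 0 e). Qed.

Variables (q : R -> R[i]) (lam : R[i]).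
Hypotheses (hq : sqint q) (w0 : 0 < complex.Im (lam ^+ 2)).
Local Notation aX := (potX q lam).
Local Notation aY := (potY q lam).

(** Reversing the listing puts the largest variable first, as in the chain integrals; the phases of
    $a_Y(y_k)$ and $a_X(x_k)$ multiply to $e^{2i\lambda^2(y_k-x_k)}$. *)
Lemma word_integral_sorted j w (e : nat -> R) : nX w = j -> nY w = j ->
  word_integral q lam j w = (-1) ^+ j *
    iterc (iota 0 j.*2) (sorted_fun aX aY (lam ^+ j.*2) (rev (indexed_letters w))) e.
Proof.
move=> Xw Yw; rewrite /word_integral (cint_iterE _ _ e); congr (_ * _).
apply: iterc_ext => e' _ /=; set v := map _ _.
have nthv i : (i < j.*2)%N -> v`_i = e' i.
  by move=> ij; rewrite (nth_map 0%N) ?size_iota// nth_iota.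
have lE : listing (fun k => v`_(k.*2)) (fun k => v`_(k.*2.+1)) w =
    [seq e' x.2 | x <- indexed_letters w].
  transitivity [seq v`_(x.2) | x <- indexed_letters w]; first by rewrite map_listing.
  apply/eq_in_map => x xin; apply: nthv.
  have : x.2 \in [seq x.2 | x <- indexed_letters w] by exact: map_f.
  by rewrite (perm_mem (indexed_letters2 Xw Yw)) mem_iota.
rewrite lE /sorted_fun map_rev rev_sorted; congr (if _ then _ * _ else _).
rewrite /letter_prod (perm_big (indexed_letters w)) ?perm_rev//=.
rewrite (perm_big _ (perm_listing _ _ w)) /= big_cat !big_map Xw Yw /=.
rewrite -big_split /= -[iota 0 j]/(iota 0 j) -[in RHS](subn0 j) -/(index_iota 0 j).
rewrite big_mkord; apply: eq_bigr => k _.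
rewrite !nthv ?ltn_Sdouble ?ltn_double//.
rewrite /potX /potY [RHS]mulrACA -cexpD [X in X * _]mulrC; congr (_ * cexp _).
by rewrite rmorphB /=; ring.
Qed.

Variable M : R.
Hypotheses (M0 : 0 <= M) (mM : forall t, wavg q (complex.Im (lam ^+ 2)) t <= M).

Lemma word_integralE n v : v \in ric_words n ->
  word_integral q lam n.+1 (rev (letterY :: v)) =
  (-1) ^+ n.+1 * (lam ^+ n.*2.+2 * cint [set: R] (fun s => aY s * word_fun aX aY v s)).
Proof.
move=> /ric_words_count[pv Xv Yv].
set w := rev _; have Xw : nX w = n.+1 by rewrite count_rev /= Xv.
have Yw : nY w = n.+1 by rewrite count_rev /= Yv.
have pz : perm_eq [seq x.2 | x <- rev (indexed_letters w)] (iota 0 n.+1.*2).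
  by rewrite map_rev perm_rev indexed_letters2.
rewrite (word_integral_sorted (fun=> 0) Xw Yw); congr (_ * _).
have wz : [seq x.1 | x <- rev (indexed_letters w)] = letterY :: v.
  by rewrite map_rev indexed_letters1 revK.
have uz : uniq [seq x.2 | x <- rev (indexed_letters w)] by rewrite (perm_uniq pz) iota_uniq.
case: (rev (indexed_letters w)) pz wz uz => [|[l i] z] // pz [lE vE] uz; rewrite -vE in pv Xv Yv *.
rewrite lE.
have mX : cmeas aX by apply: cmeas_potX; case: hq.
have mY : cmeas aY by apply: cmeas_potY; case: hq.
have aXE := cabs_potX q lam; have aYE := cabs_potY q lam.
have XY : nX [seq x.1 | x <- z] = (nY [seq x.1 | x <- z]).+1 by rewrite Xv Yv.
(* The only use of Fubini: from the order $x_1,y_1,x_2,\dots$ to the order prescribed by the word,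
   largest variable outermost. Absolute convergence is the second goal. *)
rewrite -(@iterc_perm _ _ (jmeas_sorted mX mY _ _) _ _ _ uz pz).
  exact: (iterc_sorted hq w0 mX mY aXE aYE M0 mM).
exact: (itere_sorted hq w0 mX mY aXE aYE M0 mM).
Qed.

End WordIntegral.

(** * From strict excess of X to connected words *)

Section ConnectedWords.
Local Notation nX := (count_mem letterX).
Local Notation nY := (count_mem letterY).

Definition positions (a : bool) (w : seq bool) : seq nat :=
  [seq i <- iota 0 (size w) | nth letterX w i == a].

Lemma positions_rcons a w l :
  positions a (rcons w l) = positions a w ++ (if l == a then [:: size w] else [::]).
Proof.
rewrite /positions size_rcons -[(size w).+1]addn1 iotaD filter_cat /= add0n.
rewrite nth_rcons ltnn eqxx; congr (_ ++ _).
by apply: eq_in_filter => i; rewrite mem_iota nth_rcons => /andP[_ ->].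
Qed.

Lemma size_positions a w : size (positions a w) = count_mem a w.
Proof.
elim/last_ind: w => // w l IH; rewrite positions_rcons size_cat IH -cats1 count_cat /=.
by case: eqP.
Qed.

Lemma nth_positions a w k d : (k < count_mem a w)%N ->
  [/\ (nth d (positions a w) k < size w)%N, nth letterX w (nth d (positions a w) k) = a &
      count_mem a (take (nth d (positions a w) k) w) = k].
Proof.
elim/last_ind: w => // w l IH; rewrite positions_rcons -cats1 count_cat /= addn0 => kw.
rewrite size_cat /= addn1 nth_cat size_positions; have [kw'|kw'] := ltnP k (count_mem a w).
  have [i1 i2 i3] := IH kw'; rewrite nth_cat i1 takel_cat ?(ltnW i1)//.
  by split => //; rewrite ltnW.
move: kw; case: eqP => [la|_] /= kw; last by rewrite addn0 ltnNge kw' in kw.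
have -> : k = count_mem a w by apply/eqP; rewrite addn1 ltnS in kw; rewrite eqn_leq kw' kw.
by rewrite subnn /= take_size_cat// nth_cat ltnn subnn; split.
Qed.

Lemma occP a w k : (k < count_mem a w)%N ->
  [/\ (occ a w k < size w)%N, nth letterX w (occ a w k) = a &
      count_mem a (take (occ a w k) w) = k].
Proof. exact: nth_positions. Qed.

Lemma excess_pos_take v m : excess_pos v -> (0 < m <= size v)%N ->
  (nY (take m (rev v)) < nX (take m (rev v)))%N.
Proof.
elim: v m => [|l v IH] m pv /andP[m0 mv]; first by move: m0 mv; case: m.
rewrite rev_cons; have [mv'|vm] := leqP m (size v).
  rewrite -cats1 takel_cat ?size_rev//; apply: IH; last by rewrite m0.
  by case/andP: pv.
rewrite take_oversize ?size_rcons ?size_rev// -rev_cons !count_rev.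
by case/andP: pv.
Qed.

(** Every proper nonempty prefix has strictly more X's than Y's, so the balance first returns to
    zero at the very end. The opening X, necessarily at position 0, is therefore paired with the
    final Y, at position $2n+1$. *)
Lemma connected_ric n v : v \in ric_words n ->
  connected_word n.+1 (rev (letterY :: v)).
Proof.
move=> /ric_words_count[pv Xv Yv].
have pre m := @excess_pos_take v m pv.
have sv : size v = n.*2.+1.
  by rewrite -(count_predC (pred1 letterX)) Xv (eq_count (a2 := pred1 letterY)) ?Yv; [lia|case].
pose w := rcons (rev v) letterY.
have sw : size w = n.*2.+2 by rewrite size_rcons size_rev sv.
have Xw : nX w = n.+1 by rewrite /w -cats1 count_cat count_rev Xv addn0.
have Yw : nY w = n.+1 by rewrite /w -cats1 count_cat count_rev Yv addn1.
have prew m : (0 < m <= n.*2.+1)%N -> (nY (take m w) < nX (take m w))%N.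
  by move=> /andP[m0 mn]; rewrite /w -cats1 takel_cat ?size_rev ?sv//; apply: pre; rewrite m0 sv.
have takeS i a : (i < size w)%N ->
    count_mem a (take i.+1 w) = (count_mem a (take i w) + (nth letterX w i == a))%N.
  by move=> iw; rewrite (take_nth letterX)// -cats1 count_cat /= addn0.
have mono a i k : (i <= k)%N -> (count_mem a (take i w) <= count_mem a (take k w))%N.
  by move=> ik; rewrite -(subnKC ik) takeD count_cat leq_addr.
have weak m : (nY (take m w) <= nX (take m w))%N.
  case: m => [|m]; first by rewrite take0.
  have [mn|mn] := leqP m.+1 n.*2.+1; first by apply/ltnW/prew.
  by rewrite take_oversize ?Xw ?Yw// sw.
rewrite rev_cons -/w /connected_word; apply/andP; split.
  rewrite /admissible Xw Yw !eqxx !andTb; apply/allP => k; rewrite mem_iota => /andP[_ kn].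
  have [x1 x2 x3] : [/\ (occ letterX w k < size w)%N, nth letterX w (occ letterX w k) = letterX &
      nX (take (occ letterX w k) w) = k] by apply: occP; rewrite Xw.
  have [y1 y2 y3] : [/\ (occ letterY w k < size w)%N, nth letterX w (occ letterY w k) = letterY &
      nY (take (occ letterY w k) w) = k] by apply: occP; rewrite Yw.
  (* Were the Y of index [k] at or before the X of the same index, the prefix ending with it would
     hold $k+1$ Y's and at most $k$ X's. *)
  rewrite ltnNge; apply/negP => yx.
  have := mono letterX _ _ yx; rewrite x3.
  have := takeS _ letterX y1; have := takeS _ letterY y1; rewrite y2 y3 /= addn0 addn1.
  move: (occ letterY w k) y1 yx => i y1 yx Y1 X1 X2.
  by have := weak i.+1; rewrite Y1 X1; move: X2; clear; lia.
have [x1 x2 x3] : [/\ (occ letterX w 0 < size w)%N, nth letterX w (occ letterX w 0) = letterX &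
    nX (take (occ letterX w 0) w) = 0%N] by apply: occP; rewrite Xw.
have [y1 y2 y3] : [/\ (occ letterY w n < size w)%N, nth letterX w (occ letterY w n) = letterY &
    nY (take (occ letterY w n) w) = n] by apply: occP; rewrite Yw.
have -> : occ letterX w 0 = 0%N.
  move: (occ letterX w 0) x1 x3 => i x1 x3; case: (posnP i) => // i0.
  by have := prew i; rewrite x3 i0 ltn0; move: x1; rewrite sw ltnS => -> /(_ isT).
have -> : occ letterY w n = n.*2.+1.
  move: (occ letterY w n) y1 y2 y3 => i y1 y2 y3.
  have := takeS _ letterY y1; have := takeS _ letterX y1; rewrite y2 y3 /= addn0 addn1 => X1 Y1.
  have Xle : (nX (take i.+1 w) <= n.+1)%N by have := mono letterX i.+1 (size w) y1; rewrite take_size Xw.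
  (* If the last Y came earlier, a proper prefix would contain all $n+1$ Y's, while there are only
     $n+1$ X's in all, contradicting strictness. *)
  apply/eqP; rewrite eqn_leq; move: (y1); rewrite sw ltnS => -> /=; rewrite leqNgt; apply/negP => iN.
  by have := prew i.+1 iN; rewrite Y1; move: Xle; lia.
rewrite /paired sw ltnSn /=.
have w0 : nth letterX w 0 = letterX.
  have := prew 1%N isT; have := takeS 0%N letterX; have := takeS 0%N letterY.
  rewrite sw take0 /= => /(_ isT) -> /(_ isT) ->.
  by case: (nth _ _ _).
have [u uE] : exists u, rev v = letterX :: u.
  move: w0 (size_rev v); rewrite /w sv; case: (rev v) => // x u /= -> _.
  by exists u.
have su : size u = n.*2 by have := size_rev v; rewrite uE sv => -[].
have wE : w = letterX :: rcons u letterY by rewrite /w uE.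
rewrite {1 2 3}wE /= nth_rcons su ltnn eqxx /=.
(* Deleting the opening X lowers its count by one in every prefix, which turns the strict excess
   into the weak inequality of [balanced]. *)
rewrite drop0 -cats1 -su take_size_cat//; apply/andP; split.
  apply/allP => m; rewrite mem_iota add0n => /andP[_ mu].
  have := prew m.+1; rewrite wE /= -cats1 takel_cat ?(ltnW mu)// ltnS -su => /(_ (ltnW mu)).
  by rewrite /= add0n add1n ltnS.
move: Xw Yw; rewrite wE -cats1 /= !count_cat /= !addn0 !add0n add1n addn1.
by move=> -[->] [->].
Qed.

End ConnectedWords.

Section WordExpansion.
Context {R : realType}.

Lemma log_coef_words (q : R -> R[i]) (lam : R[i]) n : sqint q ->
  0 < complex.Im (lam ^+ 2) ->
  log_coef q lam n = \sum_(v <- ric_words n)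
    - (-1) ^+ n.+1 * word_integral q lam n.+1 (rev (letterY :: v)).
Proof.
move=> hq w0; pose M := Num.sqrt (sqn q / (2 * complex.Im (lam ^+ 2))).
have M0 : 0 <= M by exact: sqrtr_ge0.
have mM t : wavg q (complex.Im (lam ^+ 2)) t <= M.
  by rewrite -[leLHS](ger0_norm (wavg_ge0 _ _ _)) -sqrtr_sqr ler_wsqrtr// wavg_bound.
have mX : cmeas (potX q lam) by apply: cmeas_potX; case: hq.
have mY : cmeas (potY q lam) by apply: cmeas_potY; case: hq.
have aXE := cabs_potX q lam; have aYE := cabs_potY q lam.
have wf v : v \in ric_words n ->
    cintb [set: R] (fun s => potY q lam s * word_fun (potX q lam) (potY q lam) v s).
  move=> /ric_words_count[pv Xv Yv].
  by apply: (cintb_letterY hq w0 mX mY aXE aYE M0 mM pv); rewrite Xv Yv.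
transitivity (\sum_(v <- ric_words n) - lam ^+ n.*2.+2 *
    cint [set: R] (fun s => potY q lam s * word_fun (potX q lam) (potY q lam) v s)).
  rewrite -mulr_sumr /log_coef; congr (_ * _).
  transitivity (cint [set: R] (fun s => \sum_(v <- ric_words n)
      potY q lam s * word_fun (potX q lam) (potY q lam) v s)).
    apply: eq_cint => s _; rewrite (ric_word_fun hq w0 mX mY aXE aYE M0 mM).
    by rewrite mulr_sumr.
  elim: (ric_words n) wf => [_|v s IH wf].
    by rewrite big_nil -[RHS](cint0 [set: R]); apply: eq_cint => s _; rewrite big_nil.
  have wfs u : u \in s -> cintb [set: R]
      (fun t => potY q lam t * word_fun (potX q lam) (potY q lam) u t).
    by move=> us; apply: wf; rewrite inE us orbT.
  have wfS : cintb [set: R] (fun t => \sum_(u <- s)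
      potY q lam t * word_fun (potX q lam) (potY q lam) u t).
    elim: s wfs {IH wf} => [_|u s IHs wfs].
      by apply: (@cintb_ext _ _ (fun=> 0)) => [t|]; [rewrite big_nil|exact: cintb0].
    apply: (@cintb_ext _ _ (fun t =>
        potY q lam t * word_fun (potX q lam) (potY q lam) u t +
        \sum_(z <- s) potY q lam t * word_fun (potX q lam) (potY q lam) z t)).
      by move=> t; rewrite big_cons.
    apply: cintbD => //; first by apply: wfs; exact: mem_head.
    by apply: IHs => z zs; apply: wfs; rewrite inE zs orbT.
  rewrite big_cons -(IH wfs) -cintD//; last by apply: wf; exact: mem_head.
  by apply: eq_cint => t _; rewrite big_cons.
rewrite big_seq [RHS]big_seq; apply: eq_bigr => v vin.
rewrite (word_integralE hq w0 M0 mM vin) [RHS]mulrA mulNr -expr2 -exprM mulnC exprM sqrrN.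
by rewrite expr1n expr1n !mulNr mul1r.
Qed.

(** Minus the multiplicity of the word, times $(-1)^j$ to undo the sign built into [word_integral].
    It depends on the word alone, so one linear combination serves all $q$ and $\lambda$. *)
Definition word_coef j (w : (j.*2).-tuple bool) : R[i] :=
  - (-1) ^+ j * (count_mem (w : seq bool) [seq rev (letterY :: v) | v <- ric_words j.-1])%:R.

Lemma b_hom_connected (q : R -> R[i]) (lam : R[i]) j : (0 < j)%N -> sqint q ->
  0 < complex.Im (lam ^+ 2) -> b_hom q lam j =
    \sum_(w : (j.*2).-tuple bool | connected_word j w)
      word_coef w * word_integral q lam j w.
Proof.
case: j => // n _ hq w0; rewrite b_homE// log_coef_words// /word_coef /=.
rewrite big_seq; set f := word_integral q lam n.+1.
have conn v : v \in ric_words n -> connected_word n.+1 (rev (letterY :: v)).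
  exact: connected_ric.
have szv v : v \in ric_words n -> size (rev (letterY :: v)) == n.+1.*2.
  move=> vin; have /andP[/and3P[/eqP X /eqP Y _] _] := conn v vin.
  rewrite -(count_predC (pred1 letterX)) X (eq_count (a2 := pred1 letterY)); last by case.
  by rewrite Y addnn.
rewrite -big_seq.
elim: (ric_words n) conn szv => [_ _|v s IH conn szv].
  rewrite big_nil big1// => w _; by rewrite /= mulr0 mul0r.
rewrite big_cons IH; last 2 first.
  by move=> u us; apply: conn; rewrite inE us orbT.
  by move=> u us; apply: szv; rewrite inE us orbT.
have vS := mem_head v s; pose wv : n.+1.*2.-tuple bool := Tuple (szv v vS).
rewrite [RHS](bigD1 wv)/=; last exact: conn.
rewrite (bigD1 wv)/=; last exact: conn.
rewrite eqxx natrD mulrDr mulr1 [in RHS]mulrDl addrA; congr (_ + _).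
apply: eq_bigr => w /andP[_ wn]; rewrite (_ : (rev (letterY :: v) == w) = false) ?add0n//.
by apply: contra_neqF wn => /eqP E; apply: val_inj.
Qed.

End WordExpansion.

(** * Exponential mollifiers *)

Section Mollifier.
Context {R : realType}.
Local Notation mu := (@lebesgue_measure R).
Local Notation mble := (@measurable _ (measurableTypeR R)).
Local Notation ex c s := ((expR (c * s))%:C%C).

(** Convolution with the one-sided kernel $2we^{-2ws}$, $s>0$, of mass one. It solves $g'=2w(p-g)$,
    so its derivative is controlled by the very defect that is to be small. *)
Definition moll (p : R -> R[i]) (w t : R) : R[i] :=
  (2 * w * expR (- (2 * w) * t))%:C%C * cint `]-oo, t] (fun s => p s * ex (2 * w) s).

Variable p : R -> R[i].
Hypothesis hp : sqint p.

Lemma cintb_weighted w t : 0 < w -> cintb `]-oo, t] (fun s => p s * ex (2 * w) s).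
Proof.
move=> w0; split.
  apply: cmeasM; first by case: hp.
  by apply: cmeas_real; exact: measurable_expRM.
rewrite (_ : (fun x => _) = (fun s => cabs (p s) * expR (2 * w * s))).
  exact: wprim_integrable.
by apply/funext => s; rewrite cabsM cabsR ger0_norm ?expR_ge0.
Qed.

Lemma cabs_cint_weighted w t : 0 < w ->
  cabs (cint `]-oo, t] (fun s => p s * ex (2 * w) s)) <= wprim p w t.
Proof.
move=> w0; apply: cabs_cint_le => //.
- by case: (cintb_weighted 0 w0).
- exact: wprim_integrable.
- by move=> s _; rewrite cabsM cabsR ger0_norm ?expR_ge0.
Qed.

Lemma cabs_moll w t : 0 < w -> cabs (moll p w t) <= 2 * w * wavg p w t.
Proof.
move=> w0; have w20 : 0 <= 2 * w by rewrite mulr_ge0 ?ltW.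
rewrite cabsM cabsR ger0_norm; last by rewrite mulr_ge0 ?expR_ge0.
rewrite /wavg [leRHS]mulrA ler_wpM2l ?cabs_cint_weighted//.
exact: mulr_ge0 w20 (expR_ge0 _).
Qed.

Lemma prim_weighted w : 0 < w ->
  prim (fun t => cint `]-oo, t] (fun s => p s * ex (2 * w) s)) (fun s => p s * ex (2 * w) s).
Proof. by move=> w0; apply: primNy => t; exact: cintb_weighted. Qed.

Lemma prim_moll w : 0 < w ->
  prim (moll p w) (fun t => (2 * w)%:C%C * (p t - moll p w t)).
Proof.
move=> w0; have := primZ (2 * w)%:C%C (primM (prim_expR (- (2 * w))) (prim_weighted w0)).
rewrite (_ : (fun x => _) = moll p w); last first.
  by apply/funext => t; rewrite /moll mulrA -rmorphM.
move=> /prim_eq; apply => t; congr (_ * _); rewrite addrC mulrCA -rmorphM -expRD.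
rewrite -mulrDl addNr mul0r expR0 mulr1; congr (_ + _).
by rewrite /moll [- (2 * w) * expR _]mulNr rmorphN [LHS]mulNr.
Qed.

Lemma cmeas_moll w : 0 < w -> cmeas (moll p w).
Proof. by move=> w0; exact: prim_cmeas (prim_moll w0). Qed.

Lemma sqint_moll w : 0 < w -> sqint (moll p w) /\ sqn (moll p w) <= sqn p.
Proof.
move=> w0; have [jm Im] := wavg_L2 hp w0; have mm := cmeas_moll w0.
have jd : mu.-integrable [set: R] (EFin \o (fun t => (2 * w) ^+ 2 * wavg p w t ^+ 2)).
  by have := integrableZl (measurableT : mble setT) ((2 * w) ^+ 2) jm.
have le t : cabs (moll p w t) ^+ 2 <= (2 * w) ^+ 2 * wavg p w t ^+ 2.
  rewrite -exprMn ler_pXn2r ?nnegrE ?cabs_ge0 ?cabs_moll//.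
  exact: mulr_ge0 (mulr_ge0 (ler0n _ 2) (ltW w0)) (wavg_ge0 _ _ _).
have js : mu.-integrable [set: R] (EFin \o (fun t => cabs (moll p w t) ^+ 2)).
  apply: (le_integrable _ _ _ jd) => //.
    by apply/measurable_EFinP; apply: measurable_funX; exact: measurable_cabs.
  move=> t _ /=; rewrite lee_fin !ger0_norm ?exprn_ge0 ?cabs_ge0//.
  exact: mulr_ge0 (sqr_ge0 _) (sqr_ge0 _).
split; first by split.
rewrite /sqn (le_trans (le_Rintegral _ js jd _))//.
rewrite RintegralZl// (le_trans (ler_wpM2l (sqr_ge0 _) Im))//.
rewrite le_eqVlt; apply/orP; left; apply/eqP; rewrite /sqn; field.
by rewrite lt0r_neq0.
Qed.


(** Near $-\infty$ the function [p] need not be integrable, whereas [h], with its weight $e^{2s}$,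
    is. Its primitive [H] is to be differentiated at [t], and [D t s] is the first-order defect. *)
Local Notation h s := (p s * ex (2 * 1) s).
Local Notation H t := (cint `]-oo, t] (fun s => p s * ex (2 * 1) s)).
Local Notation D t s := (H s - H t - (s - t)%:C%C * h t).

Lemma prim_defect t : prim (fun s => D t s) (fun s => h s - h t).
Proof.
have := primB (primB (prim_weighted (ltr01 : 0 < 1 :> R)) (prim_cst (H t)))
  (primZ (h t) (primB prim_id (prim_cst t%:C%C))).
rewrite (_ : (fun s => _) = (fun s => D t s)); last first.
  by apply/funext => s; rewrite rmorphB /= [_ * h t]mulrC.
by move=> /prim_eq; apply => s; rewrite !subr0 mulr1.
Qed.

(** The part of the weight not contained in [h] is $e^{bs}$. On $[x,t]$ one writes
    $h(s)=h(t)+\partial_sD(t,s)$ and integrates by parts; the upper boundary term carries no defect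
    since $D(t,t)=0$. *)
Lemma moll_identity w t x : 1 < w -> x <= t ->
  let b := 2 * (w - 1) in
  cint `]-oo, t] (fun s => p s * ex (2 * w) s) =
  cint `]-oo, x] (fun s => p s * ex (2 * w) s) +
  (ex b t * (b^-1%:C%C * h t) - ex b x * (D t x + b^-1%:C%C * h t) -
   cint `[x, t] (fun s => (b * expR (b * s))%:C%C * D t s)).
Proof.
move=> w1 xt b; have b0 : 0 < b by rewrite mulr_gt0// subr_gt0.
have bE : 2 * w = b + 2 * 1 by rewrite /b; ring.
move: b b0 bE => b b0 bE.
have w0 : 0 < w by rewrite (lt_trans _ w1).
have pN := primM (prim_expR b) (primD (prim_defect t) (prim_cst (b^-1%:C%C * h t))).
have jD a c : cintb `[a, c] (fun s => (b * expR (b * s))%:C%C * D t s).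
  exact: (prim_mul_bounded (prim_defect t) (prim_expR b).1).
have E s : (b * expR (b * s))%:C%C * (D t s + b^-1%:C%C * h t) + ex b s * (h s - h t + 0) =
    (b * expR (b * s))%:C%C * D t s + p s * ex (2 * w) s.
  have -> : expR (2 * w * s) = expR (b * s) * expR (2 * 1 * s).
    by rewrite -expRD -mulrDl bE.
  rewrite !rmorphM fmorphV /=; move: (D t s) => d.
  by field; rewrite (inj_eq (@complexI R)) (lt0r_neq0 b0).
have := (prim_eq pN E).2 x t xt; rewrite cintD//; last first.
  exact: (prim_weighted w0).1.
rewrite -[X in _ = _ + X](cintNy_sub xt (cintb_weighted t w0)) !subrr mul0r subr0 add0r => I.
by rewrite I; ring.
Qed.

(** Half of the exponential pays for the linear factor, through $\frac b2(t-s)\le e^{b(t-s)/2}$; the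
    other half is integrated. *)
Lemma defect_integral b t x e (d : R -> R[i]) : 0 < b -> x <= t -> 0 <= e -> cmeas d ->
  (forall s, x <= s -> s <= t -> cabs (d s) <= e * (t - s)) ->
  cabs (cint `[x, t] (fun s => (b * expR (b * s))%:C%C * d s)) <= 4 * e * expR (b * t) / b.
Proof.
move=> b0 xt e0 md dE.
have b20 : 0 < b / 2 by rewrite divr_gt0.
have [jg Ig] := Rintegral_expR (lt0r_neq0 b20) xt.
have jd : mu.-integrable `[x, t] (EFin \o (fun s => 2 * e * expR (b / 2 * t) * expR (b / 2 * s))).
  by have := integrableZl (measurable_itv _ : mble `[x, t]) (2 * e * expR (b / 2 * t)) jg.
have mf : cmeas (fun s => (b * expR (b * s))%:C%C * d s).
  apply: cmeasM => //; apply: cmeas_real; apply: measurable_funM => //.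
  exact: measurable_expRM.
have le s : `[x, t]%classic s -> cabs ((b * expR (b * s))%:C%C * d s) <=
    2 * e * expR (b / 2 * t) * expR (b / 2 * s).
  rewrite /= in_itv /= => /andP[xs st].
  have be0 : 0 <= b * expR (b * s) by rewrite mulr_ge0 ?expR_ge0// ltW.
  rewrite cabsM cabsR ger0_norm// (le_trans (ler_wpM2l be0 (dE s xs st)))//.
  have -> : expR (b / 2 * t) = expR (b / 2 * s) * expR (b / 2 * (t - s)).
    by rewrite -expRD; congr expR; ring.
  have -> : expR (b * s) = expR (b / 2 * s) * expR (b / 2 * s).
    by rewrite -expRD; congr expR; field.
  have := expR_ge1Dx (b / 2 * (t - s)).
  have := expR_gt0 (b / 2 * s).
  move: (expR (b / 2 * s)) (expR (b / 2 * (t - s))) => f g f0 fg.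
  rewrite -subr_ge0 (_ : _ - _ = 2 * e * f ^+ 2 * (g - b / 2 * (t - s))); last by field.
  apply: mulr_ge0; last by rewrite subr_ge0 (le_trans _ fg)// lerDr.
  exact: mulr_ge0 (mulr_ge0 (ler0n _ 2) e0) (sqr_ge0 _).
rewrite (le_trans (cabs_cint_le _ mf jd le))// RintegralZl// Ig.
have -> : expR (b * t) = expR (b / 2 * t) * expR (b / 2 * t).
  by rewrite -expRD; congr expR; field.
move: (expR (b / 2 * t)) (expR (b / 2 * x)) (expR_ge0 (b / 2 * x)) (expR_ge0 (b / 2 * t)).
move=> f g g0 f0; rewrite -subr_ge0 (_ : _ - _ = 4 * e * f * g / b).
  by rewrite divr_ge0 ?(ltW b0)// !mulr_ge0.
by field; rewrite lt0r_neq0.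
Qed.

Lemma expRN_le1 (y : R) : 0 < y -> expR (- y) <= y^-1.
Proof.
move=> y0; rewrite expRN lef_pV2 ?posrE ?expR_gt0// (le_trans _ (expR_ge1Dx y))//.
by rewrite lerDr.
Qed.

Lemma expRN_le2 (y : R) : 0 < y -> expR (- y) <= 4 / y ^+ 2.
Proof.
move=> y0; have y20 : 0 < y / 2 by rewrite divr_gt0.
have -> : expR (- y) = expR (- (y / 2)) * expR (- (y / 2)) by rewrite -expRD; congr expR; field.
have := expRN_le1 y20; have := expR_ge0 (- (y / 2)).
move: (expR _) => f f0 fy; rewrite (_ : 4 / _ = (y / 2)^-1 * (y / 2)^-1); last first.
  by field; rewrite lt0r_neq0.
by rewrite ler_pM.
Qed.

(** For fixed [t] the error is $O(1/w)$ plus a multiple of [e]. The $1/w$ part collects the far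
    integral, the mismatch $2w/b-1=1/(w-1)$ and the boundary term in [h t]; the constant 10 is 2
    from the defect at $t-\eta$ plus 8 from its integral. The factor $e^{-2t}$ removes the weight of
    [h]. *)
Lemma moll_error w t eta e : 2 <= w -> 0 < eta -> 0 <= e ->
  (forall s, t - eta <= s -> s <= t -> cabs (D t s) <= e * (t - s)) ->
  cabs (moll p w t - p t) <=
    (2 * cabs (p t) + 4 * (1 + sqn p) / eta ^+ 2 +
       2 * expR (- 2 * t) * cabs (h t) / eta) / w + 10 * e * expR (- 2 * t).
Proof.
move=> w2 eta0 e0 De; pose x := t - eta; pose b := 2 * (w - 1).
have w1 : 1 < w by rewrite (lt_le_trans _ w2)// ltr1n.
have xt : x <= t by rewrite gerBl ltW.
have := moll_identity w1 xt; rewrite -/b /=; set J := cint `[x, t] _; set I := cint `]-oo, x] _ => E.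
have b0 : 0 < b by rewrite mulr_gt0// subr_gt0.
have wb : w <= b by rewrite /b; lra.
have w0 : 0 < w by rewrite (lt_trans _ w1).
have Jb : cabs J <= 4 * e * expR (b * t) / b.
  by apply: defect_integral => //; exact: prim_cmeas (prim_defect t).
have Ib : cabs I <= expR (2 * w * x) * (1 + sqn p).
  rewrite (le_trans (cabs_cint_weighted _ w0))// wprim_wavg ler_wpM2l ?expR_ge0//.
  have := wavg_bound hp w0 x; have := wavg_ge0 p w x.
  have : sqn p / (2 * w) <= sqn p.
    by rewrite ler_pdivrMr ?mulr_gt0// ler_peMr ?sqn_ge0//; lra.
  by move: (wavg p w x) (sqn p / (2 * w)) => m u; nra.
have Db : cabs (D t x) <= e * eta.
  by have := De x (lexx _) xt; rewrite (_ : t - x = eta)// /x; ring.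
pose c := 2 * w; pose k := expR (- c * t); pose r := expR (- 2 * t).
have k0 : 0 < k by exact: expR_gt0.
have r0 : 0 < r by exact: expR_gt0.
have c0 : 0 < c by rewrite mulr_gt0.
have kb : k * expR (b * t) = r by rewrite -expRD; congr expR; rewrite /c /b; ring.
have kcx : k * expR (2 * w * x) = expR (- (c * eta)).
  by rewrite -expRD; congr expR; rewrite /c /x; ring.
have kbx : k * expR (b * x) = r * expR (- (b * eta)).
  by rewrite -!expRD; congr expR; rewrite /b /c /x; ring.
have rp : r * expR (2 * 1 * t) = 1 by rewrite -expRD -[RHS]expR0; congr expR; ring.
have u1 := expRN_le2 (mulr_gt0 c0 eta0); have u2 := expRN_le1 (mulr_gt0 b0 eta0).
have cb : c / b <= 2 by rewrite ler_pdivrMr// /c /b; lra.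
have cb1 : `|c / b - 1| <= 2 / w.
  rewrite (_ : c / b - 1 = 2 / b); last by rewrite /c /b; field; lra.
  by rewrite ger0_norm ?divr_ge0 ?(ltW b0)// ler_wpM2l// lef_pV2 ?posrE.
have hE : (c * k)%:C%C * (ex b t * (b^-1%:C%C * h t)) = (c / b)%:C%C * p t.
  have -> : c / b = c * (k * expR (b * t) * expR (2 * 1 * t)) / b by rewrite kb rp mulr1.
  rewrite !rmorphM /=; move: (p t) (ex (2 * 1) t) (ex b t) k%:C%C c%:C%C b^-1%:C%C => z1 z2 z3 z4 z5 z6.
  by ring.
have ME : moll p w t - p t = (c * k)%:C%C * I + (c / b - 1)%:C%C * p t
    - (c * k * expR (b * x))%:C%C * (D t x + b^-1%:C%C * h t) - (c * k)%:C%C * J.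
  rewrite {1}/moll E -/c -/k [(c / b - 1)%:C%C]rmorphB rmorph1 [(_ - 1) * p t]mulrBl mul1r -hE [(c * k * _)%:C%C]rmorphM /=.
  move: (D t x) (h t) (p t) (c * k)%:C%C b^-1%:C%C (ex b t) (ex b x) => d z1 z2 z3 z4 z5 z6.
  by ring.
have bi0 : 0 <= b^-1 by rewrite invr_ge0 ltW.
have ck0 : 0 <= c * k by rewrite mulr_ge0 ?ltW.
have w1i : 0 < w^-1 by rewrite invr_gt0.
rewrite ME (le_trans (cabsB _ _))//.
have T1 : cabs ((c * k)%:C%C * I) <= 4 * (1 + sqn p) / eta ^+ 2 / w.
  rewrite cabsM cabsR ger0_norm// (le_trans (ler_wpM2l ck0 Ib))//.
  rewrite mulrA -[c * k * _]mulrA kcx.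
  have S0 : 0 <= 1 + sqn p by rewrite addr_ge0 ?sqn_ge0.
  rewrite (le_trans (ler_wpM2r S0 (ler_wpM2l (ltW c0) u1)))//.
  rewrite (_ : c * _ * _ = 4 * (1 + sqn p) / eta ^+ 2 / c); last first.
    by field; rewrite !lt0r_neq0.
  rewrite ler_wpM2l ?lef_pV2 ?posrE//; last by rewrite /c; lra.
  by rewrite divr_ge0 ?exprn_ge0 ?(ltW eta0)// mulr_ge0.
have T2 : cabs ((c / b - 1)%:C%C * p t) <= 2 * cabs (p t) / w.
  by rewrite cabsM cabsR [leRHS]mulrAC ler_wpM2r ?cabs_ge0.
have T3 : cabs ((c * k * expR (b * x))%:C%C * (D t x + b^-1%:C%C * h t)) <=
    2 * e * r + 2 * r * cabs (h t) / eta / w.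
  rewrite cabsM cabsR ger0_norm; last by rewrite mulr_ge0 ?expR_ge0.
  rewrite -[c * k * _]mulrA kbx.
  have dh : cabs (D t x + b^-1%:C%C * h t) <= e * eta + b^-1 * cabs (h t).
    rewrite (le_trans (cabsD _ _))// lerD//.
    by rewrite cabsM cabsR ger0_norm.
  have s0 : 0 <= c * (r * expR (- (b * eta))) by rewrite !mulr_ge0 ?expR_ge0 ?ltW.
  rewrite (le_trans (ler_wpM2l s0 dh))//.
  have e1 : 0 <= e * eta + b^-1 * cabs (h t) by rewrite addr_ge0 ?mulr_ge0 ?cabs_ge0 ?(ltW eta0).
  rewrite (le_trans (ler_wpM2r e1 (ler_wpM2l (ltW c0) (ler_wpM2l (ltW r0) u2))))//.
  rewrite (_ : c * _ * _ = c / b * (r * (e + cabs (h t) / eta * b^-1))); last first.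
    by field; rewrite !lt0r_neq0.
  have q0 : 0 <= r * (e + cabs (h t) / eta * b^-1).
    rewrite mulr_ge0 ?(ltW r0)// addr_ge0// mulr_ge0// divr_ge0 ?cabs_ge0 ?(ltW eta0)//.
  rewrite (le_trans (ler_wpM2r q0 cb))//.
  rewrite (_ : 2 * e * r + _ = 2 * (r * (e + cabs (h t) / eta * w^-1))); last by ring.
  rewrite ler_wpM2l// ler_wpM2l ?(ltW r0)// lerD2l ler_wpM2l ?lef_pV2 ?posrE//.
  by rewrite divr_ge0 ?cabs_ge0 ?(ltW eta0).
have T4 : cabs ((c * k)%:C%C * J) <= 8 * e * r.
  rewrite cabsM cabsR ger0_norm// (le_trans (ler_wpM2l ck0 Jb))//.
  rewrite [leLHS](_ : _ = c / b * (4 * e * (k * expR (b * t)))); last by ring.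
  rewrite kb (_ : 8 * e * r = 2 * (4 * e * r)); last by ring.
  by rewrite ler_wpM2r// !mulr_ge0// ltW.
rewrite (le_trans (lerD (le_trans (cabsB _ _) (lerD (le_trans (cabsD _ _) (lerD T1 T2)) T3)) T4))//.
by rewrite -/r !mulrDl; lra.
Qed.

End Mollifier.

(** * Almost everywhere convergence of the mollifications *)

Section Differentiation.
Context {R : realType}.
Local Notation mu := (@lebesgue_measure R).
Local Notation mble := (@measurable _ (measurableTypeR R)).

Lemma derivable_defect (F : R -> R) t e : derivable F t 1 -> 0 < e ->
  exists2 eta, 0 < eta & forall s, `|s - t| < eta ->
    `|F s - F t - (s - t) * derive1 F t| <= e * `|s - t|.
Proof.
move=> dF e0.
have : (fun h : R => h^-1 *: (F (h *: 1 + t) - F t)) @ 0^' --> derive1 F t.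
  by rewrite derive1E /derive; exact: dF.
move=> /cvgrPdist_le /(_ e e0)[/= eta eta0 H]; exists eta => // s st.
have [->|st0] := eqVneq s t; first by rewrite !subrr mul0r subrr normr0 mulr0.
have h0 : s - t != 0 by rewrite subr_eq0.
have := H (s - t); rewrite /= sub0r normrN => /(_ st h0).
rewrite [_ *: 1]mulr1 subrK => {}H.
rewrite -(ler_pM2l (x := `|s - t|^-1)) ?invr_gt0 ?normr_gt0//.
rewrite [leRHS]mulrCA mulVf ?normr_eq0// mulr1 -normfV -normrM mulrBr mulKf//.
by rewrite distrC.
Qed.

Lemma locally_integrable_itv (u : R -> R) : measurable_fun [set: R] u ->
  (forall a b, mu.-integrable `[a, b] (EFin \o u)) -> locally_integrable [set: R] u.
Proof.
move=> mf ju; split => //; first exact: openT.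
move=> K _ cK; have [M [_ HM]] := compact_bounded cK.
have KM : K `<=` `[- (M + 1), M + 1]%classic.
  move=> x Kx; rewrite /= in_itv /= -ler_norml; apply: (HM (M + 1)) => //.
  by rewrite ltrDl.
have [_] := integrableP _ _ _ (ju (- (M + 1)) (M + 1)); apply: le_lt_trans.
apply: ge0_subset_integral => //; first exact: compact_measurable.
by apply/measurable_EFinP; apply: measurableT_comp => //; exact: measurable_funTS.
Qed.

End Differentiation.

Section MollifierLimit.
Context {R : realType}.
Local Notation mu := (@lebesgue_measure R).
Local Notation mble := (@measurable _ (measurableTypeR R)).
Local Notation ex c s := ((expR (c * s))%:C%C).
Variable p : R -> R[i].
Hypothesis hp : sqint p.
Local Notation h s := (p s * ex (2 * 1) s).
Local Notation H t := (cint `]-oo, t] (fun s => p s * ex (2 * 1) s)).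
Local Notation D t s := (H s - H t - (s - t)%:C%C * h t).

(** Lebesgue's differentiation theorem for the real and imaginary parts of [H], each contributing
    half of [e]. *)
Lemma ae_defect : {ae mu, forall t, forall e, 0 < e -> exists2 eta, 0 < eta &
  forall s, t - eta <= s -> s <= t -> cabs (D t s) <= e * (t - s)}.
Proof.
have jh t := cintb_weighted hp t (ltr01 : 0 < 1 :> R).
have jh2 := (prim_weighted hp (ltr01 : 0 < 1 :> R)).1.
have [mr mi] := (jh 0).1.
have Fr := FTC1Ny (fun t => cintb_Re (measurable_itv _) (jh t))
  (locally_integrable_itv mr (fun a b => cintb_Re (measurable_itv _) (jh2 a b))).
have Fi := FTC1Ny (fun t => cintb_Im (measurable_itv _) (jh t))
  (locally_integrable_itv mi (fun a b => cintb_Im (measurable_itv _) (jh2 a b))).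
have := @filterS2 _ _ (ae_filter_ringOfSetsType mu) _ _ _ _ Fr Fi; apply.
move=> t [dr er] [di ei] e e0.
have e20 : 0 < e / 2 by rewrite divr_gt0.
have [n1 n10 H1] := derivable_defect dr e20.
have [n2 n20 H2] := derivable_defect di e20.
rewrite er in H1; rewrite ei in H2.
pose eta := Num.min n1 n2; have eta0 : 0 < eta by rewrite lt_min n10.
exists (eta / 2); first by rewrite divr_gt0.
move=> s ts st; have st' : `|s - t| = t - s by rewrite distrC ger0_norm ?subr_ge0.
have lt_ : `|s - t| < eta by rewrite st'; lra.
rewrite lt_min in lt_; case/andP: lt_ => /H1 {}H1 /H2 {}H2.
rewrite st' in H1 H2; rewrite (le_trans (cabs_le _))//.
rewrite [leRHS](_ : _ = e / 2 * (t - s) + e / 2 * (t - s)); last by field.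
apply: lerD.
  apply: le_trans H1; rewrite cReD cReN cReD cReN [complex.Re (_ * h t)]cReM /= mul0r subr0; exact: lexx.
apply: le_trans H2; rewrite cImD cImN cImD cImN [complex.Im (_ * h t)]cImM /= mul0r addr0; exact: lexx.
Qed.

Lemma ae_moll : {ae mu, forall t, forall e, 0 < e -> exists N : nat,
  forall n, (N <= n)%N -> cabs (moll p n.+2%:R t - p t) <= e}.
Proof.
move: ae_defect; apply: ae_mono => t Ht e e0.
pose r := expR (- 2 * t); have r0 : 0 < r by exact: expR_gt0.
(* Makes the term $10\,e\,e^{-2t}$ of [moll_error] equal to half of the target; the other half is
   reached once the width parameter exceeds $2X/e$. The shift by 2 in [n.+2] meets the requirement
   $w\ge2$ there. *)
have e1 : 0 < e / (20 * r) by rewrite divr_gt0// mulr_gt0.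
have [eta eta0 De] := Ht _ e1.
pose X := 2 * cabs (p t) + 4 * (1 + sqn p) / eta ^+ 2 + 2 * r * cabs (h t) / eta.
exists (Num.truncn (2 * X / e)) => n Nn.
have w2 : 2 <= n.+2%:R :> R by rewrite ler_nat.
rewrite (le_trans (moll_error hp w2 eta0 (ltW e1) De))// -/r -/X.
rewrite (_ : 10 * _ * r = e / 2); last by field; rewrite lt0r_neq0.
have : X / n.+2%:R <= e / 2.
  have := truncnS_gt (2 * X / e); have : (Num.truncn (2 * X / e)).+1%:R <= n.+2%:R :> R.
    by rewrite ler_nat ltnS (leq_trans Nn).
  rewrite ltr_pdivrMr// ler_pdivrMr ?ltr0n//.
  move: (_.+1%:R) n.+2%:R => a b ab; have : a * e <= b * e by rewrite ler_wpM2r// ltW.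
  rewrite [e / 2 * b](_ : _ = b * e / 2); last by field.
  by move: (a * e) (b * e) => u v; lra.
by move: (X / _) => y; lra.
Qed.

End MollifierLimit.

(** * Convergence of the mollifications in $L^2$ *)

Section MollifierL2.
Context {R : realType}.
Local Notation mu := (@lebesgue_measure R).
Local Notation mble := (@measurable _ (measurableTypeR R)).

Lemma cabs_parallelogram (z v : R[i]) :
  cabs (z - v) ^+ 2 <= 2 * cabs z ^+ 2 + 2 * cabs v ^+ 2.
Proof.
have := cabsB z v; have := cabs_ge0 z; have := cabs_ge0 v; have := cabs_ge0 (z - v).
move: (cabs z) (cabs v) (cabs (z - v)) => a b c c0 b0 a0 cab.
have : c ^+ 2 <= (a + b) ^+ 2 by rewrite ler_pXn2r ?nnegrE ?addr_ge0.
by have := sqr_ge0 (a - b); nra.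
Qed.

Lemma integrable_sq2 (f g : R -> R[i]) : sqint f -> sqint g ->
  mu.-integrable [set: R] (EFin \o (fun t => 2 * cabs (f t) ^+ 2 + 2 * cabs (g t) ^+ 2)).
Proof.
move=> hf hg.
by have := integrableD (measurableT : mble setT)
  (integrableZl (measurableT : mble setT) 2 hf.2) (integrableZl (measurableT : mble setT) 2 hg.2).
Qed.

Lemma sqintB (f g : R -> R[i]) : sqint f -> sqint g -> sqint (fun t => f t - g t).
Proof.
move=> hf hg; have mfg : cmeas (fun t => f t - g t) by apply: cmeasB; [case: hf|case: hg].
split => //; apply: (le_integrable _ _ _ (integrable_sq2 hf hg)) => //.
  by apply/measurable_EFinP; apply: measurable_funX; exact: measurable_cabs.
move=> t _ /=; rewrite lee_fin !ger0_norm ?exprn_ge0 ?cabs_ge0 ?cabs_parallelogram//.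
by rewrite (le_trans _ (cabs_parallelogram _ _))// exprn_ge0 ?cabs_ge0.
Qed.

(** Fatou applied to $g_n=2|p|^2+2|m_n|^2-|p-m_n|^2\ge0$, which tends to $4|p|^2$ almost everywhere.
    Mollification does not increase the norm, so a defect above [e] for all [n] would give $\int
    g_n\le4\|p\|^2-e$, a contradiction. No dominating function is required. *)
Lemma moll_L2 (p : R -> R[i]) e : sqint p -> 0 < e ->
  exists2 w, 0 < w & sqn (fun t => p t - moll p w t) <= e.
Proof.
move=> hp e0; apply: contrapT => no.
pose m n := moll p n.+2%:R.
have m0 n : 0 < n.+2%:R :> R by rewrite ltr0n.
have Sn n : e < sqn (fun t => p t - m n t).
  by rewrite ltNge; apply/negP => le; apply: no; exists n.+2%:R.
have hm n : sqint (m n) by have [] := sqint_moll hp (m0 n).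
pose g n t := 2 * cabs (p t) ^+ 2 + 2 * cabs (m n t) ^+ 2 - cabs (p t - m n t) ^+ 2.
have jg n : mu.-integrable [set: R] (EFin \o g n).
  by have := integrableB (measurableT : mble setT) (integrable_sq2 hp (hm n)) (sqintB hp (hm n)).2.
have Ig n : \int[mu]_t g n t <= 4 * sqn p - e.
  rewrite /g RintegralB//; [|exact: integrable_sq2|by case: (sqintB hp (hm n))].
  have -> : \int[mu]_t (2 * cabs (p t) ^+ 2 + 2 * cabs (m n t) ^+ 2) = 2 * sqn p + 2 * sqn (m n).
    rewrite RintegralD//; first by rewrite !RintegralZl//; [case: (hm n)|case: hp].
      by have := integrableZl (measurableT : mble setT) 2 hp.2.
    by have := integrableZl (measurableT : mble setT) 2 (hm n).2.
  have [_ mp] := sqint_moll hp (m0 n); have := Sn n; rewrite /sqn /m in mp *; lra.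
have mg n : measurable_fun [set: R] (EFin \o g n) by exact: measurable_int (jg n).
have g0 n t : (0 <= (g n t)%:E)%E by rewrite lee_fin subr_ge0 cabs_parallelogram.
have sq (u : nat -> R) (l : R) : u @ \oo --> l -> (fun n => u n ^+ 2) @ \oo --> l ^+ 2.
  by move=> ul; apply: (cvgM ul ul).
have lim t : (forall e, 0 < e -> exists N : nat,
    forall n, (N <= n)%N -> cabs (m n t - p t) <= e) ->
    (fun n => (g n t)%:E) @ \oo --> (4 * cabs (p t) ^+ 2)%:E.
  move=> H; have d0 : (fun n => cabs (p t - m n t)) @ \oo --> 0.
    apply/cvgrPdist_le => d d1; have [N HN] := H d d1; exists N => // n /= Nn.
    by rewrite sub0r normrN ger0_norm ?cabs_ge0// cabs_distC HN.
  have dm : (fun n => cabs (m n t)) @ \oo --> cabs (p t).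
    apply/cvgrPdist_le => d d1; have [N HN] := H d d1; exists N => // n /= Nn.
    have := HN n Nn; rewrite ler_norml.
    have := cabs_distD (p t) (m n t) 0; have := cabs_distD (m n t) (p t) 0.
    rewrite !subr0 (cabs_distC (p t)).
    by move: (cabs (p t)) (cabs (m n t)) (cabs _) => x y z; clear; lra.
  apply: cvg_EFin; first by apply: nearW.
  rewrite (_ : 4 * _ = 2 * cabs (p t) ^+ 2 + 2 * cabs (p t) ^+ 2 - 0 ^+ 2); last by ring.
  apply: cvgB; last exact: (sq _ _ d0).
  by apply: cvgD; [exact: cvg_cst|apply: cvgMr; exact: (sq _ _ dm)].
have mi : measurable_fun [set: R] (fun t => limn_einf (fun n => (g n t)%:E)).
  apply: (measurableT_comp (@oppe_measurable R setT)).
  apply: (measurable_fun_limn_esup (f := fun n t => (- (g n t)%:E)%E)) => n.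
  exact: (measurableT_comp (@oppe_measurable R setT) (mg n)).
have := fatou mu (measurableT : mble setT) mg (fun n t _ => g0 n t).
apply/negP; rewrite -ltNge.
have E1 : (\int[mu]_t limn_einf (fun n => (g n t)%:E) = (4 * sqn p)%:E)%E.
  transitivity (\int[mu]_t (4 * cabs (p t) ^+ 2)%:E)%E.
    apply: ae_eq_integral => //.
      by apply/measurable_EFinP; apply: measurable_funM => //; exact: sqint_measurable.
    by move: (ae_moll hp); apply: ae_mono => t /lim /cvg_limn_einf_sup[-> _] _.
  rewrite -RintegralZl ?hp.2// /Rintegral fineK// integrable_fin_num//.
  by have := integrableZl (measurableT : mble setT) 4 hp.2.
rewrite E1; apply: (@le_lt_trans _ _ (4 * sqn p - e)%:E); last first.
  by rewrite lte_fin gtrBl.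
rewrite limn_einf_lim; apply: lime_le; first exact: is_cvg_einfs.
apply: nearW => n; apply: (@le_trans _ _ (\int[mu]_t (g n t)%:E)%E).
  by apply: ereal_inf_lbound; exists n => /=.
have fn := integrable_fin_num (measurableT : mble setT) (jg n).
by rewrite -(fineK fn) lee_fin; exact: Ig.
Qed.

End MollifierL2.

(** * Large lambda *)

Section Oscillatory.
Context {R : realType}.
Local Notation mu := (@lebesgue_measure R).
Local Notation mble := (@measurable _ (measurableTypeR R)).
Implicit Types (f g q : R -> R[i]) (z : R[i]).
Local Notation w z := (complex.Im z).
Local Notation ph z s := (cexp (- (2 * ('i%C * z)) * s%:C%C)).

(** The solution of $y'=2izy+f$ that is bounded by the weighted average of [f]; for $z=\lambda^2$
    and $f=q^*$ it is the inner integral of $b_2$. *)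
Definition osc z f (s : R) : R[i] :=
  cexp (2 * ('i%C * z) * s%:C%C) * cint `]-oo, s] (fun r => f r * ph z r).

Lemma cabs_phase z s : cabs (ph z s) = expR (2 * w z * s).
Proof.
rewrite (_ : - (2 * ('i%C * z)) = 'i%C * (- 2%:R * z)); last by ring.
by rewrite cabs_cexpi mulNr [complex.Im _](cImN (2%:R * z)) Im_natM opprK.
Qed.

Lemma cabs_phaseV z s : cabs (cexp (2 * ('i%C * z) * s%:C%C)) = expR (- (2 * w z) * s).
Proof.
rewrite (_ : 2 * ('i%C * z) = 'i%C * (2%:R * z)); last by ring.
by rewrite cabs_cexpi Im_natM.
Qed.

Lemma cintb_phase z f s : sqint f -> 0 < w z -> cintb `]-oo, s] (fun r => f r * ph z r).
Proof.
move=> hf w0; split; first by apply: cmeasM; [case: hf|exact: cmeas_cexpZ].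
rewrite (_ : (fun x => _) = (fun r => cabs (f r) * expR (2 * w z * r))).
  exact: wprim_integrable.
by apply/funext => r; rewrite cabsM cabs_phase.
Qed.

Lemma cabs_cint_phase z f s : sqint f -> 0 < w z ->
  cabs (cint `]-oo, s] (fun r => f r * ph z r)) <= wprim f (w z) s.
Proof.
move=> hf w0; apply: cabs_cint_le => //.
- by case: (cintb_phase 0 hf w0).
- exact: wprim_integrable.
- by move=> r _; rewrite cabsM cabs_phase.
Qed.

Lemma cabs_osc z f s : sqint f -> 0 < w z -> cabs (osc z f s) <= wavg f (w z) s.
Proof.
by move=> hf w0; rewrite cabsM cabs_phaseV ler_wpM2l ?expR_ge0 ?cabs_cint_phase.
Qed.

Lemma oscB z f g s : sqint f -> sqint g -> 0 < w z ->
  osc z (fun r => f r - g r) s = osc z f s - osc z g s.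
Proof.
move=> hf hg w0; rewrite /osc -mulrBr -(cintB (measurable_itv _ : mble `]-oo, s]) (cintb_phase s hf w0)
  (cintb_phase s hg w0)); congr (_ * _).
by apply: eq_cint => r _; rewrite mulrBl.
Qed.

Lemma expR_dominated_eq0 (c K : R) (A : R[i]) : 0 < c -> 0 <= K ->
  (forall x, cabs A <= K * expR (c * x)) -> A = 0.
Proof.
move=> c0 K0 AK; apply: cabs_le0; rewrite leNgt; apply/negP => A0.
have y0 : 0 < 2 * K / cabs A + 1 by rewrite ltr_wpDl// divr_ge0 ?mulr_ge0// ltW.
(* At this point $Ke^{-y}\le K/y$ with $y=2K/|A|+1$, so the bound reads $2K+|A|\le K$, which is
   impossible. *)
have := AK (- (2 * K / cabs A + 1) / c).
rewrite [c * _]mulrC divfK ?lt0r_neq0// => H.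
have := le_trans H (ler_wpM2l K0 (expRN_le1 y0)).
rewrite ler_pdivlMr// mulrDr mulr1 [cabs A * (_ / _)]mulrC divfK ?lt0r_neq0//; lra.
Qed.

Lemma wavg_le_const f v : sqint f -> 0 < v -> exists2 M, 0 <= M & forall t, wavg f v t <= M.
Proof.
move=> hf v0; exists (Num.sqrt (sqn f / (2 * v))) => [|t]; first exact: sqrtr_ge0.
by rewrite -[leLHS](ger0_norm (wavg_ge0 _ _ _)) -sqrtr_sqr ler_wsqrtr// wavg_bound.
Qed.

(** Integration by parts on a half-line, the boundary at $-\infty$ being handled indirectly: the
    combination [A] of the three terms has zero density, hence is constant, and it is dominated by
    $e^{2wx}$, hence is zero. *)
Lemma osc_by_parts z g g1 B : prim g g1 -> sqint g -> sqint g1 -> 0 < w z ->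
  (forall s, cabs (g s) <= B) ->
  forall s, 2 * ('i%C * z) * osc z g s = osc z g1 s - g s.
Proof.
move=> pg hg hg1 w0 gB.
have B0 : 0 <= B by exact: le_trans (cabs_ge0 _) (gB 0).
pose A s := 2 * ('i%C * z) * cint `]-oo, s] (fun r => g r * ph z r) -
  cint `]-oo, s] (fun r => g1 r * ph z r) + g s * ph z s.
have pA : prim A (fun=> 0).
  apply: (prim_eq (primD (primB (primZ (2 * ('i%C * z)) (primNy (fun t => cintb_phase t hg w0)))
    (primNy (fun t => cintb_phase t hg1 w0))) (primM pg (prim_cexpZ _)))).
  by move=> s; ring.
have [M M0 gM] := wavg_le_const hg w0; have [M1 M10 g1M] := wavg_le_const hg1 w0.
have A0 s : A s = 0.
  apply: (@expR_dominated_eq0 (2 * w z) (cabs (2 * ('i%C * z)) * M + M1 + B)).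
  - by rewrite mulr_gt0.
  - by rewrite !addr_ge0// mulr_ge0 ?cabs_ge0.
  move=> x; have T1 : cabs (2 * ('i%C * z) * cint `]-oo, x] (fun r => g r * ph z r)) <=
      cabs (2 * ('i%C * z)) * (M * expR (2 * w z * x)).
    rewrite cabsM; apply: (ler_wpM2l (cabs_ge0 _)).
    apply: le_trans (cabs_cint_phase x hg w0) _; rewrite wprim_wavg mulrC.
    exact: (ler_wpM2r (expR_ge0 _) (gM x)).
  have T2 : cabs (cint `]-oo, x] (fun r => g1 r * ph z r)) <= M1 * expR (2 * w z * x).
    apply: le_trans (cabs_cint_phase x hg1 w0) _; rewrite wprim_wavg mulrC.
    exact: (ler_wpM2r (expR_ge0 _) (g1M x)).
  have T3 : cabs (g x * ph z x) <= B * expR (2 * w z * x).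
    by rewrite cabsM cabs_phase; exact: (ler_wpM2r (expR_ge0 _) (gB x)).
  rewrite (prim0_cst pA s x); apply: le_trans (cabsD _ _) _.
  apply: le_trans (lerD (le_trans (cabsB _ _) (lerD T1 T2)) T3) _.
  by rewrite [cabs _ * (M * _)]mulrA -!mulrDl.
move=> s; rewrite /osc; have := A0 s; rewrite /A.
have E : cexp (2 * ('i%C * z) * s%:C%C) * ph z s = 1.
  by rewrite -cexpD -[RHS]cexp0; congr cexp; ring.
move: E; move: (cexp (2 * ('i%C * z) * s%:C%C)) (ph z s) => e f ef.
move: (cint _ _) (cint _ _) (g s) => d c u cd.
have -> : u = u * (e * f) by rewrite ef mulr1.
apply/eqP; rewrite -subr_eq0 (_ : _ - _ = e * (2 * ('i%C * z) * c - d + u * f)); last by ring.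
by rewrite cd mulr0.
Qed.

End Oscillatory.

(** * Comparison of $b_2$ with its limit *)

Section FirstCoefficient.
Context {R : realType}.
Local Notation mu := (@lebesgue_measure R).
Local Notation mble := (@measurable _ (measurableTypeR R)).

Lemma sqintJ (q : R -> R[i]) : sqint q -> sqint (fun s => (q s)^*%C).
Proof.
move=> [mq jq]; split; first exact: cmeasJ.
by rewrite (_ : (fun x => _) = (fun x => cabs (q x) ^+ 2))//; apply/funext => x; rewrite cabsJ.
Qed.

Lemma sqintZ (c : R) (f : R -> R[i]) : sqint f ->
  sqint (fun s => c%:C%C * f s) /\ sqn (fun s => c%:C%C * f s) = c ^+ 2 * sqn f.
Proof.
move=> [mf jf].
have E : (fun x => cabs (c%:C%C * f x) ^+ 2) = (fun x => c ^+ 2 * cabs (f x) ^+ 2).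
  by apply/funext => x; rewrite cabsM cabsR exprMn real_normK ?num_real.
split; last by rewrite /sqn E RintegralZl.
split; first by apply: cmeasZ.
by rewrite E; have := integrableZl (measurableT : mble setT) (c ^+ 2) jf.
Qed.

Lemma integrable_cabsM (f g : R -> R[i]) (th : R) : sqint f -> sqint g -> 0 < th ->
  mu.-integrable [set: R] (EFin \o (fun t => cabs (f t) * cabs (g t))) /\
  \int[mu]_t (cabs (f t) * cabs (g t)) <= th / 2 * sqn g + (2 * th)^-1 * sqn f.
Proof.
move=> hf hg th0.
have j1 : mu.-integrable [set: R] (EFin \o (fun t => th / 2 * cabs (g t) ^+ 2)).
  by have := integrableZl (measurableT : mble setT) (th / 2) hg.2.
have j2 : mu.-integrable [set: R] (EFin \o (fun t => (2 * th)^-1 * cabs (f t) ^+ 2)).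
  by have := integrableZl (measurableT : mble setT) (2 * th)^-1 hf.2.
have j12 : mu.-integrable [set: R] (EFin \o (fun t =>
    th / 2 * cabs (g t) ^+ 2 + (2 * th)^-1 * cabs (f t) ^+ 2)).
  by have := integrableD (measurableT : mble setT) j1 j2.
have le t : cabs (f t) * cabs (g t) <= th / 2 * cabs (g t) ^+ 2 + (2 * th)^-1 * cabs (f t) ^+ 2.
  move: (cabs (f t)) (cabs (g t)) => a b; rewrite -subr_ge0.
  rewrite (_ : _ - _ = (th * b - a) ^+ 2 / (2 * th)); last by field; rewrite lt0r_neq0.
  by rewrite divr_ge0 ?sqr_ge0// mulr_ge0// ltW.
have jfg : mu.-integrable [set: R] (EFin \o (fun t => cabs (f t) * cabs (g t))).
  apply: (le_integrable _ _ _ j12) => //.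
    apply/measurable_EFinP; apply: measurable_funM; apply: measurable_cabs.
      by case: hf.
    by case: hg.
  move=> t _ /=; rewrite lee_fin ger0_norm ?(mulr_ge0 (cabs_ge0 _) (cabs_ge0 _))//.
  exact: le_trans (le t) (ler_norm _).
split => //; rewrite (le_trans (le_Rintegral _ jfg j12 _))//.
by rewrite RintegralD// !RintegralZl//; [case: hf|case: hg].
Qed.

Lemma cint_mulJ (q : R -> R[i]) : sqint q ->
  cint [set: R] (fun s => q s * (q s)^*%C) = (sqn q)%:C%C.
Proof.
move=> hq; rewrite -cint_real; last exact: hq.2.
apply: eq_cint => s _; rewrite sqr_cabs; case: (q s) => a b.
by apply: complex_eqP => /=; ring.
Qed.

Lemma log_coef0E (q : R -> R[i]) (lam : R[i]) : log_coef q lam 0 =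
  - lam ^+ 2 * cint [set: R] (fun s => q s * osc (lam ^+ 2) (fun r => (q r)^*%C) s).
Proof. by congr (_ * _); apply: eq_cint => s _; rewrite /potY /osc [RHS]mulrA. Qed.

Local Notation w lam := (complex.Im (lam ^+ 2)).

Lemma half_i_mul (x y u : R[i]) :
  'i%C / 2%:R * (y + 2 * ('i%C * u) * x) = 'i%C / 2%:R * y - u * x.
Proof.
have ii : 'i%C * 'i%C = -1 :> R[i] by rewrite -expr2 sqr_i.
rewrite mulrDr; congr (_ + _).
rewrite (_ : 'i%C / 2%:R * _ = ('i%C * 'i%C) * (u * x)); last by field.
by rewrite ii mulN1r.
Qed.

Definition conj_defect (q : R -> R[i]) (v : R) : R :=
  sqn (fun s => (q s)^*%C - moll (fun r => (q r)^*%C) v s).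

(** Split $q^*=g+d$ with [g] the mollification. By parts, $-\lambda^2\operatorname{osc}g=\frac
    i2(\operatorname{osc}g'-g)$, which is where the factor $-\frac i2$ of the limit arises. The
    three lines of the bound estimate $\operatorname{osc}d$, $\operatorname{osc}g'$ with $g'=2vd$,
    and the replacement of [g] by $q^*$ in the main term. *)
Lemma log_coef0_moll (q : R -> R[i]) (lam : R[i]) (v th : R) : sqint q ->
  0 < complex.Im (lam ^+ 2) -> 0 < v -> 0 < th ->
  cabs (log_coef q lam 0 + 'i%C / 2%:R * (sqn q)%:C%C) <=
    cabs lam ^+ 2 * (th * conj_defect q v / (4 * w lam) + sqn q / (4 * th * w lam)) +
    2^-1 * ((2 * v) ^+ 2 * conj_defect q v / (4 * w lam) + sqn q / (4 * w lam)) +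
    2^-1 * (th / 2 * conj_defect q v + (2 * th)^-1 * sqn q).
Proof.
move=> hq w0 v0 th0; pose p s := (q s)^*%C; pose g := moll p v.
pose d s := p s - g s; pose sd := conj_defect q v; pose z := lam ^+ 2.
have hp : sqint p by exact: sqintJ.
have hg : sqint g by case: (sqint_moll hp v0).
have hd : sqint d by exact: sqintB.
pose g1 s := (2 * v)%:C%C * d s.
have [hg1 ng1] : sqint g1 /\ sqn g1 = (2 * v) ^+ 2 * sd by exact: sqintZ.
have pg : prim g g1 := prim_moll hp v0.
have [M M0 wM] := wavg_le_const hp v0.
have gB s : cabs (g s) <= 2 * v * M.
  by rewrite (le_trans (cabs_moll hp s v0))// ler_wpM2l// mulr_ge0// ltW.
have IP := osc_by_parts pg hg hg1 w0 gB.
have [j1 I1] := wavg_pairing hq hd w0 th0.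
have [j2 I2] := wavg_pairing hq hg1 w0 ltr01.
have [j3 I3] := integrable_cabsM hq hd th0.
pose F s := - z * (q s * osc z p s) + 'i%C / 2%:R * (q s * p s).
have FE s : F s = q s * (- z * osc z d s + 'i%C / 2%:R * osc z g1 s + 'i%C / 2%:R * d s).
  rewrite /F [osc z d s](oscB s hp hg w0); have := IP s; rewrite -/z /d => IPs.
  have -> : 'i%C / 2%:R * osc z g1 s = 'i%C / 2%:R * g s - z * osc z g s.
    have -> : osc z g1 s = g s + 2 * ('i%C * z) * osc z g s by rewrite IPs; ring.
    exact: half_i_mul.
  by ring.
have mz s : cabs (F s) <= cabs lam ^+ 2 * (cabs (q s) * wavg d (complex.Im z) s) +
    2^-1 * (cabs (q s) * wavg g1 (complex.Im z) s) + 2^-1 * (cabs (q s) * cabs (d s)).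
  have i2 : cabs ('i%C / 2%:R : R[i]) = 2^-1.
    by rewrite cabsM cabsV cabs_sqrt /= expr0n /= expr1n add0r sqrtr1 mul1r -(rmorph_nat (real_complex R)) cabsR ger0_norm.
  rewrite FE cabsM.
  have T : cabs (- z * osc z d s + 'i%C / 2%:R * osc z g1 s + 'i%C / 2%:R * d s) <=
      cabs lam ^+ 2 * wavg d (complex.Im z) s + 2^-1 * wavg g1 (complex.Im z) s + 2^-1 * cabs (d s).
    apply: le_trans (cabsD _ _) _; rewrite [cabs (_ / _ * d s)]cabsM i2 lerD2r.
    apply: le_trans (cabsD _ _) _; rewrite [cabs (- z * _)]cabsM [cabs (_ / _ * _)]cabsM i2.
    rewrite cabsN cabsX; apply: lerD.
      by apply: (ler_wpM2l _ (cabs_osc s hd w0)); rewrite exprn_ge0 ?cabs_ge0.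
    by apply: (ler_wpM2l _ (cabs_osc s hg1 w0)); rewrite invr_ge0.
  apply: le_trans (ler_wpM2l (cabs_ge0 _) T) _.
  by rewrite le_eqVlt; apply/orP; left; apply/eqP; ring.
have jq : cintb [set: R] (fun s => q s * osc z p s).
  have [K K0 qK] := wavg_le_const hq w0.
  apply: (cintb_ext _ (cintb_potY_ric hq w0 K0 qK 0 (measurableT : mble setT))) => s.
  by rewrite /potY /osc [RHS]mulrA.
have jqp : cintb [set: R] (fun s => q s * p s).
  split; first by apply: cmeasM; [case: hq|case: hp].
  rewrite (_ : (fun x => _) = (fun x => cabs (q x) ^+ 2)); first by case: hq.
  by apply/funext => s; rewrite cabsM cabsJ expr2.
have -> : log_coef q lam 0 + 'i%C / 2%:R * (sqn q)%:C%C = cint [set: R] F.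
  by rewrite log_coef0E -(cint_mulJ hq) -!cintZ// -cintD//; exact: cintbZ.
have mF : cmeas F by case: (cintbD measurableT (cintbZ (- z) measurableT jq) (cintbZ ('i%C / 2%:R) measurableT jqp)).
have J1 : mu.-integrable [set: R] (EFin \o (fun s => cabs lam ^+ 2 * (cabs (q s) * wavg d (complex.Im z) s))).
  by have := integrableZl (measurableT : mble setT) (cabs lam ^+ 2) j1.
have J2 : mu.-integrable [set: R] (EFin \o (fun s => 2^-1 * (cabs (q s) * wavg g1 (complex.Im z) s))).
  by have := integrableZl (measurableT : mble setT) 2^-1 j2.
have J3 : mu.-integrable [set: R] (EFin \o (fun s => 2^-1 * (cabs (q s) * cabs (d s)))).
  by have := integrableZl (measurableT : mble setT) 2^-1 j3.
have J12 : mu.-integrable [set: R] (EFin \o (fun s => cabs lam ^+ 2 * (cabs (q s) * wavg d (complex.Im z) s)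
    + 2^-1 * (cabs (q s) * wavg g1 (complex.Im z) s))).
  by have := integrableD (measurableT : mble setT) J1 J2.
have J123 : mu.-integrable [set: R] (EFin \o (fun s => cabs lam ^+ 2 * (cabs (q s) * wavg d (complex.Im z) s)
    + 2^-1 * (cabs (q s) * wavg g1 (complex.Im z) s) + 2^-1 * (cabs (q s) * cabs (d s)))).
  by have := integrableD (measurableT : mble setT) J12 J3.
apply: le_trans (cabs_cint_le (measurableT : mble setT) mF J123 (fun s _ => mz s)) _.
rewrite RintegralD// RintegralD// !RintegralZl//.
apply: lerD; first apply: lerD.
- by apply: (ler_wpM2l _ I1); rewrite exprn_ge0 ?cabs_ge0.
- apply: (ler_wpM2l _ (le_trans I2 _)); first by rewrite invr_ge0.
  by rewrite ng1 mul1r mulr1.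
- by apply: (ler_wpM2l _ I3); rewrite invr_ge0.
Qed.

End FirstCoefficient.

(** * Limits along sectors *)

Section LargeLambda.
Context {R : realType}.
Local Notation mu := (@lebesgue_measure R).
Local Notation mble := (@measurable _ (measurableTypeR R)).
Local Notation w lam := (complex.Im (lam ^+ 2)).

(** The parameters are fixed in this order: [th] large, so that $\|q\|^2/th\le\eta$; then [v], so
    that [th] times the defect is at most $\eta$; then [W], for the term containing $(2v)^2$. With
    $e=(\delta^{-1}+1)\eta$ the outer terms contribute $\frac12\delta^{-1}\eta+\frac12\eta$ and the
    middle one $\frac12e$. *)
Lemma log_coef0_limit (q : R -> R[i]) (delta e : R) : sqint q -> 0 < delta -> 0 < e ->
  exists2 W, 0 < W & forall lam, W <= w lam -> delta * cabs lam ^+ 2 <= w lam ->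
    cabs (log_coef q lam 0 + 'i%C / 2%:R * (sqn q)%:C%C) <= e.
Proof.
move=> hq d0 e0; pose eta := e / (delta^-1 + 1).
have di0 : 0 < delta^-1 by rewrite invr_gt0.
have eta0 : 0 < eta by rewrite divr_gt0// addr_gt0.
have S0 := sqn_ge0 q.
pose th := sqn q / eta + 1.
have th0 : 0 < th by rewrite ltr_wpDl// divr_ge0// ltW.
have Sth : sqn q / th <= eta.
  rewrite ler_pdivrMr// /th mulrDr mulr1 mulrC divfK ?lt0r_neq0//.
  by rewrite lerDl ltW.
have [v v0 Dv] := moll_L2 (sqintJ hq) (divr_gt0 eta0 th0).
rewrite -/(conj_defect q v) in Dv.
have D0 : 0 <= conj_defect q v by exact: sqn_ge0.
have thD : th * conj_defect q v <= eta by rewrite mulrC -ler_pdivlMr.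
pose Q := (2 * v) ^+ 2 * conj_defect q v + sqn q.
have Q0 : 0 <= Q by rewrite addr_ge0// mulr_ge0// sqr_ge0.
exists (Q / (4 * e) + 1); first by rewrite ltr_wpDl// divr_ge0// mulr_ge0// ltW.
move=> lam Ww dw.
have w0 : 0 < w lam by rewrite (lt_le_trans _ Ww)// ltr_wpDl// divr_ge0// mulr_ge0// ltW.
apply: le_trans (log_coef0_moll hq w0 v0 th0) _.
have T2 : (2 * v) ^+ 2 * conj_defect q v / (4 * w lam) + sqn q / (4 * w lam) <= e.
  rewrite -mulrDl -/Q ler_pdivrMr ?mulr_gt0//.
  rewrite mulrCA mulrA -ler_pdivrMl ?mulr_gt0// mulrC.
  by rewrite (le_trans _ Ww)// lerDl.
have T1 : cabs lam ^+ 2 * (th * conj_defect q v / (4 * w lam) + sqn q / (4 * th * w lam)) <=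
    delta^-1 * (2 * eta) / 4.
  have A : cabs lam ^+ 2 <= delta^-1 * w lam by rewrite mulrC ler_pdivlMr// mulrC.
  have B0 : 0 <= th * conj_defect q v / (4 * w lam) + sqn q / (4 * th * w lam).
    by rewrite addr_ge0// divr_ge0// !mulr_ge0// ltW.
  apply: le_trans (ler_wpM2r B0 A) _.
  rewrite [leLHS](_ : _ = delta^-1 * (th * conj_defect q v + sqn q / th) / 4); last first.
    by field; rewrite !lt0r_neq0.
  rewrite ler_wpM2r// ler_wpM2l ?(ltW di0)//; lra.
have T3 : th / 2 * conj_defect q v + (2 * th)^-1 * sqn q <= eta.
  rewrite [leLHS](_ : _ = (th * conj_defect q v + sqn q / th) / 2); last first.
    by field; rewrite !lt0r_neq0.
  lra.
have E : e = delta^-1 * eta + eta.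
  by rewrite -[X in _ = _ + X]mul1r -mulrDl mulrC /eta divfK// lt0r_neq0// addr_gt0.
apply: le_trans (lerD (lerD T1 (ler_wpM2l _ T2)) (ler_wpM2l _ T3)) _; rewrite ?invr_ge0//.
move: E e0 eta0 di0; clear; move: (delta^-1) => di; move: eta => eta -> *; nra.
Qed.


(** In the sector $|\lambda|^2\le w/\delta$, so $M^2\le\sup_t$ [wsq] $/(2w)$ leaves exactly $\sup_t$
    [wsq] $/(2\delta)$, which [wsq_small] makes as small as desired. *)
Lemma wavg_sector (q : R -> R[i]) (delta e : R) : sqint q -> 0 < delta -> 0 < e ->
  exists2 W, 0 < W & forall lam, W <= w lam -> delta * cabs lam ^+ 2 <= w lam ->
    exists M, [/\ 0 <= M, forall t, wavg q (w lam) t <= M & cabs lam ^+ 2 * M ^+ 2 <= e].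
Proof.
move=> hq d0 e0; have e10 : 0 < 2 * delta * e by rewrite !mulr_gt0.
have [W W0 HW] := wsq_small hq e10.
exists W => // lam Ww dw; have w0 : 0 < w lam by rewrite (lt_le_trans W0).
have c0 : 0 <= 2 * delta * e / (2 * w lam) by rewrite divr_ge0 ?mulr_ge0 ?ltW.
exists (Num.sqrt (2 * delta * e / (2 * w lam))); split; first exact: sqrtr_ge0.
  move=> t; rewrite -[leLHS](ger0_norm (wavg_ge0 _ _ _)) -sqrtr_sqr ler_wsqrtr//.
  rewrite (le_trans (wavg_sq hq w0 t))// ler_wpM2r ?HW// invr_ge0.
  by rewrite mulr_ge0// ltW.
rewrite sqr_sqrtr//.
have A : cabs lam ^+ 2 <= delta^-1 * w lam by rewrite mulrC ler_pdivlMr// mulrC.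
apply: le_trans (ler_wpM2r c0 A) _.
by rewrite [leLHS](_ : _ = e)//; field; rewrite !lt0r_neq0.
Qed.

Lemma pairing_sector (q : R -> R[i]) (delta : R) lam : sqint q -> 0 < delta ->
  0 < w lam -> delta * cabs lam ^+ 2 <= w lam ->
  cabs lam ^+ 2 * pairing q lam <= sqn q / (2 * delta).
Proof.
move=> hq d0 w0 dw.
have A : cabs lam ^+ 2 <= delta^-1 * w lam by rewrite mulrC ler_pdivlMr// mulrC.
have [_ I] := wavg_pairing hq hq w0 ltr01.
apply: le_trans (ler_wpM2r (pairing_ge0 _ _) A) _.
apply: le_trans (ler_wpM2l _ I) _; first by rewrite mulr_ge0 ?invr_ge0 ?ltW.
by rewrite [leLHS](_ : _ = sqn q / (2 * delta))//; field; rewrite !lt0r_neq0.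
Qed.

Lemma s11_sector (q : R -> R[i]) (delta e : R) : sqint q -> 0 < delta -> 0 < e ->
  exists2 W, 0 < W & forall lam, W <= w lam -> delta * cabs lam ^+ 2 <= w lam ->
    exists S, [/\ s11 q lam = cexp S,
      cvgC (fun n => \sum_(1 <= j < n.+1) b_hom q lam j) \oo S &
      cabs (S + 'i%C / 2%:R * (sqn q)%:C%C) <= e].
Proof.
move=> hq d0 e0; have S0 := sqn_ge0 q.
have e20 : 0 < e / 2 by rewrite divr_gt0.
have [W1 W10 H1] := log_coef0_limit hq d0 e20.
have S1 : 0 < sqn q + 1 by rewrite ltr_wpDl.
(* The first bound gives convergence of the series; the second makes the tail after $b_2$, at most
   $8\cdot\frac{\|q\|^2}{2\delta}\cdot\rho$, no larger than $e/2$. The added 1 guards against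
   $q=0$. *)
pose e1 := Num.min 32^-1 (e * delta / (32 * (sqn q + 1))).
have e10 : 0 < e1 by rewrite lt_min invr_gt0 ltr0n /= divr_gt0 ?mulr_gt0.
have [W2 W20 H2] := wavg_sector hq d0 e10.
exists (Num.max W1 W2) => [|lam]; first by rewrite lt_max W10.
rewrite ge_max => /andP[W1w W2w] dw; have w0 : 0 < w lam by exact: lt_le_trans W1w.
have [M [M0 qM ML]] := H2 lam W2w dw.
have [ML1 ML2] : cabs lam ^+ 2 * M ^+ 2 <= 32^-1 /\
    cabs lam ^+ 2 * M ^+ 2 <= e * delta / (32 * (sqn q + 1)).
  by move: ML; rewrite le_min => /andP[].
have small : 32 * (cabs lam ^+ 2 * M ^+ 2) <= 1 by rewrite mulrC -ler_pdivlMr// mul1r.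
have [S sE HS] := s11_series hq w0 M0 qM small.
have P1 := pairing_sector hq d0 w0 dw.
set rho := 4 * (cabs lam ^+ 2 * M ^+ 2) in HS.
have rho0 : 0 <= rho by rewrite mulr_ge0// mulr_ge0 ?exprn_ge0 ?cabs_ge0.
have rho1 : `|rho| < 1 by rewrite ger0_norm// /rho; lra.
exists S; split => //.
  apply: (@squeezeC _ _ _ (fun n => 8 * cabs lam ^+ 2 * pairing q lam * rho ^+ n)) => [n|].
    rewrite big_add1 /= big_mkord -cabsN opprB (le_trans _ (HS n))//.
    by under eq_bigr => i _ do rewrite b_homE//.
  exact: (cvg_geometric _ rho1).
have := HS 1%N; rewrite big_ord_recl big_ord0 addr0 expr1 => HS1.
have L0 := H1 lam W1w dw.
have tri : cabs (S + 'i%C / 2%:R * (sqn q)%:C%C) <=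
    cabs (S - log_coef q lam 0) + cabs (log_coef q lam 0 + 'i%C / 2%:R * (sqn q)%:C%C).
  by rewrite (le_trans _ (cabsD _ _))// addrA subrK.
apply: le_trans tri _; rewrite [leRHS](_ : e = e / 2 + e / 2); last by field.
apply: lerD L0; apply: le_trans HS1 _.
have rb : rho <= e * delta / (8 * (sqn q + 1)).
  rewrite /rho mulrC -ler_pdivlMr// (le_trans ML2)//.
  by rewrite le_eqVlt; apply/orP; left; apply/eqP; field; rewrite lt0r_neq0.
have AP0 : 0 <= cabs lam ^+ 2 * pairing q lam.
  by rewrite mulr_ge0 ?pairing_ge0 ?exprn_ge0 ?cabs_ge0.
rewrite [leLHS](_ : _ = 8 * ((cabs lam ^+ 2 * pairing q lam) * rho)); last by ring.
apply: le_trans (ler_wpM2l (ler0n _ 8) (ler_pM AP0 rho0 P1 rb)) _.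
rewrite [leLHS](_ : _ = e / 2 * (sqn q / (sqn q + 1))); last by field; rewrite !lt0r_neq0.
by rewrite ler_piMr ?(ltW e20)// ler_pdivrMr// mul1r lerDl.
Qed.

Lemma L2_sqint (q : R -> R[i]) : L2 q -> sqint q /\ L2norm q ^+ 2 = sqn q.
Proof.
move=> [mr mi]; rewrite /L2norm /Lnorm2 unlock.
have -> : (\int[mu]_x (`|(complex.Re `|q x|)%:E| `^ 2)%E = \int[mu]_x (cabs (q x) ^+ 2)%:E)%E.
  apply: eq_integral => x _.
  by rewrite abse_EFin poweR_EFin -/(cabs (q x)) ger0_norm ?cabs_ge0// powR_mulrn ?cabs_ge0.
set I := (\int[mu]_x _)%E => Ioo.
have I0 : (0 <= I)%E by apply: integral_ge0 => x _; rewrite lee_fin exprn_ge0 ?cabs_ge0.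
have mq : cmeas q by [].
have Ifin : (I < +oo)%E.
  rewrite ltNge leye_eq; apply/negP => /eqP IE; move: Ioo.
  by rewrite IE poweRyr.
have hq : sqint q.
  split => //; apply/integrableP; split.
    by apply/measurable_EFinP; apply: measurable_funX; exact: measurable_cabs.
  by under eq_integral do rewrite /= ger0_norm ?exprn_ge0 ?cabs_ge0//.
split => //; have -> : I = (sqn q)%:E by rewrite /sqn /Rintegral fineK// ge0_fin_numE.
by rewrite poweR_EFin /= powR12_sqrt ?sqn_ge0// sqr_sqrtr// sqn_ge0.
Qed.

Lemma sector_near (delta W : R) : 0 < delta -> 0 < W ->
  sector_oo delta [set lam : R[i] | W <= w lam /\ delta * cabs lam ^+ 2 <= w lam].
Proof.
(* Beyond 1 one has $|\lambda|\le|\lambda|^2$, so $|\lambda|>W/\delta$ already gives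
   $\delta|\lambda|^2\ge W$. *)
move=> d0 W0; exists (Num.max 1 (W / delta)) => lam; rewrite gt_max => /andP[l1 lW].
rewrite -/(cabs lam) -/(cabs (lam ^+ 2)) cabsX => dw; split => //.
apply: le_trans dw; rewrite -/(cabs lam) in l1 lW.
rewrite mulrC -ler_pdivrMr//; apply: le_trans (ltW lW) _.
by rewrite expr2 ler_peMl ?cabs_ge0// ltW.
Qed.

Lemma sector_mono (delta : R) (A B : set R[i]) :
  sector_oo delta A -> A `<=` B -> sector_oo delta B.
Proof. by move=> [M HM] AB; exists M => lam /HM h /h /AB. Qed.

Lemma ln_s11_sector (q : R -> R[i]) (delta : R) : L2 q -> 0 < delta ->
  [/\ (\forall lambda \near sector_oo delta,
         ln_s11_converges q lambda /\ cexp (ln_s11 q lambda) = s11 q lambda),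
      cvgC (ln_s11 q) (sector_oo delta) (- ('i%C / 2%:R) * (L2norm q ^+ 2)%:C%C) &
      cvgC (s11 q) (sector_oo delta) (cexp (- ('i%C / 2%:R) * (L2norm q ^+ 2)%:C%C))].
Proof.
move=> /L2_sqint[hq ->] d0; set l := - ('i%C / 2%:R) * _.
have lnE (lam S : R[i]) : cvgC (fun n => \sum_(1 <= j < n.+1) b_hom q lam j) \oo S ->
    ln_s11_converges q lam /\ ln_s11 q lam = S.
  move=> cS; split; first by apply/cvg_ex; exists S.
  exact: (cvg_lim (@norm_hausdorff _ R[i]^o) cS).
have sec e : 0 < e -> exists2 W, 0 < W & forall lam, W <= w lam ->
    delta * cabs lam ^+ 2 <= w lam -> [/\ ln_s11_converges q lam,
    cexp (ln_s11 q lam) = s11 q lam & cabs (ln_s11 q lam - l) <= e].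
  move=> e0; have [W W0 HW] := s11_sector hq d0 e0; exists W => // lam Ww dw.
  have [S [sS /lnE[cS SE] Sl]] := HW lam Ww dw; rewrite SE sS; split => //.
  by rewrite /l mulNr opprK.
have near e : 0 < e -> sector_oo delta [set lam | [/\ ln_s11_converges q lam,
    cexp (ln_s11 q lam) = s11 q lam & cabs (ln_s11 q lam - l) <= e]].
  move=> e0; have [W W0 HW] := sec e e0.
  by apply: sector_mono (sector_near d0 W0) _ => lam [Ww dw]; exact: HW.
have ln_cvg : cvgC (ln_s11 q) (sector_oo delta) l.
  apply/cvgCP => [A B|e e0]; first exact: sector_mono.
  have e20 : 0 < e / 2 by rewrite divr_gt0.
  apply: sector_mono (near _ e20) _ => lam [_ _ H] /=; apply: le_lt_trans H _.
  by rewrite ltr_pdivrMr// ltr_pMr// ltr1n.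
split => //.
  by apply: sector_mono (near 1 ltr01) _ => lam [].
have FF : Filter (sector_oo delta).
  split.
  - by exists 0.
  - move=> A B [M HM] [N HN]; exists (Num.max M N) => lam; rewrite gt_max => /andP[lM lN] h.
    by split; [exact: HM|exact: HN].
  - by move=> A B AB HA; exact: sector_mono HA AB.
have := cvgC_cexp (FF := FF) ln_cvg; rewrite !cvgCP; try exact: sector_mono.
move=> H e e0; have H1 := H e e0; have H2 := near 1 ltr01.
(* The identity between [s11] and the exponential of [ln_s11] holds only far out in the sector,
   hence the intersection with the convergence set. *)
apply: sector_mono (filterI H1 H2) _ => lam [/= H3 [_ <- _]].
exact: H3.
Qed.

End LargeLambda.

Theorem theorem1p1 (R : realType) :
  ((forall (q : R -> R[i]) (lambda : R[i]),
      L2 q -> 0 < complex.Im (lambda ^+ 2) ->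
      homogeneous_expansion q lambda (s_hom q lambda)) /\
   (forall j : nat, (0 < j)%N ->
      exists c : (j.*2).-tuple bool -> R[i],
        forall (q : R -> R[i]) (lambda : R[i]),
          L2 q -> 0 < complex.Im (lambda ^+ 2) ->
          b_hom q lambda j =
            \sum_(w : (j.*2).-tuple bool | connected_word j w)
              c w * word_integral q lambda j w)) /\
  (forall q : R -> R[i], L2 q ->
     forall delta : R, 0 < delta ->
       [/\ (\forall lambda \near sector_oo delta,
              ln_s11_converges q lambda /\
              cexp (ln_s11 q lambda) = s11 q lambda),
           cvgC (ln_s11 q) (sector_oo delta)
             (- ('i%C / 2%:R) * (L2norm q ^+ 2)%:C%C) &
           cvgC (s11 q) (sector_oo delta)
             (cexp (- ('i%C / 2%:R) * (L2norm q ^+ 2)%:C%C))]).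
Proof.
split; last by move=> q hq delta; exact: ln_s11_sector.
split=> [q lambda /L2_sqint[hq _] w0|j j0]; first by case: (s_homE hq w0).
exists (@word_coef R j) => q lambda /L2_sqint[hq _] w0.
exact: b_hom_connected.
Qed.
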